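(* Consider the closed-loop system described in the context, with nominal values $r_e\in\mathbb{R}$, $d_e\in L^2(0,L)$ and associated deviations $\Delta u_D,\Delta\zeta,\Delta w,\Delta r,\Delta d$. There exist constants $\kappa,\overline{C}_1>0$ such that, for every $\epsilon\in[0,1)$, there exists $\overline{C}_2(\epsilon)>0$ such that, along every closed-loop trajectory and for every $t\geq 0$, $$\Delta u_D(t)^2+\Delta\zeta(t)^2+\Vert\Delta w(t)\Vert_{H_0^1(0,L)}^2\leq \overline{C}_1 e^{-2\kappa t}\left(\Delta u_D(0)^2+\Delta\zeta(0)^2+\Vert\Delta w(0)\Vert_{H_0^1(0,L)}^2\right)+\overline{C}_2(\epsilon)\sup_{0\leq s\leq t}e^{-2\epsilon\kappa(t-s)}\left\{\Delta r(s)^2+\Vert\Delta d(s)\Vert^2\right\}.$$ Moreover, the constants $\kappa,\overline{C}_1,\overline{C}_2(\epsilon)$ can be chosen independently of $r_e$ and $d_e$.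
   Context: Notation. $\mathbb{R}_+=[0,+\infty)$, $\mathbb{N}=\{0,1,2,\dots\}$. Fix $L>0$, $D>0$ and a real-valued $c\in L^\infty(0,L)$. $\langle f,g\rangle=\int_0^L f(x)g(x)\,dx$ on $L^2(0,L)$; $\Vert\cdot\Vert$ is the $L^2(0,L)$ norm for functions, the Euclidean norm for vectors and the induced norm for matrices; $\Vert f\Vert_{H_0^1(0,L)}=\Vert f'\Vert_{L^2(0,L)}$. Spectral data. $\mathcal{A}f=f''+cf$ on $D(\mathcal{A})=H^2(0,L)\cap H_0^1(0,L)$, a self-adjoint operator with compact resolvent in $L^2(0,L)$. $(e_j)_{j\geq1}$ is a Hilbert basis of $L^2(0,L)$ of real eigenfunctions, $\mathcal{A}e_j=\lambda_je_j$, with $\lambda_1>\lambda_2>\cdots\to-\infty$. $n\in\mathbb{N}$ is the integer with $\lambda_j\geq0$ for $1\leq j\leq n$ and $\lambda_j\leq\lambda_{n+1}<0$ for $j\geq n+1$ ($n=0$ allowed). Put $a(x)=\frac{x}{L}c(x)$, $b(x)=-\frac{x}{L}$, $a_j=\langle a,e_j\rangle$, $b_j=\langle b,e_j\rangle$, $\alpha=\frac1L-\sum_{j\geq n+1}\frac{e_j'(0)}{\lambda_j}a_j$, $\beta=-\sum_{j\geq n+1}\frac{e_j'(0)}{\lambda_j}b_j$. Matrices. $A_1\in\mathbb{R}^{(n+1)\times(n+1)}$ has zero first row, first column $(0,a_1,\dots,a_n)^\top$, and lower-right $n\times n$ block $\mathrm{diag}(\lambda_1,\dots,\lambda_n)$;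 $B_1=(1,b_1,\dots,b_n)^\top$; $L_1=(\alpha,e_1'(0),\dots,e_n'(0))$; $A=\begin{pmatrix}A_1&0\\L_1&0\end{pmatrix}\in\mathbb{R}^{(n+2)\times(n+2)}$, $B=\begin{pmatrix}B_1\\\beta\end{pmatrix}\in\mathbb{R}^{n+2}$. A gain $K\in\mathbb{R}^{1\times(n+2)}$ is fixed such that $A_K=A+e^{-DA}BK$ is Hurwitz. Closed-loop system. Data: $r:\mathbb{R}_+\to\mathbb{R}$ continuous, $d:\mathbb{R}_+\to L^2(0,L)$ continuously differentiable, $y_0\in H^2(0,L)\cap H_0^1(0,L)$, $z_0\in\mathbb{R}$. The system is $y_t=y_{xx}+c(x)y+d(t,x)$, $\dot z(t)=y_x(t,0)-r(t)$, $y(t,0)=0$, $y(t,L)=u_D(t):=u(t-D)$, $y(0,\cdot)=y_0$, $z(0)=z_0$, where $u(t)=0$ for $t<0$ and $u(t)=\int_0^tv(\tau)\,d\tau$ for $t\geq0$. Write $v_D(t)=v(t-D)$, $w(t,x)=y(t,x)-\frac{x}{L}u_D(t)$, $w_j(t)=\langle w(t,\cdot),e_j\rangle$, $\zeta(t)=z(t)-\sum_{j\geq n+1}\frac{e_j'(0)}{\lambda_j}w_j(t)$, $X=(u_D,w_1,\dots,w_n,\zeta)^\top\in\mathbb{R}^{n+2}$. The control is $v(t)=0$ for $t<0$ and $v(t)=KZ(t)$ for $t\geq0$, with $Z(t)=X(t)+\int_{t-D}^te^{A(t-D-\tau)}Bv(\tau)\,d\tau$. Thus $w_t=\mathcal{A}w+a\,u_D+b\,v_D+d$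 with $w(t,\cdot)\in D(\mathcal{A})$, $w(0)=y_0$, and $\dot z(t)=w_x(t,0)+\frac1Lu_D(t)-r(t)$. Equilibrium and deviations. For $r_e\in\mathbb{R}$, $d_e\in L^2(0,L)$, let $d_{e,j}=\langle d_e,e_j\rangle$, $\Gamma_e=\big(0,d_{e,1},\dots,d_{e,n},-r_e-\sum_{j\geq n+1}\frac{e_j'(0)}{\lambda_j}d_{e,j}\big)^\top$, $Z_e=X_e=-A_K^{-1}\Gamma_e=:(u_e,w_{1,e},\dots,w_{n,e},\zeta_e)^\top$, $w_{j,e}=-\frac{a_j}{\lambda_j}u_e-\frac{d_{e,j}}{\lambda_j}$ for $j\geq n+1$, $w_e=\sum_{j\geq1}w_{j,e}e_j\in D(\mathcal{A})$. Deviations: $\Delta r=r-r_e$, $\Delta d=d-d_e$, $\Delta u_D=u_D-u_e$, $\Delta\zeta=\zeta-\zeta_e$, $\Delta w=w-w_e$. *)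

(* Defs.v *)
From HB Require Import structures.
From mathcomp Require Import all_boot all_order all_algebra.
From mathcomp Require Import all_classical all_reals all_analysis.
From mathcomp Require Import complex.

Set Implicit Arguments.
Unset Strict Implicit.
Unset Printing Implicit Defensive.

Import Order.TTheory GRing.Theory Num.Theory.
Import numFieldNormedType.Exports.

Local Open Scope classical_set_scope.
Local Open Scope ring_scope.

Section FunctionSpaces.
Context {R : realType}.
Local Notation mu := (@lebesgue_measure R).
Variable L : R.

(* Elements of L^2(0,L) are represented by functions on R of which only the
   values on [0,L] matter; equality in L^2 is equality almost everywhere. *)
Definition L2 (f : R -> R) : Prop :=
  measurable_fun `[0, L] f /\
  mu.-integrable `[0, L] (EFin \o (fun x => f x ^+ 2)).

Definition Linfty (f : R -> R) : Prop :=
  measurable_fun `[0, L] f /\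
  exists M : R, {ae mu, forall x, x \in `[0, L] -> `|f x| <= M}.

Definition ip (f g : R -> R) : R := \int[mu]_(x in `[0, L]) (f x * g x).

Definition l2norm (f : R -> R) : R := Num.sqrt (ip f f).

(* H^2(0,L) in dimension one: f is C^1 on [0,L] and f' is an indefinite
   integral of an L^2 function.  The continuous derivative f' (hence its trace
   at 0) and a representative of f'' are carried along with f. *)
Record H2 : Type := MkH2 {
  h2val :> R -> R;
  dx : R -> R;
  dxx : R -> R;
  dxx_L2 : L2 dxx;
  dxE : forall x, x \in `[0, L] -> dx x = dx 0 + \int[mu]_(s in `[0, x]) dxx s;
  h2valE : forall x, x \in `[0, L] ->
    h2val x = h2val 0 + \int[mu]_(s in `[0, x]) dx s }.

(* Membership in H^1_0(0,L), for an element of H^2(0,L). *)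
Definition dirichlet (f : H2) : Prop := f 0 = 0 /\ f L = 0.

(* Functions in H^1(0,L) are differentiable a.e. in the classical sense and the
   classical derivative is the weak one; for f in C^1([0,L]) only the endpoints
   are affected by the values of f outside [0,L]. *)
Definition H10norm (f : R -> R) : R := l2norm (derive1 f).

(* Sum of a series in L^2(0,L). *)
Definition L2_sum (u : nat -> R -> R) (f : R -> R) : Prop :=
  l2norm (fun x => f x - \sum_(0 <= j < N) u j x) @[N --> \oo] --> 0.

Definition hilbert_basis (e : nat -> R -> R) : Prop :=
  [/\ forall j, L2 (e j),
      forall i j, ip (e i) (e j) = (i == j)%:R
    & forall f, L2 f -> L2_sum (fun j x => ip f (e j) * e j x) f].

(* Maps from [0,+oo) to L^2(0,L); the derivative at t = 0 is one-sided. *)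
Definition L2_continuous (F : R -> R -> R) : Prop :=
  forall t, 0 <= t ->
    l2norm (fun x => F s x - F t x) @[s --> within [set s | 0 <= s] (nbhs t)]
      --> 0.

Definition L2_has_derivative (F : R -> R -> R) (t : R) (G : R -> R) : Prop :=
  l2norm (fun x => (F s x - F t x) / (s - t) - G x)
    @[s --> within [set s | 0 <= s] t^'] --> 0.

Definition L2_C1 (F : R -> R -> R) : Prop :=
  (forall t, 0 <= t -> L2 (F t)) /\
  exists F' : R -> R -> R,
    [/\ forall t, 0 <= t -> L2 (F' t),
        forall t, 0 <= t -> L2_has_derivative F t (F' t)
      & L2_continuous F'].

Definition has_derivative_halfline (z : R -> R) (t l : R) : Prop :=
  (z s - z t) / (s - t) @[s --> within [set s | 0 <= s] t^'] --> l.

(* The operator f |-> f'' + c f, to be used on functions f with dirichlet f. *)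
Definition calA (c : R -> R) (f : H2) : R -> R :=
  fun x => dxx f x + c x * f x.

End FunctionSpaces.

Section Matrices.
Context {R : realType}.

Definition expmx (m : nat) (M : 'M[R]_m) : 'M[R]_m :=
  \matrix_(i, j) limn (series (fun k => (k`!%:R)^-1 * (M ^+ k) i j)).

Definition hurwitz (m : nat) (M : 'M[R]_m) : Prop :=
  forall z : R[i], eigenvalue (map_mx (real_complex R) M) z ->
    complex.Re z < 0.

End Matrices.

(* Eigenpairs are indexed from 0: e j and lam j stand for e_{j+1} and
   lambda_{j+1}, so that a sum over j >= n+1 becomes one over (n <= j). *)
Record spectral_data (R : realType) (L : R) (c : R -> R)
    (e : nat -> H2 L) (lam : nat -> R) : Prop := SpectralData {
  eig_dirichlet : forall j, dirichlet (e j);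
  eig_eq : forall j, {ae @lebesgue_measure R, forall x, x \in `[0, L] ->
    calA c (e j) x = lam j * e j x};
  eig_basis : hilbert_basis L (fun j => e j : R -> R);
  eig_decr : forall i j, (i < j)%N -> lam j < lam i;
  eig_lim : lam j @[j --> \oo] --> -oo }.

Definition unstable_count (R : realType) (lam : nat -> R) (n : nat) : Prop :=
  [/\ forall j, (j < n)%N -> 0 <= lam j,
      forall j, (n <= j)%N -> lam j <= lam n
    & lam n < 0].

Section ReducedModel.
Context {R : realType}.
Local Notation mu := (@lebesgue_measure R).
Variables (L D : R) (c : R -> R) (e : nat -> H2 L) (lam : nat -> R) (n : nat).

Definition afun : R -> R := fun x => x / L * c x.
Definition bfun : R -> R := fun x => - (x / L).
Definition acoef (j : nat) : R := ip L afun (e j).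
Definition bcoef (j : nat) : R := ip L bfun (e j).

(* The terms are summable whenever f is the sequence of coefficients of an
   L^2 function, since e_j'(0) / lam_j is square-summable. *)
Definition tail (f : nat -> R) : R :=
  limn (fun N => \sum_(n <= j < N) dx (e j) 0 / lam j * f j).

Definition alpha : R := L^-1 - tail acoef.
Definition beta : R := - tail bcoef.

Definition A1 : 'M[R]_(1 + n) :=
  block_mx 0 0 (\col_(j < n) acoef j) (diag_mx (\row_(j < n) lam j)).
Definition B1 : 'cV[R]_(1 + n) := col_mx 1%:M (\col_(j < n) bcoef j).
Definition L1 : 'rV[R]_(1 + n) := row_mx alpha%:M (\row_(j < n) dx (e j) 0).

Definition Amx : 'M[R]_(1 + n + 1) := block_mx A1 0 L1 0.
Definition Bmx : 'cV[R]_(1 + n + 1) := col_mx B1 beta%:M.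

Definition AK (K : 'rV[R]_(1 + n + 1)) : 'M[R]_(1 + n + 1) :=
  Amx + expmx (- D *: Amx) *m Bmx *m K.

(* Column vector (u, w_1, ..., w_n, zeta). *)
Definition state (u : R) (w : nat -> R) (zeta : R) : 'cV[R]_(1 + n + 1) :=
  col_mx (col_mx u%:M (\col_(j < n) w j)) zeta%:M.

Section Equilibrium.
Variables (K : 'rV[R]_(1 + n + 1)) (re : R) (de : R -> R).

Definition decoef (j : nat) : R := ip L de (e j).

Definition Gamma_e : 'cV[R]_(1 + n + 1) := state 0 decoef (- re - tail decoef).

Definition Xe : 'cV[R]_(1 + n + 1) := - (invmx (AK K) *m Gamma_e).

Definition u_e : R := usubmx (usubmx Xe) 0 0.
Definition zeta_e : R := dsubmx Xe 0 0.

Definition wcoef_e (j : nat) : R :=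
  if insub j is Some i then dsubmx (usubmx Xe) (i : 'I_n) 0
  else - (acoef j / lam j) * u_e - decoef j / lam j.

Definition equilibrium_profile (we : H2 L) : Prop :=
  dirichlet we /\ L2_sum L (fun j x => wcoef_e j * e j x) we.

End Equilibrium.

Section Trajectory.
Variables (v : R -> R) (y : R -> H2 L) (z : R -> R).

Definition input (t : R) : R :=
  if t < 0 then 0 else \int[mu]_(tau in `[0, t]) v tau.
Definition uD (t : R) : R := input (t - D).

Definition wfun (t : R) : R -> R := fun x => y t x - x / L * uD t.
Definition wcoef (t : R) (j : nat) : R := ip L (wfun t) (e j).
Definition zeta (t : R) : R := z t - tail (wcoef t).
Definition Xvec (t : R) : 'cV[R]_(1 + n + 1) := state (uD t) (wcoef t) (zeta t).

Definition Zvec (t : R) : 'cV[R]_(1 + n + 1) :=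
  Xvec t + \col_i \int[mu]_(tau in `[t - D, t])
    ((expmx ((t - D - tau) *: Amx) *m Bmx) i 0 * v tau).

(* Classical solutions, with y in C([0,+oo); H^2(0,L)); the evolution equation
   holds in L^2(0,L) at every time. The control v may jump at 0. *)
Record closed_loop (K : 'rV[R]_(1 + n + 1)) (r : R -> R) (d : R -> R -> R)
    (y0 : H2 L) (z0 : R) : Prop := ClosedLoop {
  control_neg : forall t, t < 0 -> v t = 0;
  control_loc : forall T, mu.-integrable `[0, T] (EFin \o v);
  control_law : forall t, 0 <= t -> v t = (K *m Zvec t) 0 0;
  y_cont : L2_continuous L (fun t => y t : R -> R);
  y_dx_cont : L2_continuous L (fun t => dx (y t));
  y_dxx_cont : L2_continuous L (fun t => dxx (y t));
  y_pde : forall t, 0 <= t ->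
    L2_has_derivative L (fun s => y s : R -> R) t
      (fun x => dxx (y t) x + c x * y t x + d t x);
  y_left : forall t, 0 <= t -> y t 0 = 0;
  y_right : forall t, 0 <= t -> y t L = uD t;
  y_init : forall x, x \in `[0, L] -> y 0 x = y0 x;
  z_ode : forall t, 0 <= t ->
    has_derivative_halfline z t (dx (y t) 0 - r t);
  z_init : z 0 = z0 }.

End Trajectory.

End ReducedModel.

(* Main.v *)
(* In the coordinates X = (u_D, w_1, ..., w_n, zeta) the deviation from the
   equilibrium solves X' = A X + B v_D + Gamma, where the tail sum in zeta absorbs
   the trace w_x(t, 0): e_j'(0) / lam_j is square summable, and f'(0) is the sum of
   the e_j'(0) <f, e_j> for f in D(A). The predictor Z = X + delay term then solves
   Z' = A_K Z + Gamma, the nominal control being 0 at the equilibrium.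

   All estimates are comparisons with one positive gauge E, the right-hand side of
   the theorem as a function of time, which satisfies E' >= - rho E and
   E(s) <= e^(rho D) E(t) for t - D <= s <= t. If h' <= - mu h + a E with mu > rho,
   then h <= M E with M depending only on mu - rho, a and h(0) / E(0). This is
   applied first to a Lyapunov function of Z, which bounds v and the delay term,
   hence X; then to the partial sums of - lam_j w_j^2 over j >= n, whose supremum
   controls the H^1_0 norm because <A w, w> = - |w'|^2 + <c w, w>. *)

Require Import Defs.
From HB Require Import structures.
From mathcomp Require Import all_boot all_order all_algebra.
From mathcomp Require Import all_classical all_reals all_analysis.
From mathcomp Require Import measurable_realfun.
From mathcomp Require Import complex ring lra.

Set Implicit Arguments.
Unset Strict Implicit.
Unset Printing Implicit Defensive.

Import Order.TTheory GRing.Theory Num.Theory.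
Import numFieldNormedType.Exports.
Local Open Scope classical_set_scope.
Local Open Scope ring_scope.

(** The solution is differentiable in time only as an L^2-valued map, so the H^1_0 norm of the
    deviation cannot be differentiated directly. Only bounded linear functionals of y(t), namely the
    coefficients and the tail sum, are differentiated; partial sums of - lam_j w_j^2 then obey a
    differential inequality whose constants do not depend on the number of terms.

    The feedback may make v jump at 0, so u_D, and everything built on it, may fail to be
    differentiable at t = D; the comparison argument therefore allows one exceptional time.

    A running supremum has no useful derivative. The gauge is built for a fixed horizon T: E(s) =
    energy(0) e^(- rho s) + sigma e^(eps rho (T - s)), where sigma is the supremum of the theorem at
    t = T. Then E(T) is the right-hand side up to constants, and sigma and eps enter the estimates
    only through E, so the constants depend neither on eps nor on the nominal values. The rate rho =
    2 kappa lies below both the decay rate of the Lyapunov function and - lam_n. *)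

Lemma cvg0_mulr {R : realType} (T : Type) (F : set_system T) (FF : Filter F)
    (f : T -> R) (k : R) : f x @[x --> F] --> 0 -> f x * k @[x --> F] --> 0.
Proof.
by move=> f0; rewrite -(mul0r k); apply: cvgM f0 _; exact: cvg_cst.
Qed.

(** * The space L^2(0,L) *)

Section L2Theory.
Context {R : realType}.
Local Notation mu := (@lebesgue_measure R).
Variable L : R.
Implicit Types f g h : R -> R.

Let mI : measurable (`[0, L] : set (g_sigma_algebraType R.-ocitv.-measurable)).
Proof. exact: measurable_itv. Qed.

Lemma L2_integrableM f g : L2 L f -> L2 L g ->
  mu.-integrable `[0, L] (EFin \o (fun x => f x * g x)).
Proof.
move=> [mf f2] [mg g2].
have fg : mu.-integrable `[0, L] (EFin \o (fun x => f x ^+ 2 + g x ^+ 2)).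
  by have := integrableD mI f2 g2; apply: eq_integrable.
apply: (le_integrable _ _ _ fg) => //.
  by apply/measurable_EFinP; exact: measurable_funM.
move=> x _ /=; rewrite lee_fin [leRHS]ger0_norm ?addr_ge0 ?sqr_ge0//.
rewrite ler_norml; apply/andP; split; nra.
Qed.

Lemma L2_integrable f : L2 L f -> mu.-integrable `[0, L] (EFin \o f).
Proof.
move=> Lf.
have L1 : L2 L (fun=> 1).
  split; first exact: measurable_cst.
  apply: measurable_bounded_integrable => //.
  - by rewrite /= lebesgue_measure_itv/=; case: ifPn; rewrite ?ltry.
  - by exists 1; split => // M M1 x _; rewrite expr1n normr1 ltW.
by have := L2_integrableM Lf L1; apply: eq_integrable => // x _ /=; rewrite mulr1.
Qed.

Lemma L2D f g : L2 L f -> L2 L g -> L2 L (fun x => f x + g x).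
Proof.
move=> Lf Lg; split; first exact: measurable_funD Lf.1 Lg.1.
have i1 := integrableD mI Lf.2 Lg.2.
have i2 := integrableZl mI 2 (L2_integrableM Lf Lg).
have := integrableD mI i1 i2; apply: eq_integrable => // x _ /=.
by rewrite -!EFinM -!EFinD sqrrD; congr EFin; ring.
Qed.

Lemma L2Z k f : L2 L f -> L2 L (fun x => k * f x).
Proof.
move=> Lf; split; first by apply: measurable_funM => //; exact: Lf.1.
have := integrableZl mI (k ^+ 2) Lf.2.
by apply: eq_integrable => // x _ /=; rewrite exprMn.
Qed.

Lemma L2N f : L2 L f -> L2 L (fun x => - f x).
Proof.
by move=> /(L2Z (-1)); under eq_fun do rewrite mulN1r.
Qed.

Lemma L2B f g : L2 L f -> L2 L g -> L2 L (fun x => f x - g x).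
Proof. by move=> Lf Lg; exact/L2D/L2N. Qed.

Lemma L2_0 : L2 L (fun=> 0).
Proof.
split; first exact: measurable_cst.
by rewrite (_ : _ \o _ = cst 0%E) ?integrable0//; apply/funext => x /=; rewrite expr0n.
Qed.

Lemma L2_sumr (I : Type) (r : seq I) (P : pred I) (F : I -> R -> R) :
  (forall i, P i -> L2 L (F i)) -> L2 L (fun x => \sum_(i <- r | P i) F i x).
Proof.
move=> LF; elim: r => [|i r IH].
  by under eq_fun do rewrite big_nil; exact: L2_0.
under eq_fun do rewrite big_cons; case Pi: (P i) => //.
exact: L2D (LF _ Pi) IH.
Qed.

Lemma L2_bounded f (M : R) : measurable_fun `[0, L] f ->
  {ae mu, forall x, x \in `[0, L] -> `|f x| <= M} -> L2 L f.
Proof.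
move=> mf fM; split => //.
apply/integrableP; split.
  by apply/measurable_EFinP; exact: measurable_funX.
apply: (@le_lt_trans _ _ (\int[mu]_(x in `[0%R, L]) (M ^+ 2)%R%:E)%E).
  apply: ae_ge0_le_integral => //.
  - apply/measurable_EFinP; apply: measurableT_comp => //.
    exact: measurable_funX.
  - by move=> x _; rewrite lee_fin sqr_ge0.
  - move: fM; apply: (@filterS _ _ (ae_filter_ringOfSetsType mu)) => x fM xL /=.
    rewrite lee_fin ger0_norm ?sqr_ge0// -real_normK ?num_real//.
    by rewrite lerXn2r ?nnegrE ?fM// (le_trans _ (fM xL)).
rewrite integral_cst//= lebesgue_measure_itv/=.
by case: ifPn => _; rewrite ?mule0// -EFinM ltry.
Qed.

Lemma L2_bounded_mul f g : Linfty L f -> L2 L g -> L2 L (fun x => f x * g x).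
Proof.
move=> [mf [M fM]] Lg; split; first exact: measurable_funM mf Lg.1.
apply/integrableP; split.
  by apply/measurable_EFinP/measurable_funX; exact: measurable_funM mf Lg.1.
apply: (@le_lt_trans _ _ (\int[mu]_(x in `[0%R, L]) (M ^+ 2 * g x ^+ 2)%R%:E)%E).
  apply: ae_ge0_le_integral => //.
  - apply/measurable_EFinP; apply: measurableT_comp => //.
    by apply/measurable_funX; exact: measurable_funM mf Lg.1.
  - by move=> x _; rewrite lee_fin mulr_ge0 ?sqr_ge0.
  - apply/measurable_EFinP; apply: measurable_funM => //.
    exact: measurable_funX Lg.1.
  - move: fM; apply: (@filterS _ _ (ae_filter_ringOfSetsType mu)) => x fM xL /=.
    rewrite lee_fin ger0_norm ?sqr_ge0// exprMn ler_wpM2r ?sqr_ge0//.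
    rewrite -real_normK ?num_real// lerXn2r ?nnegrE ?fM//.
    by rewrite (le_trans _ (fM xL)).
have /integrableP[_] := (L2Z M Lg).2.
congr (_ < _)%E; apply: eq_integral => x _ /=.
by rewrite ger0_norm ?sqr_ge0// exprMn.
Qed.

Lemma L2_cst k : L2 L (fun=> k).
Proof. by apply: (@L2_bounded _ `|k|) => //; apply: aeW. Qed.

Lemma ipC f g : ip L f g = ip L g f.
Proof. by apply: eq_Rintegral => x _; rewrite mulrC. Qed.

Lemma eq_ip f f' g g' : {in `[0, L], f =1 f'} -> {in `[0, L], g =1 g'} ->
  ip L f g = ip L f' g'.
Proof.
move=> ff' gg'; apply: eq_Rintegral => x; rewrite inE/= => xL.
by rewrite ff'// gg'.
Qed.

Lemma ipDl f g h : L2 L f -> L2 L g -> L2 L h ->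
  ip L (fun x => f x + g x) h = ip L f h + ip L g h.
Proof.
move=> Lf Lg Lh; rewrite /ip -RintegralD//; try exact: L2_integrableM.
by apply: eq_Rintegral => x _; rewrite mulrDl.
Qed.

Lemma ipZl k f g : L2 L f -> L2 L g -> ip L (fun x => k * f x) g = k * ip L f g.
Proof.
move=> Lf Lg; rewrite /ip -RintegralZl//; last exact: L2_integrableM.
by apply: eq_Rintegral => x _; rewrite mulrA.
Qed.

Lemma ipNl f g : L2 L f -> L2 L g -> ip L (fun x => - f x) g = - ip L f g.
Proof.
move=> Lf Lg; rewrite -[RHS]mulN1r -ipZl//.
by apply: eq_Rintegral => x _; rewrite mulN1r.
Qed.

Lemma ipBl f g h : L2 L f -> L2 L g -> L2 L h ->
  ip L (fun x => f x - g x) h = ip L f h - ip L g h.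
Proof. by move=> Lf Lg Lh; rewrite ipDl ?ipNl//; exact: L2N. Qed.

Lemma ip0l g : ip L (fun=> 0) g = 0.
Proof.
rewrite /ip; under eq_Rintegral do rewrite mul0r.
by rewrite Rintegral_cst// mul0r.
Qed.

Lemma ip_suml (I : Type) (r : seq I) (P : pred I) (F : I -> R -> R) g :
  (forall i, P i -> L2 L (F i)) -> L2 L g ->
  ip L (fun x => \sum_(i <- r | P i) F i x) g = \sum_(i <- r | P i) ip L (F i) g.
Proof.
move=> LF Lg; elim: r => [|i r IH].
  by rewrite big_nil -[RHS](ip0l g); apply: eq_ip => // x _; rewrite big_nil.
rewrite big_cons -IH; case Pi: (P i); last first.
  by apply: eq_ip => // x _; rewrite big_cons Pi.
rewrite -ipDl//; [|exact: LF|exact: L2_sumr].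
by apply: eq_ip => // x _; rewrite big_cons Pi.
Qed.

Lemma ip_ge0 f : 0 <= ip L f f.
Proof. by apply: Rintegral_ge0 => x _; rewrite -expr2 sqr_ge0. Qed.

Lemma sqr_l2norm f : l2norm L f ^+ 2 = ip L f f.
Proof. by rewrite sqr_sqrtr ?ip_ge0. Qed.

Lemma l2norm_ge0 f : 0 <= l2norm L f.
Proof. exact: sqrtr_ge0. Qed.

Lemma ip_sub_sqr k f g : L2 L f -> L2 L g ->
  ip L (fun x => f x - k * g x) (fun x => f x - k * g x) =
  ip L f f - 2 * k * ip L f g + k ^+ 2 * ip L g g.
Proof.
move=> Lf Lg; have Lk := L2Z k Lg; have Ls := L2B Lf Lk.
rewrite ipBl// ipZl// ![ip L _ (fun x => _ - _)]ipC !ipBl// !ipZl//.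
by rewrite (ipC g f); ring.
Qed.

Lemma cauchy_schwarz f g : L2 L f -> L2 L g ->
  ip L f g ^+ 2 <= ip L f f * ip L g g.
Proof.
move=> Lf Lg; have [g0|gN0] := eqVneq (ip L g g) 0.
  suff -> : ip L f g = 0 by rewrite g0 mulr0 expr0n.
  apply/eqP/negP => /negP fgN0.
  (* When <g, g> = 0 the quadratic in k is affine, and this k gives it the value -1. *)
  have := ip_ge0 (fun x => f x - ((ip L f f + 1) / (2 * ip L f g)) * g x).
  rewrite ip_sub_sqr// g0 mulr0 addr0.
  suff -> : 2 * ((ip L f f + 1) / (2 * ip L f g)) * ip L f g = ip L f f + 1 by lra.
  by field; rewrite fgN0.
have g0 : 0 < ip L g g by rewrite lt_neqAle eq_sym gN0 ip_ge0.
have := ip_ge0 (fun x => f x - (ip L f g / ip L g g) * g x).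
rewrite ip_sub_sqr//.
suff -> : ip L f f - 2 * (ip L f g / ip L g g) * ip L f g
  + (ip L f g / ip L g g) ^+ 2 * ip L g g = ip L f f - ip L f g ^+ 2 / ip L g g.
  by rewrite subr_ge0 ler_pdivrMr.
by field; rewrite gN0.
Qed.

Lemma normr_ip_le f g : L2 L f -> L2 L g ->
  `|ip L f g| <= l2norm L f * l2norm L g.
Proof.
move=> Lf Lg; rewrite -(@ler_pXn2r _ 2)// ?nnegrE ?mulr_ge0 ?l2norm_ge0//.
by rewrite exprMn !sqr_l2norm real_normK ?num_real// cauchy_schwarz.
Qed.

Lemma ip_sqrD f g : L2 L f -> L2 L g ->
  ip L (fun x => f x + g x) (fun x => f x + g x) <= 2 * (ip L f f + ip L g g).
Proof.
move=> Lf Lg; have Ls := L2D Lf Lg.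
have := ip_ge0 (fun x => f x - 1 * g x).
rewrite ip_sub_sqr// ipDl// ![ip L _ (fun x => _ + _)]ipC !ipDl//.
by rewrite (ipC g f); lra.
Qed.

End L2Theory.

(** * Bessel, Parseval and coefficients in a Hilbert basis *)

Section HilbertBasis.
Context {R : realType}.
Variables (L : R) (e : nat -> R -> R).
Hypothesis He : hilbert_basis L e.
Implicit Types f g h : R -> R.

Let Le j : L2 L (e j). Proof. by case: He. Qed.

Lemma bessel f N : L2 L f -> \sum_(0 <= j < N) ip L f (e j) ^+ 2 <= ip L f f.
Proof.
move=> Lf; have [_ ort _] := He.
pose S := fun x => \sum_(0 <= j < N) ip L f (e j) * e j x.
have LS : L2 L S by apply: L2_sumr => j _; exact: L2Z.
have Se j : (j < N)%N -> ip L S (e j) = ip L f (e j).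
  move=> jN; rewrite ip_suml//; last by move=> *; exact: L2Z.
  rewrite (bigD1_seq j) ?iota_uniq ?mem_index_iota//= ipZl// ort eqxx mulr1.
  rewrite big1 ?addr0// => i ij; rewrite ipZl// ort (negbTE ij) mulr0//.
have Sg g : L2 L g -> ip L S g = \sum_(0 <= j < N) ip L f (e j) * ip L g (e j).
  move=> Lg; rewrite ip_suml//; last by move=> *; exact: L2Z.
  by apply: eq_bigr => j _; rewrite ipZl// (ipC L (e j)).
have fS : ip L f S = \sum_(0 <= j < N) ip L f (e j) ^+ 2.
  by rewrite ipC Sg//; apply: eq_bigr => j _; rewrite expr2.
have SS : ip L S S = \sum_(0 <= j < N) ip L f (e j) ^+ 2.
  rewrite Sg//; rewrite !big_nat; apply: eq_bigr => j /andP[_ jN].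
  by rewrite Se// expr2.
have := ip_ge0 L (fun x => f x - 1 * S x).
by rewrite ip_sub_sqr// fS SS; lra.
Qed.

Lemma L2_sum_ip u f g : (forall j, L2 L (u j)) -> L2 L f -> L2 L g ->
  L2_sum L u f -> (\sum_(0 <= j < N) ip L (u j) g) @[N --> \oo] --> ip L f g.
Proof.
move=> Lu Lf Lg uf.
have h := cvg0_mulr eventually_filter (l2norm L g) uf.
apply/cvgrPdist_le => eps eps0.
move/cvgrPdist_le : h => /(_ _ eps0); apply: filterS => N.
rewrite sub0r normrN ger0_norm ?mulr_ge0 ?l2norm_ge0//; apply: le_trans.
have LS : L2 L (fun x => \sum_(0 <= j < N) u j x) by apply: L2_sumr.
by rewrite -ip_suml// -ipBl//; apply: normr_ip_le => //; exact: L2B.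
Qed.

Lemma parseval f g : L2 L f -> L2 L g ->
  (\sum_(0 <= j < N) ip L f (e j) * ip L g (e j)) @[N --> \oo] --> ip L f g.
Proof.
move=> Lf Lg; have [_ _ tot] := He.
have := L2_sum_ip (fun j => L2Z _ (Le j)) Lf Lg (tot _ Lf).
apply: cvg_trans; apply: near_eq_cvg; near=> N.
by apply: eq_bigr => j _; rewrite ipZl// (ipC L (e j)).
Unshelve. all: by end_near. Qed.

(** For N > j orthonormality makes the j-th coefficient of the N-th partial sum equal to c j, so the
    limit is that of an eventually constant sequence. *)
Lemma L2_sum_coef (c : nat -> R) f : L2 L f ->
  L2_sum L (fun j x => c j * e j x) f -> forall j, ip L f (e j) = c j.
Proof.
move=> Lf cf j; have [_ ort _] := He.
have /cvg_lim := L2_sum_ip (fun i => L2Z (c i) (Le i)) Lf (Le j) cf.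
move=> <-//; apply/cvg_lim => //.
apply: cvg_near_cst; exists j.+1 => // N /= jN.
rewrite (bigD1_seq j) ?iota_uniq ?mem_index_iota//= ipZl// ort eqxx mulr1.
by rewrite big1 ?addr0// => i ij; rewrite ipZl// ort (negbTE ij) mulr0.
Qed.

End HilbertBasis.

(** * Primitives of integrable functions and integration by parts *)

Section AbsolutelyContinuous.
Context {R : realType}.
Local Notation mu := (@lebesgue_measure R).
Variable L : R.
Hypothesis L0 : 0 < L.
Implicit Types f g F G : R -> R.

Let mI (i : interval R) :
  measurable ([set` i] : set (g_sigma_algebraType R.-ocitv.-measurable)).
Proof. exact: measurable_itv. Qed.

(** Absolute continuity in integrated form. The density is only asked to be integrable, so that the
    pair (f', f'') of an H^2 function qualifies. *)
Definition primitive_on F f : Prop :=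
  mu.-integrable `[0, L] (EFin \o f) /\
  forall x, x \in `[0, L] -> F x = F 0 + \int[mu]_(s in `[0, x]) f s.

(** Fubini on the triangle 0 <= s <= x <= L. It stands in for the pointwise product rule, which
    makes no sense for densities that are merely integrable. *)
Lemma Rintegral_triangle f g :
  mu.-integrable `[0, L] (EFin \o f) -> mu.-integrable `[0, L] (EFin \o g) ->
  \int[mu]_(x in `[0, L]) (f x * \int[mu]_(s in `[0, x]) g s) =
  \int[mu]_(s in `[0, L]) (g s * \int[mu]_(x in `[s, L]) f x).
Proof.
move=> intf intg.
pose fL := f \_ `[0, L]; pose gL := g \_ `[0, L].
have fLi : mu.-integrable setT (EFin \o fL).
  by rewrite /fL -restrict_EFin; apply/integrable_restrict => //=; rewrite setTI.
have gLi : mu.-integrable setT (EFin \o gL).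
  by rewrite /gL -restrict_EFin; apply/integrable_restrict => //=; rewrite setTI.
pose H (p : R * R) : \bar R := (fL p.1 * gL p.2 * ((p.2 <= p.1)%R)%:R)%R%:E.
have mfL : measurable_fun setT fL by apply/measurable_EFinP; case/integrableP: fLi.
have mgL : measurable_fun setT gL by apply/measurable_EFinP; case/integrableP: gLi.
have mH : measurable_fun setT H.
  apply/measurable_EFinP; apply: measurable_funM; first apply: measurable_funM.
  - exact: measurableT_comp mfL measurable_fst.
  - exact: measurableT_comp mgL measurable_snd.
  - apply: (@measurableT_comp _ _ _ _ _ _ (fun b : bool => b%:R : R)) => //.
    exact: measurable_fun_ler measurable_snd measurable_fst.
have mAH : measurable_fun setT (abse \o H) by exact: measurableT_comp mH.
(* Tonelli: |H| is dominated by |f| times |g|, whose iterated integral is a product of two finite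
   integrals. *)
have iH : (mu \x mu)%E.-integrable setT H.
  apply/integrable12ltyP; first exact: mH.
  have /integrableP[_ fLf] := fLi; have /integrableP[mgL' gLf] := gLi.
  apply: (@le_lt_trans _ _ (\int[mu]_x (`|fL x|%:E * \int[mu]_y `|gL y|%:E))%E).
    apply: ge0_le_integral => //=.
    - by move=> x _; apply: integral_ge0.
    - exact: (@measurable_fun_fubini_tonelli_F _ _ _ _ R mu (abse \o H) mAH
        (fun x => abse_ge0 _)).
    - apply: emeasurable_funM => //.
      by apply/measurable_EFinP; apply: measurableT_comp.
    - move=> x _; rewrite -ge0_integralZl//; last first.
        by apply/measurable_EFinP; apply: measurableT_comp.
      apply: ge0_le_integral => //=.
      + do 2 apply: measurableT_comp => //; apply: measurable_funM.
          exact: measurable_funM.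
        apply: (@measurableT_comp _ _ _ _ _ _ (fun b : bool => b%:R : R)) => //.
        exact: measurable_fun_ler.
      + apply: emeasurable_funM => //.
        by apply/measurable_EFinP; apply: measurableT_comp.
      + move=> y _; rewrite lee_fin !normrM ler_piMr ?mulr_ge0//.
        by case: (y <= x)%R; rewrite ?normr1 ?normr0.
  rewrite ge0_integralZr//; last 2 first.
    by apply/measurable_EFinP; apply: measurableT_comp.
    by apply: integral_ge0.
  by apply: lte_mul_pinfty; rewrite ?ge0_fin_numE ?integral_ge0.
have H1 x : (\int[mu]_s H (x, s) =
    ((fun x => f x * \int[mu]_(s in `[0, x]) g s) \_ `[0, L] x)%R%:E)%E.
  rewrite patchE; case: ifPn => [|xL]; last first.
    under eq_integral do rewrite /H/= /fL patchE (negbTE xL) !mul0r.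
    by rewrite integral0.
  rewrite inE/= in_itv/= => /andP[x0 xL].
  have gx : mu.-integrable `[0, x] (EFin \o g).
    by apply: integrableS intg => //; apply: subset_itvl; rewrite bnd_simp.
  rewrite /Rintegral EFinM fineK; last exact: integrable_fin_num gx.
  rewrite -integralZl// [RHS]integral_mkcond; apply: eq_integral => s _.
  rewrite /H/= /fL /gL !patchE mem_set/=; last by rewrite in_itv/= x0.
  rewrite !mem_setE !in_itv/=; case: (leP 0 s) => s0/=; last by rewrite mulr0 mul0r.
  case: (leP s x) => sx; last by rewrite mulr0.
  by rewrite (le_trans sx xL) mulr1.
have H2 s : (\int[mu]_x H (x, s) =
    ((fun s => g s * \int[mu]_(x in `[s, L]) f x) \_ `[0, L] s)%R%:E)%E.
  rewrite patchE; case: ifPn => [|sL]; last first.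
    under eq_integral do rewrite /H/= /gL [X in _ * X * _]patchE (negbTE sL) mulr0 mul0r.
    by rewrite integral0.
  rewrite inE/= in_itv/= => /andP[s0 sL].
  have fs : mu.-integrable `[s, L] (EFin \o f).
    by apply: integrableS intf => //; apply: subset_itvr; rewrite bnd_simp.
  rewrite /Rintegral EFinM fineK; last exact: integrable_fin_num fs.
  rewrite -integralZl// [RHS]integral_mkcond; apply: eq_integral => x _.
  rewrite /H/= /fL /gL !patchE [in X in _ * X * _]mem_set/=; last by rewrite in_itv/= s0.
  rewrite !mem_setE !in_itv/=; case: (leP s x) => sx/=; last by rewrite mulr0.
  rewrite (le_trans s0 sx)/=; case: (leP x L) => xL; last by rewrite !mul0r.
  by rewrite mulr1 mulrC.
have := Fubini iH.
under eq_integral do rewrite H1.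
under [X in _ = X -> _]eq_integral do rewrite H2.
by move=> /(congr1 fine); rewrite -!/(Rintegral _ _ _) -!Rintegral_mkcond.
Qed.

Lemma primitive_on_continuous F f : primitive_on F f ->
  {within `[0, L], continuous F}.
Proof.
move=> [intf FE].
have c := parameterized_integral_continuous (ltW L0) intf.
apply: (@subspace_eq_continuous _ _ _
  (fun x => F 0 + parameterized_integral mu 0 x f)).
  by move=> x; rewrite inE/= => xL; rewrite /from_subspace/= (FE x xL).
by move=> x; apply: cvgD; [exact: cvg_cst|exact: c].
Qed.

Lemma within_continuous_integrable F : {within `[0, L], continuous F} ->
  mu.-integrable `[0, L] (EFin \o F).
Proof. by move=> cF; apply: continuous_compact_integrable => //; exact: segment_compact. Qed.

Lemma within_continuous_L2 F : {within `[0, L], continuous F} -> L2 L F.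
Proof.
move=> cF; split.
  by have /within_continuous_integrable/integrableP[/measurable_EFinP] := cF.
have := @within_continuous_integrable (fun x => F x * F x).
by apply => x; apply: continuousM; exact: cF.
Qed.

Lemma primitive_onM F f G g : primitive_on F f -> primitive_on G g ->
  mu.-integrable `[0, L] (EFin \o (fun x => f x * G x)).
Proof.
move=> [intf _] /primitive_on_continuous cG.
have := @integrableMl _ _ _ mu _ (mI `[0, L]) _ G intf.
have /within_continuous_integrable/integrableP[/measurable_EFinP mG _] := cG.
move=> /(_ mG); apply.
have /compact_bounded[M [_ mrt]] := continuous_compact cG (@segment_compact _ 0 L).
by exists M; split; rewrite ?num_real // => ? ? ? ?; exact: mrt.
Qed.

(** Expanding G from the endpoint 0 and F from the endpoint L turns both integrals into boundary
    terms plus one double integral, taken in the two orders of [Rintegral_triangle]. *)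
Lemma integration_by_parts_primitive F f G g :
  primitive_on F f -> primitive_on G g ->
  \int[mu]_(x in `[0, L]) (f x * G x) =
  F L * G L - F 0 * G 0 - \int[mu]_(x in `[0, L]) (F x * g x).
Proof.
move=> pF pG; have [intf FE] := pF; have [intg GE] := pG.
have LL : L \in `[0, L] by rewrite in_itv/= lexx ltW.
have E1 : \int[mu]_(x in `[0, L]) (f x * G x) = (F L - F 0) * G 0 +
    \int[mu]_(x in `[0, L]) (f x * \int[mu]_(s in `[0, x]) g s).
  have : \int[mu]_(x in `[0, L]) (f x * G x - f x * G 0) =
      \int[mu]_(x in `[0, L]) (f x * \int[mu]_(s in `[0, x]) g s).
    by apply: eq_Rintegral => x; rewrite inE/= => xL; rewrite GE//; ring.
  rewrite RintegralB//; last 2 first.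
  - exact: primitive_onM pF pG.
  - by have := integrableZr (mI `[0, L]) (G 0) intf; apply: eq_integrable.
  move=> <-; rewrite RintegralZr// (FE L)//; ring.
have E2 : \int[mu]_(s in `[0, L]) (g s * \int[mu]_(x in `[s, L]) f x) =
    F L * (G L - G 0) - \int[mu]_(x in `[0, L]) (F x * g x).
  have : \int[mu]_(x in `[0, L]) (F L * g x - F x * g x) =
      \int[mu]_(s in `[0, L]) (g s * \int[mu]_(x in `[s, L]) f x).
    apply: eq_Rintegral => s; rewrite inE/= => sL; rewrite FE// (FE s)//.
    have [s0 sL'] := andP sL.
    have fs : mu.-integrable `[s, L] (EFin \o f).
      by apply: integrableS intf => //; apply: subset_itvr.
    have -> : \int[mu]_(x in `[s, L]) f x =
        \int[mu]_(x in `[0, L]) f x - \int[mu]_(x in `[0, s]) f x.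
      rewrite Rintegral_itvB// -Rintegral_itv_obnd_cbnd//.
      by apply: integrableS fs => //; apply: subset_itvr; rewrite bnd_simp.
    by ring.
  rewrite RintegralB//; last 2 first.
  - by have := integrableZl (mI `[0, L]) (F L) intg; apply: eq_integrable.
  - by have := primitive_onM pG pF; apply: eq_integrable => // x _ /=; rewrite mulrC.
  by move=> <-; rewrite RintegralZl// (GE L)//; ring.
by rewrite E1 Rintegral_triangle// E2; ring.
Qed.

(** Links the integrated form to [derive1], in terms of which [H10norm] is defined. *)
Lemma primitive_on_is_derive F f x : primitive_on F f -> x \in `]0, L[ ->
  {within `[0, L], continuous f} -> is_derive x 1 F (f x).
Proof.
move=> [intf FE] xL cf; have [x0 x1] := andP xL.
have cx : {for x, continuous f} by exact: within_continuous_continuous cf xL.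
have [dF dE] := continuous_FTC1_closed x1 intf x0 cx.
pose I y := \int[mu]_(t in `[0, y]) f t.
have dI : is_derive x 1 I (f x).
  exact: (DeriveDef dF (etrans (esym (derive1E _ _)) dE)).
apply: (@near_eq_is_derive _ _ _ (fun y => F 0 + I y)); last first.
  by have := is_deriveD (is_derive_cst (F 0) x 1) dI; rewrite add0r.
near=> y; rewrite /= (FE y)//.
apply: subset_itv_oo_cc.
by near: y; exact: near_in_itvoo.
Unshelve. all: by end_near. Qed.

End AbsolutelyContinuous.

Lemma cvg_eq {R : realType} (T : Type) (F : set_system T) (u v : T -> R) (l : R) :
  (forall x, v x = u x) -> u x @[x --> F] --> l -> v x @[x --> F] --> l.
Proof. by move=> /funext ->. Qed.

Lemma sum_cauchy_schwarz {R : realType} (I : Type) (r : seq I) (a b : I -> R) :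
  (\sum_(i <- r) a i * b i) ^+ 2 <= (\sum_(i <- r) a i ^+ 2) * (\sum_(i <- r) b i ^+ 2).
Proof.
elim: r => [|i r IH]; first by rewrite !big_nil expr0n mulr0.
rewrite !big_cons.
have A0 : 0 <= \sum_(i <- r) a i ^+ 2 by apply: sumr_ge0 => *; exact: sqr_ge0.
have B0 : 0 <= \sum_(i <- r) b i ^+ 2 by apply: sumr_ge0 => *; exact: sqr_ge0.
move: IH A0 B0.
move: (\sum_(_ <- _) b _ ^+ 2) (\sum_(_ <- _) a _ ^+ 2) (\sum_(_ <- _) _) (a i) (b i).
move=> B A S x y SAB A0 B0.
(* Since S^2 <= A B, the cross term is at most 2 sqrt(A B) |x y| <= A y^2 + B x^2. Once S x y > 0,
   squaring avoids the root. *)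
suff : 2 * (S * (x * y)) <= A * y ^+ 2 + B * x ^+ 2 by nra.
have [Sn|Sp] := lerP (S * (x * y)) 0; first by nra.
rewrite -(@ler_pXn2r _ 2)// ?nnegrE; last 2 first.
- by rewrite mulr_ge0// ltW.
- by apply: addr_ge0; apply: mulr_ge0 => //; exact: sqr_ge0.
have : S ^+ 2 * (x * y) ^+ 2 <= A * B * (x * y) ^+ 2 by rewrite ler_wpM2r ?sqr_ge0.
have := sqr_ge0 (A * y ^+ 2 - B * x ^+ 2).
by nra.
Qed.

(** * Functions of class H^2 and the spectral expansion *)

Section SobolevH2.
Context {R : realType}.
Local Notation mu := (@lebesgue_measure R).
Variable L : R.
Hypothesis L0 : 0 < L.
Implicit Types f g : H2 L.

Let mI (i : interval R) :
  measurable ([set` i] : set (g_sigma_algebraType R.-ocitv.-measurable)).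
Proof. exact: measurable_itv. Qed.

Lemma dx_primitive f : primitive_on L (dx f) (dxx f).
Proof. by split; [exact: L2_integrable (dxx_L2 f)|exact: dxE]. Qed.

Lemma dx_continuous f : {within `[0, L], continuous dx f}.
Proof. exact: primitive_on_continuous (dx_primitive f). Qed.

Lemma h2_primitive f : primitive_on L f (dx f).
Proof.
split; last exact: h2valE.
exact: within_continuous_integrable (@dx_continuous f).
Qed.

Lemma h2_continuous f : {within `[0, L], continuous (f : R -> R)}.
Proof. exact: primitive_on_continuous (h2_primitive f). Qed.

Lemma dx_L2 f : L2 L (dx f).
Proof. exact: within_continuous_L2 (@dx_continuous f). Qed.

Lemma h2_L2 f : L2 L f.
Proof. exact: within_continuous_L2 (@h2_continuous f). Qed.

Lemma green f g : dirichlet g -> ip L (dxx f) g = - ip L (dx f) (dx g).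
Proof.
move=> [g0 gL]; rewrite /ip.
rewrite (integration_by_parts_primitive L0 (dx_primitive f) (h2_primitive g)).
by rewrite g0 gL; ring.
Qed.

Lemma dxx_sym f g : dirichlet f -> dirichlet g ->
  ip L (dxx f) g = ip L f (dxx g).
Proof. by move=> Df Dg; rewrite green// ipC -green// ipC. Qed.

(** Cauchy-Schwarz on [0, x] against the constant 1 bounds f(x)^2 by L |f'|^2 at every x;
    integrating over [0, L] brings the second factor L. *)
Lemma poincare f : dirichlet f -> ip L f f <= L ^+ 2 * ip L (dx f) (dx f).
Proof.
move=> [f0 _].
have fx x : x \in `[0, L] -> f x * f x <= L * ip L (dx f) (dx f).
  move=> xL; have [x0 x1] : 0 <= x /\ x <= L by move: xL; rewrite in_itv/= => /andP.
  rewrite (h2valE f xL) f0 add0r -expr2.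
  have sub (h : R -> R) : L2 L h -> L2 x h.
    have s : `[0, x] `<=` `[0, L] by apply: subset_itvl; rewrite bnd_simp.
    by move=> [mh ih]; split;
      [exact: measurable_funS mh|exact: integrableS ih].
  have := cauchy_schwarz (sub _ (dx_L2 f)) (L2_cst x 1).
  have -> : ip x (dx f) (fun=> 1) = \int[mu]_(s in `[0, x]) dx f s.
    by apply: eq_Rintegral => s _; rewrite mulr1.
  move=> /le_trans; apply.
  have -> : ip x (fun=> 1) (fun=> 1) = x :> R.
    rewrite /ip mulr1 Rintegral_cst//= lebesgue_measure_itv/= lte_fin mul1r.
    by case: ltP => x0'/=; rewrite ?subr0//; apply/eqP; rewrite eq_le x0 x0'.
  rewrite mulrC ler_pM// ?ip_ge0//.
  apply: fine_le.
  - exact: integrable_fin_num (L2_integrableM (sub _ (dx_L2 f)) (sub _ (dx_L2 f))).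
  - exact: integrable_fin_num (L2_integrableM (dx_L2 f) (dx_L2 f)).
  - apply: ge0_subset_integral => //.
    + apply/measurable_EFinP; apply: measurable_funM; exact: (dx_L2 f).1.
    + by move=> s _; rewrite lee_fin -expr2 sqr_ge0.
    + by apply: subset_itvl; rewrite bnd_simp.
have -> : L ^+ 2 * ip L (dx f) (dx f) =
    \int[mu]_(x in `[0, L]) (L * ip L (dx f) (dx f)).
  rewrite Rintegral_cst//= lebesgue_measure_itv/= lte_fin L0/= subr0.
  by ring.
apply: le_Rintegral => //.
- exact: L2_integrableM (h2_L2 f) (h2_L2 f).
- exact: L2_integrable (L2_cst L _).
Qed.

(** [derive1] is known to agree with [dx] on the open interval; at 0 and L it depends on values
    outside [0, L], but the endpoints do not affect the integral. *)
Lemma sqr_H10norm f : H10norm L f ^+ 2 = ip L (dx f) (dx f).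
Proof.
rewrite sqr_l2norm /ip.
have dfE x : x \in `]0, L[ -> derive1 f x = dx f x.
  move=> xL; rewrite derive1E.
  by have [] := primitive_on_is_derive L0 (h2_primitive f) xL (@dx_continuous f).
have m2 : measurable_fun `]0, L[ (fun x => dx f x * dx f x).
  have [m _] := dx_L2 f.
  apply: (@measurable_funS _ _ _ _ `[0, L]) => //; first exact: subset_itv_oo_cc.
  exact: measurable_funM.
have m1 : measurable_fun `]0, L[ (fun x => derive1 f x * derive1 f x).
  by apply: eq_measurable_fun m2 => x; rewrite inE/= => xL; rewrite dfE.
rewrite /Rintegral integral_itv_bndoo; last exact/measurable_EFinP.
rewrite [in RHS]integral_itv_bndoo; last exact/measurable_EFinP.
by congr fine; apply: eq_integral => x; rewrite inE/= => xL; rewrite dfE.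
Qed.

Section LinearCombination.
Variables (k : R) (f g : H2 L).

Let h x := f x - x / L * k - g x.
Let dh x := dx f x - L^-1 * k - dx g x.
Let ddh x := dxx f x - dxx g x.

Let ddh_L2 : L2 L ddh.
Proof. exact: L2B (dxx_L2 f) (dxx_L2 g). Qed.

Let sub x (F : R -> R) : x \in `[0, L] ->
  mu.-integrable `[0, L] (EFin \o F) -> mu.-integrable `[0, x] (EFin \o F).
Proof.
rewrite in_itv/= => /andP[_ xL].
by apply: integrableS => //; apply: subset_itvl; rewrite bnd_simp.
Qed.

Let dhE x : x \in `[0, L] -> dh x = dh 0 + \int[mu]_(s in `[0, x]) ddh s.
Proof.
move=> xL; rewrite RintegralB//; last 2 first.
- exact/sub/L2_integrable/dxx_L2.
- exact/sub/L2_integrable/dxx_L2.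
by rewrite /dh (dxE f xL) (dxE g xL); ring.
Qed.

Let hE x : x \in `[0, L] -> h x = h 0 + \int[mu]_(s in `[0, x]) dh s.
Proof.
move=> xL; have [x0 _] : 0 <= x /\ x <= L by move: xL; rewrite in_itv/= => /andP.
rewrite RintegralB//; last 2 first.
- by apply/sub => //; apply: L2_integrable; apply: L2B (dx_L2 f) (L2_cst _ _).
- exact/sub/L2_integrable/dx_L2.
rewrite RintegralB//; last 2 first.
- exact/sub/L2_integrable/dx_L2.
- by apply/sub => //; exact: L2_integrable (L2_cst _ _).
have -> : \int[mu]_(s in `[0, x]) (L^-1 * k) = x / L * k.
  rewrite Rintegral_cst//= lebesgue_measure_itv/= lte_fin.
  case: ltP => x0'/=; first by rewrite subr0; ring.
  have -> : x = 0 by apply/eqP; rewrite eq_le x0 x0'.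
  by ring.
by rewrite /h (h2valE f xL) (h2valE g xL); ring.
Qed.

(** For f = y(t), k = u_D(t) and g = w_e this is the deviation of w, with its derivative and its
    trace at 0 at hand; x / L * k lifts the boundary value at L. *)
Definition h2_deviation : H2 L := MkH2 ddh_L2 dhE hE.

End LinearCombination.

Lemma dirichlet_deviation k f g : f 0 = 0 -> f L = k -> dirichlet g ->
  dirichlet (h2_deviation k f g).
Proof.
by move=> f0 fL [g0 gL]; split; rewrite /= ?f0 ?fL ?g0 ?gL;
  field; rewrite gt_eqF.
Qed.

End SobolevH2.

Section SpectralExpansion.
Context {R : realType}.
Local Notation mu := (@lebesgue_measure R).
Variables (L : R) (c : R -> R) (e : nat -> H2 L) (lam : nat -> R).
Hypotheses (L0 : 0 < L) (Lc : Linfty L c) (sp : spectral_data c e lam).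
Implicit Types f g : H2 L.

Let mI (i : interval R) :
  measurable ([set` i] : set (g_sigma_algebraType R.-ocitv.-measurable)).
Proof. exact: measurable_itv. Qed.

Lemma ae_eq_ip (f f' g : R -> R) : L2 L f -> L2 L f' -> L2 L g ->
  {ae mu, forall x, x \in `[0, L] -> f x = f' x} -> ip L f g = ip L f' g.
Proof.
move=> [mf _] [mf' _] [mg _] ff'; congr fine; apply: ae_eq_integral => //.
- by apply/measurable_EFinP; exact: measurable_funM.
- by apply/measurable_EFinP; exact: measurable_funM.
- move: ff'; apply: (@filterS _ _ (ae_filter_ringOfSetsType mu)) => x ff' xL.
  by rewrite ff'.
Qed.

Lemma Linfty_bound : exists2 M : R, 0 <= M &
  forall f : R -> R, L2 L f -> `|ip L (fun x => c x * f x) f| <= M * ip L f f.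
Proof.
have [mc [M cM]] := Lc; exists `|M| => // f Lf.
have Lcf := L2_bounded_mul Lc Lf.
have cf2 : ip L (fun x => c x * f x) (fun x => c x * f x) <= `|M| ^+ 2 * ip L f f.
  rewrite -ipZl//; apply: fine_le.
  - exact: integrable_fin_num (L2_integrableM Lcf Lcf).
  - exact: integrable_fin_num (L2_integrableM (L2Z _ Lf) Lf).
  apply: ae_ge0_le_integral => //.
  - by move=> x _; rewrite lee_fin -expr2 sqr_ge0.
  - apply/measurable_EFinP; apply: measurable_funM; exact: Lcf.1.
  - by move=> x _; rewrite lee_fin -mulrA mulr_ge0 ?sqr_ge0// -expr2 sqr_ge0.
  - apply/measurable_EFinP; apply: measurable_funM; last exact: Lf.1.
    exact: (L2Z _ Lf).1.
  - move: cM; apply: (@filterS _ _ (ae_filter_ringOfSetsType mu)) => x cM xL.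
    rewrite lee_fin -expr2 exprMn -mulrA -expr2 ler_wpM2r ?sqr_ge0//.
    rewrite -[leLHS]real_normK ?num_real// lerXn2r ?nnegrE//.
    by rewrite (le_trans (cM xL))// ler_norm.
rewrite -(@ler_pXn2r _ 2)// ?nnegrE ?mulr_ge0 ?ip_ge0//.
rewrite real_normK ?num_real// (le_trans (cauchy_schwarz Lcf Lf))//.
rewrite exprMn [_ ^+ 2 in leRHS]expr2 -[leRHS]mulrA.
have -> : `|M| * (`|M| * ip L f f ^+ 2) = `|M| ^+ 2 * ip L f f * ip L f f by ring.
by rewrite ler_wpM2r ?ip_ge0.
Qed.

Lemma calA_L2 f : L2 L (calA c f).
Proof. exact: L2D (dxx_L2 f) (L2_bounded_mul Lc (h2_L2 L0 f)). Qed.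

Lemma ip_mulA (h f g : R -> R) :
  ip L (fun x => h x * f x) g = ip L f (fun x => h x * g x).
Proof. by apply: eq_Rintegral => x _; ring. Qed.

Lemma calA_sym f g : dirichlet f -> dirichlet g ->
  ip L (calA c f) g = ip L f (calA c g).
Proof.
move=> Df Dg; have Lf := h2_L2 L0 f; have Lg := h2_L2 L0 g.
rewrite ipDl//; [|exact: dxx_L2|exact: L2_bounded_mul].
rewrite [RHS]ipC ipDl//; [|exact: dxx_L2|exact: L2_bounded_mul].
by rewrite dxx_sym// ip_mulA ![ip L f _]ipC.
Qed.

Lemma calA_coef f j : dirichlet f -> ip L (calA c f) (e j) = lam j * ip L f (e j).
Proof.
move=> Df; have De := eig_dirichlet sp j.
rewrite calA_sym// ipC.
have Lej := h2_L2 L0 (e j).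
rewrite (@ae_eq_ip _ (fun x => lam j * e j x))//.
- by rewrite ipZl//; [rewrite ipC|exact: h2_L2].
- exact: calA_L2.
- exact: L2Z.
- exact: h2_L2.
- exact: eig_eq sp j.
Qed.

Lemma calA_energy f : dirichlet f ->
  ip L (dx f) (dx f) = ip L (fun x => c x * f x) f - ip L (calA c f) f.
Proof.
move=> Df; have Lf := h2_L2 L0 f.
rewrite [ip L (calA c f) f]ipDl//; [|exact: dxx_L2|exact: L2_bounded_mul].
by rewrite (green L0)//; ring.
Qed.

(* A test function that equals 1 at 0 and vanishes at L turns the trace f'(0) into
   a bounded functional of (A f, f). *)
Definition ramp (x : R) : R := 1 - x / L.

Lemma ramp_primitive : primitive_on L ramp (fun=> - L^-1).
Proof.
split; first exact: L2_integrable (L2_cst _ _).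
move=> x; rewrite in_itv/= => /andP[x0 _].
rewrite Rintegral_cst//= lebesgue_measure_itv/= lte_fin /ramp.
case: ltP => x0'/=; first by rewrite subr0; ring.
have -> : x = 0 by apply/eqP; rewrite eq_le x0 x0'.
by ring.
Qed.

Lemma ramp_L2 : L2 L ramp.
Proof.
exact: (within_continuous_L2 (primitive_on_continuous L0 ramp_primitive)).
Qed.

(** Integrating f'' against [ramp] by parts leaves the boundary term - f'(0) and a multiple of the
    integral of f', which vanishes by the Dirichlet conditions. *)
Lemma trace0 f : dirichlet f ->
  dx f 0 = ip L f (fun x => c x * ramp x) - ip L (calA c f) ramp.
Proof.
move=> [f0 fL]; have Lf := h2_L2 L0 f; have Lr := ramp_L2.
have LL : L \in `[0, L] by rewrite in_itv/= lexx ltW.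
rewrite ipDl//; [|exact: dxx_L2|exact: L2_bounded_mul].
rewrite ip_mulA /ip.
rewrite (integration_by_parts_primitive L0 (dx_primitive f) ramp_primitive).
rewrite RintegralZr//; last exact: L2_integrable (dx_L2 L0 f).
have -> : \int[mu]_(x in `[0, L]) dx f x = 0.
  by have := h2valE f LL; rewrite f0 fL add0r.
by rewrite /ramp mul0r divff ?gt_eqF//; ring.
Qed.

Lemma trace0_eig j :
  dx (e j) 0 = ip L (fun x => c x * ramp x) (e j) - lam j * ip L ramp (e j).
Proof.
have De := eig_dirichlet sp j.
have Lr := ramp_L2; have Lej := h2_L2 L0 (e j).
rewrite trace0// [ip L (e j) _]ipC; congr (_ - _).
rewrite (ipC L ramp) -ipZl//; apply: ae_eq_ip => //.
- exact: calA_L2.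
- exact: L2Z.
- exact: eig_eq sp j.
Qed.

Section Tail.
Variable n : nat.
Hypothesis un : unstable_count lam n.

Let Lramp := ramp_L2.
Let Lcramp : L2 L (fun x => c x * ramp x).
Proof. exact: L2_bounded_mul. Qed.

Let g j := dx (e j) 0 / lam j.

Let lam_le j : (n <= j)%N -> lam j <= lam n. Proof. by case: un => _ + _; exact. Qed.
Let lam_n0 : lam n < 0. Proof. by case: un. Qed.

Lemma unstable_count_neq0 j : (n <= j)%N -> lam j != 0.
Proof. by move=> nj; rewrite lt_eqF// (le_lt_trans (lam_le nj)). Qed.

Let He := eig_basis sp.
Let Le j : L2 L (e j). Proof. exact: h2_L2. Qed.

(** By [trace0_eig] each quotient is <c ramp, e_j> / lam_j - <ramp, e_j>. As |lam_j| >= |lam_n| for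
    j >= n, Bessel's inequality bounds both parts. *)
Lemma trace_sqr_summable : exists2 C : R, 0 <= C &
  forall N, \sum_(n <= j < N) (dx (e j) 0 / lam j) ^+ 2 <= C.
Proof.
have Lcr := Lcramp; set cr := fun x => c x * ramp x in Lcr.
exists (2 * (ip L cr cr / lam n ^+ 2 + ip L ramp ramp)).
  by rewrite mulr_ge0// addr_ge0 ?divr_ge0 ?ip_ge0// sqr_ge0.
move=> N.
apply: (@le_trans _ _ (\sum_(0 <= j < N) 2 * (ip L cr (e j) ^+ 2 / lam n ^+ 2
    + ip L ramp (e j) ^+ 2))).
  rewrite (big_nat_widenl n 0)// big_mkcond/=; apply: ler_sum => j _.
  case: ifPn => [nj|_]; last first.
    by rewrite mulr_ge0// addr_ge0 ?divr_ge0 ?sqr_ge0.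
  have l0 := unstable_count_neq0 nj.
  have -> : dx (e j) 0 / lam j = ip L cr (e j) / lam j - ip L ramp (e j).
    by rewrite trace0_eig; field.
  have : (ip L cr (e j) / lam j) ^+ 2 <= ip L cr (e j) ^+ 2 / lam n ^+ 2.
    rewrite exprMn ler_wpM2l ?sqr_ge0// exprVn lef_pV2 ?posrE ?exprn_even_gt0//=.
      by have := lam_le nj; have := lam_n0; nra.
    by rewrite lt_eqF.
  move: (ip L cr (e j) / lam j) (ip L ramp (e j)) (_ / _ ^+ 2) => a b q.
  by have := sqr_ge0 (a + b); lra.
rewrite -mulr_sumr ler_wpM2l// big_split/= -mulr_suml.
by rewrite lerD ?ler_wpM2r ?invr_ge0 ?sqr_ge0// bessel.
Qed.

Definition tailf (h : R -> R) : R := tail e lam n (fun j => ip L h (e j)).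

(** Absolute convergence, from |g_j h_j| <= g_j^2 + h_j^2 and two square-summability bounds. Without
    it [tail], being a [limn], would carry no information. *)
Lemma tailf_cvg h : L2 L h ->
  \sum_(n <= j < N) dx (e j) 0 / lam j * ip L h (e j) @[N --> \oo] --> tailf h.
Proof.
move=> Lh; have [C C0 HC] := trace_sqr_summable.
pose u j := if (n <= j)%N then dx (e j) 0 / lam j * ip L h (e j) else 0.
suff cu : cvgn (series u).
  suff E : (fun N => \sum_(n <= j < N) dx (e j) 0 / lam j * ip L h (e j)) = series u.
    by rewrite /tailf /tail E.
  apply/funext => N; rewrite (big_nat_widenl n 0)//= /series/= big_mkcond/=.
  by apply: eq_bigr => j _.
apply: normed_cvg; apply: nondecreasing_is_cvgn.
  apply/nondecreasing_seqP => N; rewrite -subr_ge0 seriesSB.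
  exact: normr_ge0.
exists (C + ip L h h) => _ [N _ <-] /=.
apply: (@le_trans _ _ (\sum_(n <= j < N) (dx (e j) 0 / lam j) ^+ 2
   + \sum_(0 <= j < N) ip L h (e j) ^+ 2)); last first.
  by rewrite lerD// bessel.
rewrite (big_nat_widenl n 0)//= [X in _ <= X + _]big_mkcond/= -big_split/=.
apply: ler_sum => j _; rewrite /u; case: ifPn => _; last first.
  by rewrite normr0 add0r sqr_ge0.
by rewrite ler_norml; apply/andP; split; nra.
Qed.

Lemma tailf_linear k h1 h2 : L2 L h1 -> L2 L h2 ->
  tailf (fun x => k * h1 x + h2 x) = k * tailf h1 + tailf h2.
Proof.
move=> L1 L2'.
apply: cvg_lim => //.
apply: cvg_eq (cvgD (cvgM (cvg_cst k) (tailf_cvg L1)) (tailf_cvg L2')) => N.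
rewrite /= mulr_sumr -big_split/=; apply: eq_bigr => j _.
by rewrite ipDl ?ipZl//; [ring|exact: L2Z].
Qed.

Lemma tailf_bound : exists2 C : R, 0 <= C &
  forall h, L2 L h -> tailf h ^+ 2 <= C * ip L h h.
Proof.
have [C C0 HC] := trace_sqr_summable; exists C => // h Lh.
have c2 : (\sum_(n <= j < N) dx (e j) 0 / lam j * ip L h (e j)) ^+ 2
    @[N --> \oo] --> tailf h ^+ 2.
  by apply: cvg_eq (cvgM (tailf_cvg Lh) (tailf_cvg Lh)) => N.
apply: cvgr_to_le c2 _; near=> N.
apply: le_trans (sum_cauchy_schwarz _ _ _) _.
apply: ler_pM => //; do ?by exact: sumr_ge0 (fun _ _ => sqr_ge0 _).
apply: le_trans (bessel He N Lh).
rewrite (big_nat_widenl n 0)//= big_mkcond/=; apply: ler_sum => j _.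
by case: ifP => // _; rewrite sqr_ge0.
Unshelve. all: by end_near. Qed.

(** Parseval applied to the two inner products of [trace0] regroups, by [trace0_eig], into the sum
    of <f, e_j> e_j'(0). For j >= n, <f, e_j> = <A f, e_j> / lam_j supplies the division that makes
    the tail a bounded functional of A f. *)
Lemma trace0_expansion f : dirichlet f ->
  dx f 0 = \sum_(0 <= j < n) dx (e j) 0 * ip L f (e j) + tailf (calA c f).
Proof.
move=> Df; have Lf := h2_L2 L0 f; have LA := calA_L2 f.
have c1 : \sum_(0 <= j < N) ip L f (e j) * dx (e j) 0 @[N --> \oo] --> dx f 0.
  rewrite trace0//.
  apply: cvg_eq (cvgB (parseval He Lf Lcramp) (parseval He LA Lramp)) => N.
  rewrite /= -sumrB; apply: eq_bigr => j _.
  by rewrite trace0_eig calA_coef//; ring.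
have c2 : \sum_(0 <= j < N) ip L f (e j) * dx (e j) 0 @[N --> \oo] -->
    \sum_(0 <= j < n) dx (e j) 0 * ip L f (e j) + tailf (calA c f).
  apply: cvg_trans (cvgD (cvg_cst _) (tailf_cvg LA)); apply: near_eq_cvg.
  exists n => // N /= nN.
  rewrite /= [RHS](big_cat_nat (leq0n n) nN)/=; congr (_ + _).
    by apply: eq_bigr => j _; rewrite mulrC.
  rewrite !big_nat; apply: eq_bigr => j /andP[nj _].
  by rewrite calA_coef//; field; exact: unstable_count_neq0.
exact: cvg_unique c1 c2.
Qed.

End Tail.
End SpectralExpansion.

Lemma cvg_sumr {R : realType} (T : Type) (F : set_system T) {FF : Filter F}
    (p : nat) (f : 'I_p -> T -> R) (l : 'I_p -> R) :
  (forall i, f i x @[x --> F] --> l i) ->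
  \sum_i f i x @[x --> F] --> \sum_i l i.
Proof.
by move=> fl; apply: cvg_big => // ; exact: add_continuous.
Qed.

(** * Matrix exponential and Lyapunov functions *)

Section MatrixNorm.
Context {R : realType}.

Definition nsq p (x : 'cV[R]_p) : R := \sum_i x i 0 ^+ 2.

Lemma nsq_ge0 p (x : 'cV[R]_p) : 0 <= nsq x.
Proof. by apply: sumr_ge0 => i _; exact: sqr_ge0. Qed.

Lemma nsq_entry_le p (x : 'cV[R]_p) i : x i 0 ^+ 2 <= nsq x.
Proof.
rewrite /nsq (bigD1 i)//= lerDl; apply: sumr_ge0 => j _; exact: sqr_ge0.
Qed.

Lemma nsqD_le p (x y : 'cV[R]_p) : nsq (x + y) <= 2 * (nsq x + nsq y).
Proof.
rewrite /nsq -big_split/= mulr_sumr; apply: ler_sum => i _; rewrite mxE.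
by have := sqr_ge0 (x i 0 - y i 0); lra.
Qed.

Lemma nsq_col_mx p q (x : 'cV[R]_p) (y : 'cV[R]_q) :
  nsq (col_mx x y) = nsq x + nsq y.
Proof.
rewrite /nsq big_split_ord/=; congr (_ + _); apply: eq_bigr => i _.
  by rewrite col_mxEu.
by rewrite col_mxEd.
Qed.

Lemma nsq_mulmx_le p q (N : 'M[R]_(p, q)) : exists2 C : R, 0 <= C &
  forall x : 'cV_q, nsq (N *m x) <= C * nsq x.
Proof.
exists (\sum_i \sum_j N i j ^+ 2).
  by do 2 (apply: sumr_ge0 => ? _); exact: sqr_ge0.
move=> x; rewrite /nsq mulr_suml; apply: ler_sum => i _.
by rewrite mxE; exact: sum_cauchy_schwarz.
Qed.

End MatrixNorm.

Section MatrixExponential.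
Context {R : realType}.

Definition is_derive_mx p q (F : R -> 'M[R]_(p, q)) (t : R) (F' : 'M[R]_(p, q)) :=
  forall i j, is_derive t 1 (fun s => F s i j) (F' i j).

Lemma is_derive_sumr p (t : R) (h : 'I_p -> R -> R) (dh : 'I_p -> R) :
  (forall i, is_derive t 1 (h i) (dh i)) ->
  is_derive t 1 (fun s => \sum_i h i s) (\sum_i dh i).
Proof.
move=> Hh; rewrite (_ : (fun s => _) = \sum_i h i); first exact: is_derive_sum.
by apply/funext => s; rewrite fct_sumE.
Qed.

Lemma is_derive_mulr (t : R) (f g : R -> R) (f' g' : R) :
  is_derive t 1 f f' -> is_derive t 1 g g' ->
  is_derive t 1 (fun s => f s * g s) (f' * g t + f t * g').
Proof.
move=> df dg; apply: is_derive_eq (is_deriveM df dg) _.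
by rewrite /GRing.scale/=; ring.
Qed.

Lemma is_derive_mulmx p q r (F : R -> 'M[R]_(p, q)) (G : R -> 'M[R]_(q, r)) t F' G' :
  is_derive_mx F t F' -> is_derive_mx G t G' ->
  is_derive_mx (fun s => F s *m G s) t (F' *m G t + F t *m G').
Proof.
move=> dF dG i j; rewrite !mxE -big_split/=.
have -> : (fun s => (F s *m G s) i j) = (fun s => \sum_k F s i k * G s k j).
  by apply/funext => s; rewrite mxE.
by apply: is_derive_sumr => k; exact: is_derive_mulr (dF i k) (dG k j).
Qed.

Variable m : nat.
Implicit Types M : 'M[R]_m.

Lemma exprZmx (t : R) M k : (t *: M) ^+ k = t ^+ k *: M ^+ k.
Proof.
elim: k => [|k IH]; first by rewrite !expr0 scale1r.
by rewrite !exprS IH -!mulmxE -scalemxAl -scalemxAr scalerA.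
Qed.

Lemma mx_entry_bound M : exists2 B : R, 0 <= B &
  forall k i j, `|(M ^+ k) i j| <= B ^+ k.
Proof.
pose B := \sum_i \sum_j `|M i j|.
have B0 : 0 <= B by do 2 (apply: sumr_ge0 => ? _).
exists B => // k; elim: k => [|k IH] i j.
  by rewrite !expr0 mxE; case: (i == j); rewrite ?normr1 ?normr0.
rewrite exprS -mulmxE mxE (le_trans (ler_norm_sum _ _ _))//.
apply: (@le_trans _ _ (\sum_l `|M i l| * B ^+ k)).
  by apply: ler_sum => l _; rewrite normrM ler_wpM2l.
rewrite -mulr_suml exprS ler_wpM2r ?exprn_ge0//.
rewrite /B [leRHS](bigD1 i)//= lerDl.
by do 2 (apply: sumr_ge0 => ? _).
Qed.

Lemma cvg_pseries_fact (a : nat -> R) (C B x : R) : 0 <= C -> 0 <= B ->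
  (forall k, `|a k| <= C * B ^+ k) -> cvgn (pseries (fun k => k`!%:R^-1 * a k) x).
Proof.
move=> C0 B0 aB; apply: normed_cvg.
apply: (@series_le_cvg _ _ (fun k => C * exp_coeff (B * `|x|) k)).
- by move=> k; exact: normr_ge0.
- by move=> k; rewrite mulr_ge0// exp_coeff_ge0// mulr_ge0.
- move=> k; rewrite /exp_coeff/= !normrM normrX ger0_norm ?invr_ge0//.
  rewrite exprMn [leRHS](_ : _ = k`!%:R^-1 * (C * B ^+ k) * `|x| ^+ k); last by ring.
  by rewrite ler_wpM2r ?exprn_ge0// ler_wpM2l ?invr_ge0.
- by apply: is_cvg_seriesZ; exact: is_cvg_series_exp_coeff.
Qed.

(** Power series coefficients of the (i, j) entry of M^p e^(xM). The shift p is carried along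
    because termwise differentiation replaces p by p + 1. *)
Let coef M p i j k : R := k`!%:R^-1 * (M ^+ (k + p)) i j.

Let cvg_coef M p i j x : cvgn (pseries (coef M p i j) x).
Proof.
have [B B0 MB] := mx_entry_bound M.
apply: (@cvg_pseries_fact _ (B ^+ p) B) => //; first exact: exprn_ge0.
by move=> k; rewrite -exprD addnC.
Qed.

Let coef_diffs M p i j : pseries_diffs (coef M p i j) = coef M p.+1 i j.
Proof.
apply/funext => k; rewrite /pseries_diffs /coef addnS addSn mulrA; congr (_ * _).
by rewrite factS natrM invfM mulVKf// pnatr_eq0.
Qed.

Lemma expmxE M (t : R) i j : expmx (t *: M) i j = limn (pseries (coef M 0 i j) t).
Proof.
rewrite mxE; congr (limn (series _)); apply/funext => k.
by rewrite /= exprZmx mxE /coef addn0; ring.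
Qed.

Let pseries_coefS M i j t :
  limn (pseries (coef M 1 i j) t) = (M *m expmx (t *: M)) i j.
Proof.
rewrite mxE; apply: cvg_lim => //.
apply: (@cvg_eq _ _ _ (fun N => \sum_l M i l * pseries (coef M 0 l j) t N)).
  move=> N; rewrite /pseries /series/=.
  under [RHS]eq_bigr do rewrite mulr_sumr.
  rewrite exchange_big/=; apply: eq_bigr => k _.
  rewrite /coef addn1 addn0 exprS -mulmxE mxE mulr_sumr mulr_suml.
  by apply: eq_bigr => l _; ring.
apply: cvg_sumr => l; apply: cvgM; first exact: cvg_cst.
by rewrite expmxE; exact: cvg_coef.
Qed.

Lemma expmx_derive M (t : R) :
  is_derive_mx (fun s => expmx (s *: M)) t (M *m expmx (t *: M)).
Proof.
move=> i j; rewrite -pseries_coefS.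
have -> : (fun s => expmx (s *: M) i j) = (fun s => limn (pseries (coef M 0 i j) s)).
  by apply/funext => s; rewrite expmxE.
rewrite -coef_diffs; apply: (@pseries_snd_diffs _ _ (`|t| + 1)).
- exact: cvg_coef.
- by rewrite coef_diffs; exact: cvg_coef.
- by rewrite !coef_diffs; exact: cvg_coef.
- by rewrite [ltRHS]ger0_norm ?addr_ge0// ltrDl.
Qed.

Lemma expmx_comm M (t : R) : M *m expmx (t *: M) = expmx (t *: M) *m M.
Proof.
apply/matrixP => i j; rewrite -pseries_coefS mxE; apply: cvg_lim => //.
apply: (@cvg_eq _ _ _ (fun N => \sum_l pseries (coef M 0 i l) t N * M l j)).
  move=> N; rewrite /pseries /series/=.
  under [RHS]eq_bigr do rewrite mulr_suml.
  rewrite exchange_big/=; apply: eq_bigr => k _.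
  rewrite /coef addn1 addn0 exprSr -mulmxE mxE mulr_sumr mulr_suml.
  by apply: eq_bigr => l _; ring.
apply: cvg_sumr => l; apply: cvgM; last exact: cvg_cst.
by rewrite expmxE; exact: cvg_coef.
Qed.

Lemma expmx0 M : expmx (0 *: M) = 1%:M.
Proof.
apply/matrixP => i j; rewrite expmxE; apply: cvg_lim => //.
apply: cvg_near_cst; exists 1%N => // -[|N]//= _.
rewrite /pseries /series/= big_nat_recl//= big1_seq ?addr0.
  by rewrite /coef expr0 fact0 invr1 mul1r mulr1.
by move=> k _; rewrite expr0n/= mulr0.
Qed.

(** The product e^((a - x)M) e^(xM) has zero derivative in x because M commutes with its
    exponential; its values at x = t and x = 0 are compared. *)
Lemma expmxD M (s t : R) : expmx ((s + t) *: M) = expmx (s *: M) *m expmx (t *: M).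
Proof.
pose a := s + t; have -> : s = a - t by rewrite /a addrK.
apply/matrixP => i j.
pose F (x : R) : R := (expmx ((a - x) *: M) *m expmx (x *: M)) i j.
have d1 x : is_derive_mx (fun y => expmx ((a - y) *: M)) x
    (- (M *m expmx ((a - x) *: M))).
  move=> k l; rewrite mxE.
  have da : is_derive x 1 (fun y : R => a - y) (-1).
    apply: is_derive_eq (is_deriveB (is_derive_cst a x 1) (is_derive_id x 1)) _.
    by rewrite sub0r.
  rewrite -mulrN1.
  exact: (@is_derive1_comp _ (fun y => expmx (y *: M) k l) (fun y => a - y)
    _ _ _ (expmx_derive M (a - x) k l) da).
have dF (x : R) : is_derive x 1 F 0.
  have := is_derive_mulmx (d1 x) (expmx_derive M x) i j.
  by rewrite mulNmx expmx_comm -!mulmxA addNr mxE.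
have := is_derive_0_is_cst t 0 dF; rewrite /F subr0 expmx0 mulmx1 => ->.
by rewrite subrK.
Qed.

End MatrixExponential.

Section Lyapunov.
Context {R : realType}.

Lemma exists_pos_lower_bound p (f : 'I_p -> R) : (forall i, 0 < f i) ->
  exists2 k : R, 0 < k & forall i, k <= f i.
Proof.
move=> f0; have S0 : 0 <= \sum_i (f i)^-1 by apply: sumr_ge0 => i _; rewrite invr_ge0 ltW.
(* An explicit bound below the minimum, which also makes sense for an empty index set. *)
exists (1 + \sum_i (f i)^-1)^-1; first by rewrite invr_gt0 ltr_pwDl.
move=> i; rewrite -[f i]invrK lef_pV2 ?posrE ?invr_gt0 ?ltr_pwDl//.
rewrite (bigD1 i)//= addrCA lerDl addr_ge0//.
by apply: sumr_ge0 => j _; rewrite invr_ge0 ltW.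
Qed.

Let ReM (x y : R[i]) : complex.Re (x * y) =
  complex.Re x * complex.Re y - complex.Im x * complex.Im y.
Proof. by case: x y => [? ?] [? ?]. Qed.
Let ImM (x y : R[i]) : complex.Im (x * y) =
  complex.Re x * complex.Im y + complex.Im x * complex.Re y.
Proof. by case: x y => [? ?] [? ?]. Qed.
Let Re_sum (I : finType) (F : I -> R[i]) :
  complex.Re (\sum_i F i) = \sum_i complex.Re (F i).
Proof. by apply: (big_morph (@complex.Re R)) => // -[? ?] [? ?]. Qed.
Let Im_sum (I : finType) (F : I -> R[i]) :
  complex.Im (\sum_i F i) = \sum_i complex.Im (F i).
Proof. by apply: (big_morph (@complex.Im R)) => // -[? ?] [? ?]. Qed.

Let reM p q (N : 'M[R[i]]_(p, q)) := map_mx (@complex.Re R) N.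
Let imM p q (N : 'M[R[i]]_(p, q)) := map_mx (@complex.Im R) N.

Let re_mul p q r (N : 'M[R[i]]_(p, q)) (N' : 'M[R[i]]_(q, r)) :
  reM (N *m N') = reM N *m reM N' - imM N *m imM N'.
Proof.
apply/matrixP => i j; rewrite !mxE Re_sum -sumrB; apply: eq_bigr => k _.
by rewrite !mxE ReM.
Qed.

Let im_mul p q r (N : 'M[R[i]]_(p, q)) (N' : 'M[R[i]]_(q, r)) :
  imM (N *m N') = reM N *m imM N' + imM N *m reM N'.
Proof.
apply/matrixP => i j; rewrite !mxE Im_sum -big_split/=; apply: eq_bigr => k _.
by rewrite !mxE ImM.
Qed.

(** Schur's theorem over the complex numbers, with P = P1 + i P2, its inverse U1 + i U2 and the
    triangular T = T1 + i T2 split into real and imaginary parts, so that the Lyapunov function can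
    be a real quadratic form. The diagonal entries of T are eigenvalues of M, whence the sign of T1
    i i. *)
Lemma hurwitz_real_triangularization m (M : 'M[R]_m) : (0 < m)%N -> hurwitz M ->
  exists (P1 P2 U1 U2 T1 T2 : 'M[R]_m),
  [/\ U1 *m P1 - U2 *m P2 = 1%:M,
      P1 *m M = T1 *m P1 - T2 *m P2,
      P2 *m M = T1 *m P2 + T2 *m P1,
      forall i, T1 i i < 0
    & forall i j : 'I_m, (i < j)%N -> T1 i j = 0 /\ T2 i j = 0].
Proof.
move=> m0 hM.
pose MC := map_mx (real_complex R) M.
have [P Pu PT] := Schur MC m0.
have Punit := unitarymx_unit Pu.
pose T := P *m MC *m invmx P.
have trigT : is_trig_mx T by move: PT; rewrite /similar_to conjumx.
have PM : P *m MC = T *m P by rewrite /T mulmxKV.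
have reMC : reM MC = M by apply/matrixP => i j; rewrite !mxE.
have imMC : imM MC = 0 by apply/matrixP => i j; rewrite !mxE.
exists (reM P), (imM P), (reM (invmx P)), (imM (invmx P)), (reM T), (imM T).
split.
- rewrite -re_mul mulVmx//; apply/matrixP => i j; rewrite !mxE.
  by case: (i == j).
- have := re_mul P MC; rewrite reMC imMC mulmx0 subr0 => <-.
  by rewrite PM re_mul.
- have := im_mul P MC; rewrite reMC imMC mulmx0 add0r => <-.
  by rewrite PM im_mul.
- move=> i; rewrite mxE; apply: hM.
  have : eigenvalue T (T i i).
    rewrite eigenvalue_root_char char_poly_trig//.
    by rewrite /root horner_prod (bigD1 i)//= hornerXsubC subrr mul0r.
  case/eigenvalueP => v vT v0; apply/eigenvalueP; exists (v *m P).
    by rewrite -mulmxA PM mulmxA vT scalemxAl.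
  apply: contra v0 => /eqP vP; apply/eqP.
  by rewrite -[v](mulmxK Punit) vP mul0mx.
- move=> i j ij; move/is_trig_mxP : trigT => /(_ i j ij) T0.
  by split; rewrite mxE T0.
Qed.

(** Q x stacks the real and imaginary parts of the rescaled Schur coordinates of x. The Lyapunov
    function is |Q x|^2, coercive because Q has a left inverse. *)
Lemma hurwitz_lyapunov m (M : 'M[R]_m) : (0 < m)%N -> hurwitz M ->
  exists (Q : 'M[R]_(m + m, m)) (k C : R),
  [/\ 0 < k, 0 <= C, forall x : 'cV_m, nsq x <= C * nsq (Q *m x)
    & forall x : 'cV_m, \sum_l (Q *m x) l 0 * (Q *m (M *m x)) l 0 <=
        - k * nsq (Q *m x)].
Proof.
move=> m0 hM.
have [P1 [P2 [U1 [U2 [T1 [T2 [UP PM1 PM2 Td Tt]]]]]]] :=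
  hurwitz_real_triangularization m0 hM.
have [k0 k0_gt0 k0T] : exists2 k0, 0 < k0 & forall i, k0 <= - T1 i i.
  by apply: exists_pos_lower_bound => i; rewrite oppr_gt0.
pose tau := \sum_i \sum_j (`|T1 i j| + `|T2 i j|).
have tau0 : 0 <= tau by do 2 (apply: sumr_ge0 => ? _); rewrite addr_ge0.
have Ttau i j : `|T1 i j| + `|T2 i j| <= tau.
  rewrite /tau (bigD1 i)//= (bigD1 j)//= -addrA lerDl addr_ge0//.
    by apply: sumr_ge0 => ? _; rewrite addr_ge0.
  by do 2 (apply: sumr_ge0 => ? _); rewrite addr_ge0.
(* The diagonal rescaling by powers of del makes the off-diagonal part of the
   triangular matrix small. *)
pose del := k0 / (2 * tau * m%:R + k0).
have den0 : 0 < 2 * tau * m%:R + k0 by rewrite ltr_wpDl ?mulr_ge0.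
have del0 : 0 < del by rewrite divr_gt0.
have del1 : del <= 1 by rewrite ler_pdivrMr// mul1r lerDr !mulr_ge0.
(* The off-diagonal part may cost at most half of the diagonal decay [k0], hence the final rate k0 /
   2. *)
have deltau : del * tau * m%:R <= k0 / 2.
  have -> : del * tau * m%:R = (k0 / 2) * ((2 * tau * m%:R) / (2 * tau * m%:R + k0)).
    by rewrite /del; field; rewrite gt_eqF.
  apply: ler_piMr; first by rewrite divr_ge0// ltW.
  by rewrite ler_pdivrMr// mul1r lerDl ltW.
pose Dd : 'M[R]_m := diag_mx (\row_i del ^+ i).
pose Di : 'M[R]_m := diag_mx (\row_i del ^- i).
have DiD : Di *m Dd = 1%:M.
  apply/matrixP => i j; rewrite mul_diag_mx !mxE; case: eqP => [->|_].
    by rewrite mulr1n mulVf// expf_neq0// gt_eqF.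
  by rewrite mulr0n mulr0.
pose Q := col_mx (Dd *m P1) (Dd *m P2).
(* The real part of P^-1 Dd^-1 applied to the coordinates Dd P x recovers the real vector x. *)
pose N := row_mx (U1 *m Di) (- (U2 *m Di)).
have NQ : N *m Q = 1%:M.
  rewrite mul_row_col mulNmx !mulmxA -(mulmxA U1) -(mulmxA U2) DiD !mulmx1.
  by rewrite -UP.
have [C C0 NC] := nsq_mulmx_le N.
exists Q, (k0 / 2), C; split=> //; first by rewrite divr_gt0.
  by move=> x; rewrite -[x in nsq x]mul1mx -NQ -mulmxA.
move=> x.
pose p l := (Dd *m P1 *m x) l 0; pose q l := (Dd *m P2 *m x) l 0.
have pE l : p l = del ^+ l * (P1 *m x) l 0.
  by rewrite /p -mulmxA mul_diag_mx !mxE.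
have qE l : q l = del ^+ l * (P2 *m x) l 0.
  by rewrite /q -mulmxA mul_diag_mx !mxE.
have QxE : nsq (Q *m x) = \sum_l (p l ^+ 2 + q l ^+ 2).
  by rewrite mul_col_mx nsq_col_mx /nsq -big_split/=.
have mulE (T : 'M[R]_m) (y : 'cV_m) l : (T *m y) l 0 = \sum_j T l j * y j 0.
  by rewrite mxE.
have EM1 : P1 *m (M *m x) = T1 *m (P1 *m x) - T2 *m (P2 *m x).
  by rewrite mulmxA PM1 mulmxBl -!mulmxA.
have EM2 : P2 *m (M *m x) = T1 *m (P2 *m x) + T2 *m (P1 *m x).
  by rewrite mulmxA PM2 mulmxDl -!mulmxA.
have -> : \sum_l (Q *m x) l 0 * (Q *m (M *m x)) l 0 =
    \sum_(l < m) \sum_(j < m) del ^+ l * (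
      T1 l j * (p l * (P1 *m x) j 0 + q l * (P2 *m x) j 0) +
      T2 l j * (q l * (P1 *m x) j 0 - p l * (P2 *m x) j 0)).
  rewrite big_split_ord/= -big_split/=; apply: eq_bigr => l _.
  rewrite !mul_col_mx !col_mxEu !col_mxEd.
  have -> : (Dd *m P1 *m (M *m x)) l 0 = del ^+ l *
     (\sum_j T1 l j * (P1 *m x) j 0 - \sum_j T2 l j * (P2 *m x) j 0).
    by rewrite -(mulmxA Dd) EM1 mul_diag_mx mxE mxE -!mulE !mxE.
  have -> : (Dd *m P2 *m (M *m x)) l 0 = del ^+ l *
     (\sum_j T1 l j * (P2 *m x) j 0 + \sum_j T2 l j * (P1 *m x) j 0).
    by rewrite -(mulmxA Dd) EM2 mul_diag_mx mxE mxE -!mulE !mxE.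
  rewrite -/(p l) -/(q l) -sumrB -big_split/= !mulr_sumr -big_split/=.
  by apply: eq_bigr => j _; ring.
(* On the diagonal the T2 terms cancel and T1 l l <= - k0. Below it the weights of rows l and j
   leave a factor del^(l - j) <= del, the entries are at most tau, and products are split by 2 a b
   <= a^2 + b^2. Above it both matrices vanish. *)
apply: (@le_trans _ _ (\sum_(l < m) \sum_(j < m)
    ((if j == l then - k0 * (p l ^+ 2 + q l ^+ 2) else 0) +
     del * tau / 2 * (p l ^+ 2 + q l ^+ 2 + (p j ^+ 2 + q j ^+ 2))))).
  apply: ler_sum => l _; apply: ler_sum => j _.
  have s0 (i : 'I_m) : 0 <= p i ^+ 2 + q i ^+ 2 by rewrite addr_ge0 ?sqr_ge0.
  have dt0 : 0 <= del * tau / 2 by rewrite divr_ge0// mulr_ge0// ltW.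
  have [lj|jl|/val_inj jl] := ltngtP l j.
  - have [-> ->] := Tt _ _ lj; rewrite !mul0r addr0 mulr0.
    rewrite -val_eqE/= gtn_eqF// add0r.
    by rewrite mulr_ge0// addr_ge0.
  - rewrite -val_eqE/= ltn_eqF// add0r.
    have -> : del ^+ l * (T1 l j * (p l * (P1 *m x) j 0 + q l * (P2 *m x) j 0) +
        T2 l j * (q l * (P1 *m x) j 0 - p l * (P2 *m x) j 0)) =
      del ^+ (l - j) * (T1 l j * (p l * p j + q l * q j) +
         T2 l j * (q l * p j - p l * q j)).
      by rewrite (pE j) (qE j) -{1}(subnK (ltnW jl)) exprD; ring.
    have dd : del ^+ (l - j) <= del.
      by rewrite -[leRHS]expr1 ler_wiXn2l// ?subn_gt0// ltW.
    have dd0 : 0 <= del ^+ (l - j) by rewrite exprn_ge0// ltW.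
    pose W := p l ^+ 2 + q l ^+ 2 + (p j ^+ 2 + q j ^+ 2).
    have b1 : T1 l j * (p l * p j + q l * q j) <= `|T1 l j| * (W / 2).
      rewrite (le_trans (ler_norm _))// normrM ler_wpM2l// ler_norml /W.
      have := sqr_ge0 (p l - p j); have := sqr_ge0 (q l - q j).
      have := sqr_ge0 (p l + p j); have := sqr_ge0 (q l + q j).
      by move=> ? ? ? ?; apply/andP; split; nra.
    have b2 : T2 l j * (q l * p j - p l * q j) <= `|T2 l j| * (W / 2).
      rewrite (le_trans (ler_norm _))// normrM ler_wpM2l// ler_norml /W.
      have := sqr_ge0 (q l - p j); have := sqr_ge0 (p l - q j).
      have := sqr_ge0 (q l + p j); have := sqr_ge0 (p l + q j).
      by move=> ? ? ? ?; apply/andP; split; nra.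
    have W0 : 0 <= W by rewrite addr_ge0.
    apply: (@le_trans _ _ (del ^+ (l - j) * (tau * (W / 2)))).
      rewrite ler_wpM2l// (le_trans (lerD b1 b2))// -mulrDl ler_wpM2r// divr_ge0//.
    have -> : del * tau / 2 * W = del * (tau * (W / 2)) by field.
    by rewrite ler_wpM2r// mulr_ge0// divr_ge0.
  - rewrite -jl eqxx.
    have -> : del ^+ l * (T1 l l * (p l * (P1 *m x) l 0 + q l * (P2 *m x) l 0) +
        T2 l l * (q l * (P1 *m x) l 0 - p l * (P2 *m x) l 0)) =
      T1 l l * (p l ^+ 2 + q l ^+ 2).
      by rewrite (pE l) (qE l); ring.
    have b1 : T1 l l * (p l ^+ 2 + q l ^+ 2) <= - k0 * (p l ^+ 2 + q l ^+ 2).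
      by rewrite ler_wpM2r// lerNr.
    by rewrite (le_trans b1)// lerDl mulr_ge0// addr_ge0.
rewrite (_ : \sum_l _ = - k0 * nsq (Q *m x) + del * tau * m%:R * nsq (Q *m x)).
  have := nsq_ge0 (Q *m x); nra.
rewrite QxE.
under eq_bigr do rewrite big_split/= -big_mkcond/= big_pred1_eq.
rewrite big_split/= -mulr_sumr; congr (_ + _).
under eq_bigr do rewrite -mulr_sumr big_split/= sumr_const card_ord.
rewrite -mulr_sumr big_split/= sumr_const card_ord sumrMnl.
have half (a S : R) : a / 2 * (S *+ m + S *+ m) = a * m%:R * S.
  by rewrite -[S *+ m]mulr_natl; field.
exact: half.
Qed.

End Lyapunov.

(** * Differential inequalities on the half-line *)

Section HalfLine.
Context {R : realType}.
Implicit Types f g h : R -> R.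

Definition continuous_halfline f : Prop := forall t : R, 0 <= t ->
  f s @[s --> within [set s | 0 <= s] (nbhs t)] --> f t.

Lemma cvg_within_near (F : set_system R) (A : set R) f (l : R) : Filter F ->
  F A -> f s @[s --> within A F] --> l -> f s @[s --> F] --> l.
Proof.
move=> FF FA fl P /fl; rewrite /= /within/= => FP.
by apply: filterS2 FA FP => x Ax; exact.
Qed.

Lemma near_ge0 (t : R) : 0 < t -> \forall s \near t, 0 <= s.
Proof. by move=> t0; near=> s; apply: ltW; near: s; exact: lt_nbhsr. Unshelve. all: by end_near. Qed.

Lemma continuous_halfline_at f t : continuous_halfline f -> 0 < t ->
  {for t, continuous f}.
Proof.
move=> cf t0; apply: (@cvg_within_near (nbhs t) [set s | 0 <= s]); last exact/cf/ltW.
exact: near_ge0.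
Qed.

Lemma continuous_halfline_within f a b : continuous_halfline f -> 0 <= a ->
  {within `[a, b], continuous f}.
Proof.
move=> cf a0; apply/subspace_continuousP => x /=; rewrite in_itv/= => /andP[ax _].
apply: cvg_trans (cf x (le_trans a0 ax)); apply: cvg_app.
move=> P; rewrite /within !nbhs_simpl; apply: (@filterS _ (nbhs x)) => y yP.
by rewrite /= in_itv/= => /andP[ay _]; apply: yP; exact: le_trans ay.
Qed.

Lemma continuous_halflineT f : continuous f -> continuous_halfline f.
Proof. by move=> cf t _; apply: cvg_within_filter; exact: cf. Qed.

Lemma continuous_halflineD f g : continuous_halfline f -> continuous_halfline g ->
  continuous_halfline (fun t => f t + g t).
Proof. by move=> cf cg t t0; apply: cvgD; [exact: cf|exact: cg]. Qed.

Lemma continuous_halflineM f g : continuous_halfline f -> continuous_halfline g ->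
  continuous_halfline (fun t => f t * g t).
Proof. by move=> cf cg t t0; apply: cvgM; [exact: cf|exact: cg]. Qed.

Lemma continuous_halfline_cst (k : R) : continuous_halfline (fun=> k).
Proof. by move=> t t0; exact: cvg_cst. Qed.

Lemma continuous_halfline_sum p (f : 'I_p -> R -> R) :
  (forall i, continuous_halfline (f i)) ->
  continuous_halfline (fun t => \sum_i f i t).
Proof. by move=> cf t t0; apply: cvg_sumr => i; exact: cf. Qed.

(** The difference quotient times s - t tends to 0. The one-sided derivative at t = 0 gives
    continuity there as well. *)
Lemma halfline_derivative_continuous f :
  (forall t, 0 <= t -> exists l, has_derivative_halfline f t l) ->
  continuous_halfline f.
Proof.
move=> df t t0; have [l fl] := df t t0.
have h1 : f s @[s --> within [set s | 0 <= s] t^'] --> f t.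
  have st : s - t @[s --> within [set s | 0 <= s] t^'] --> t - t.
    apply: cvg_within_filter; apply: cvg_within_filter.
    by apply: cvgB; [exact: cvg_id|exact: cvg_cst].
  suff : f s @[s --> within [set s | 0 <= s] t^'] --> l * (t - t) + f t.
    by rewrite subrr mulr0 add0r.
  apply: cvg_eq (cvgD (cvgM fl st) (cvg_cst (f t))) => s /=.
  have [->|ts] := eqVneq s t; first by rewrite !subrr mulr0 add0r.
  by rewrite mulfVK ?subr_eq0// subrK.
move=> P fP.
have h2 : \forall s \near t, s != t -> 0 <= s -> P (f s) := h1 P fP.
suff : \forall s \near t, 0 <= s -> P (f s) by [].
apply: filterS h2 => s H s0; have [->|st] := eqVneq s t; last exact: H.
exact: nbhs_singleton fP.
Qed.

(** Caratheodory's criterion: the difference quotient, completed by l at t, is continuous there; for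
    t > 0 the half-line constraint is locally void. *)
Lemma halfline_derivative_is_derive f t l : 0 < t ->
  has_derivative_halfline f t l -> is_derive t 1 f l.
Proof.
move=> t0 fl; apply/is_derive1_caratheodory.
exists (fun s => if s == t then l else (f s - f t) / (s - t)); split.
- move=> s; case: eqP => [->|/eqP st]; first by rewrite !subrr mulr0.
  by rewrite mulfVK// subr_eq0.
- apply/continuous_withinNx; rewrite eqxx.
  apply: (@cvg_within_near _ [set s | 0 <= s]).
    by apply: (@filterS _ (nbhs t) _ [set s | 0 <= s]) (near_ge0 t0) => s.
  apply: cvg_trans fl; apply: near_eq_cvg.
  rewrite !near_withinE; apply: nearW => s st _.
  by rewrite (negbTE st).
- by rewrite eqxx.
Unshelve. all: by end_near. Qed.

(** The mean value theorem on both sides of the exceptional point p, where only continuity is known;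
    p may lie outside [0, T]. It will be the time D at which the jump of the control reaches the
    boundary. *)
Lemma derivative_le0_decr h (h' : R -> R) (T p : R) : 0 <= T ->
  {within `[0, T], continuous h} ->
  (forall t, t \in `]0, T[ -> t != p -> is_derive t 1 h (h' t) /\ h' t <= 0) ->
  h T <= h 0.
Proof.
move=> T0 ch dh.
have seg (a b : R) : 0 <= a -> a <= b -> b <= T ->
    (forall t, t \in `]a, b[ -> t != p) -> h b <= h a.
  move=> a0 ab bT abp.
  have abT t : t \in `]a, b[ -> t \in `]0, T[ by apply: subset_itvW.
  move: ab; rewrite le_eqVlt => /predU1P[->//|ab].
  have cab : {within `[a, b], continuous h}.
    apply: continuous_subspaceW ch => x /=; rewrite !in_itv/= => /andP[ax xb].
    by rewrite (le_trans a0 ax) (le_trans xb bT).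
  have dab t : t \in `]a, b[ -> is_derive t 1 h (h' t).
    by move=> tab; case: (dh t (abT t tab) (abp t tab)).
  have [c ca E] := MVT ab dab cab.
  rewrite -subr_le0 E pmulr_lle0 ?subr_gt0//.
  by case: (dh c (abT c ca) (abp c ca)).
have [/andP[p0 pT]|pNin] := boolP ((0 <= p) && (p <= T)).
  apply: (@le_trans _ _ (h p)); apply: seg => // t; rewrite in_itv/= => /andP[].
    by move=> /gt_eqF ->.
  by move=> _ /lt_eqF ->.
apply: seg => // t; rewrite in_itv/= => /andP[t0 tT].
apply: contra pNin => /eqP <-; by rewrite !ltW.
Qed.

Lemma is_derive_expRM (k t : R) :
  is_derive t 1 (fun s : R => expR (k * s)) (k * expR (k * t)).
Proof.
have d1 : is_derive t 1 (fun s : R => k * s) k.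
  apply: is_derive_eq (is_derive_mulr (is_derive_cst k t 1) (is_derive_id t 1)) _.
  by rewrite mul0r add0r mulr1.
by rewrite mulrC; exact: (is_derive1_comp (is_derive_expR _) d1).
Qed.

Lemma continuous_expRM (k : R) : continuous (fun s : R => expR (k * s)).
Proof.
move=> s; apply: differentiable_continuous; apply/derivable1_diffP.
by have [] := is_derive_expRM k s.
Qed.

(* e^(mu t) (h - M E) is nonincreasing, because E decreases at most at the rate lam < mu. *)
Lemma comparison (h h' E E' : R -> R) (T p mu lam a M : R) : 0 <= T ->
  {within `[0, T], continuous h} -> {within `[0, T], continuous E} ->
  (forall t, t \in `]0, T[ -> 0 <= E t /\
    is_derive t 1 E (E' t) /\ - lam * E t <= E' t) ->
  (forall t, t \in `]0, T[ -> t != p ->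
    is_derive t 1 h (h' t) /\ h' t <= - mu * h t + a * E t) ->
  0 <= M -> a <= M * (mu - lam) -> h 0 <= M * E 0 -> h T <= M * E T.
Proof.
move=> T0 ch cE dE dh M0 aM h0.
pose g t := expR (mu * t) * (h t - M * E t).
pose g' t := mu * expR (mu * t) * (h t - M * E t) + expR (mu * t) * (h' t - M * E' t).
have : g T <= g 0.
  apply: (@derivative_le0_decr g g' T p) => //.
    move=> x; apply: cvgM.
      by apply: continuous_subspaceT; exact: continuous_expRM.
    apply: cvgB; first exact: ch.
    by apply: cvgM; [exact: cvg_cst|exact: cE].
  move=> t tT tp; have [E0 [dEt Ele]] := dE t tT; have [dht hle] := dh t tT tp.
  split.
    have dME : is_derive t 1 (fun s => M * E s) (M * E' t).
      apply: is_derive_eq (is_derive_mulr (is_derive_cst M t 1) dEt) _.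
      by rewrite mul0r add0r.
    exact: (is_derive_mulr (is_derive_expRM mu t) (is_deriveB dht dME)).
  have -> : g' t = expR (mu * t) * (mu * (h t - M * E t) + (h' t - M * E' t)).
    by rewrite /g'; ring.
  rewrite pmulr_rle0 ?expR_gt0//.
  have : a * E t <= M * (mu - lam) * E t by rewrite ler_wpM2r.
  have : M * (- lam * E t) <= M * E' t by rewrite ler_wpM2l.
  by lra.
rewrite /g mulr0 expR0 mul1r => gT.
have : expR (mu * T) * (h T - M * E T) <= 0 by rewrite (le_trans gT)// subr_le0.
by rewrite pmulr_rle0 ?expR_gt0// subr_le0.
Qed.

End HalfLine.

(** * Time derivatives of bounded functionals of L^2-valued maps *)

Section L2Functionals.
Context {R : realType}.
Variable L : R.
Implicit Types (F : R -> R -> R) (G : R -> R).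

(** One notion covers both f |-> <f, e_j> and the tail sum, so that they inherit their time
    derivatives from the evolution equation by the same argument. *)
Definition L2_functional (C : R) (phi : (R -> R) -> R) : Prop :=
  [/\ 0 <= C, forall k f g, L2 L f -> L2 L g ->
    phi (fun x => k * f x + g x) = k * phi f + phi g
  & forall f, L2 L f -> `|phi f| <= C * l2norm L f].

Lemma L2_functional_derivative C phi F t G : L2_functional C phi ->
  (forall s, 0 <= s -> L2 L (F s)) -> L2 L G -> 0 <= t ->
  L2_has_derivative L F t G ->
  has_derivative_halfline (fun s => phi (F s)) t (phi G).
Proof.
move=> [C0 lin bnd] LF LG t0 dF; apply/cvgrPdist_le => eps eps0.
have FF : Filter (within [set s | 0 <= s] t^') by exact: within_filter.
have := cvg0_mulr FF C dF.
move/cvgrPdist_le => /(_ _ eps0); apply: filterS2 (withinT _ _) => s /= s0.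
rewrite sub0r normrN ger0_norm ?mulr_ge0 ?l2norm_ge0//; apply: le_trans.
(* Differences are put in the form k f + g, the one in which linearity is stated; N is simply -
   G. *)
pose D x := -1 * F t x + F s x; pose N x := -2 * G x + G x.
have LD : L2 L D by apply: L2D (LF _ s0); exact/L2Z/LF.
have LN : L2 L N by apply: L2D => //; exact: L2Z.
have -> : (fun x => (F s x - F t x) / (s - t) - G x) =
    (fun x => (s - t)^-1 * D x + N x).
  by apply/funext => x; rewrite /D /N; ring.
rewrite [leRHS]mulrC distrC.
have -> : (phi (F s) - phi (F t)) / (s - t) - phi G =
    phi (fun x => (s - t)^-1 * D x + N x).
  by rewrite lin// lin; [rewrite lin//; ring|exact: LF|exact: LF].
by apply: bnd; apply: L2D => //; exact: L2Z.
Qed.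

Lemma ip_functional g : L2 L g -> L2_functional (l2norm L g) (fun f => ip L f g).
Proof.
move=> Lg; split.
- exact: l2norm_ge0.
- by move=> k f h Lf Lh; rewrite ipDl ?ipZl//; exact: L2Z.
- by move=> f Lf; rewrite mulrC; exact: normr_ip_le.
Qed.

(** With q the difference quotient of F, that of |F|^2 is 2 <q, F t> + (s - t) |q|^2, and |q|^2 = |q
    - G|^2 + 2 <q, G> - |G|^2 converges. So |F|^2 is even differentiable. *)
Lemma L2_derivative_continuous F :
  (forall s, 0 <= s -> L2 L (F s)) ->
  (forall t, 0 <= t -> exists2 G, L2 L G & L2_has_derivative L F t G) ->
  continuous_halfline (fun t => ip L (F t) (F t)).
Proof.
move=> LF dF; apply: halfline_derivative_continuous => t t0.
have [G LG FG] := dF t t0.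
have FF : Filter (within [set s | 0 <= s] t^') by exact: within_filter.
have h1 := L2_functional_derivative (ip_functional (LF t t0)) LF LG t0 FG.
have h2 := L2_functional_derivative (ip_functional LG) LF LG t0 FG.
have st : s - t @[s --> within [set s | 0 <= s] t^'] --> t - t.
  apply: cvg_within_filter; apply: cvg_within_filter.
  by apply: cvgB; [exact: cvg_id|exact: cvg_cst].
have h3 := cvgB (cvgD (cvgM FG FG) (cvgM (cvg_cst (2 : R)) h2)) (cvg_cst (ip L G G)).
have h4 := cvgD (cvgM (cvg_cst (2 : R)) h1) (cvgM st (h3 FF FF FF FF FF FF)).
eexists; apply: cvg_trans (h4 FF FF FF FF); apply: near_eq_cvg.
apply: filterS (withinT _ _) => s /= s0.
have Ls := LF s s0; have Lt := LF t t0; have Lst := L2B Ls Lt.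
pose n := l2norm L (fun x => (F s x - F t x) / (s - t) - G x).
suff : 2 * ((ip L (F s) (F t) - ip L (F t) (F t)) / (s - t)) +
    (s - t) * (n * n + 2 * ((ip L (F s) G - ip L (F t) G) / (s - t)) - ip L G G) =
    (ip L (F s) (F s) - ip L (F t) (F t)) / (s - t) by [].
rewrite -expr2 sqr_l2norm.
have -> : (fun x => (F s x - F t x) / (s - t) - G x) =
    (fun x => (s - t)^-1 * (F s x - F t x) - 1 * G x).
  by apply/funext => x; ring.
rewrite ip_sub_sqr//; last exact: L2Z.
(* At s = t both sides are 0, since the inverse of 0 is 0. *)
have [->|sNt] := eqVneq s t; first by rewrite !subrr invr0 !mulr0 !mul0r addr0.
pose D x := F s x - F t x.
have D2 : ip L D D = ip L (F s) (F s) - 2 * ip L (F s) (F t) + ip L (F t) (F t).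
  by rewrite {1}/D ipBl// (ipC L (F s) D) (ipC L (F t) D) !ipBl// (ipC L (F t) (F s)); ring.
have kD2 k : ip L (fun x => k * D x) (fun x => k * D x) = k ^+ 2 * ip L D D.
  rewrite ipZl//; last exact: L2Z.
  by rewrite (ipC L D) ipZl//; ring.
rewrite -/D kD2 ipZl// ipBl// D2.
by field; rewrite subr_eq0.
Qed.

End L2Functionals.

(** * The delay term *)

Section CausalIntegral.
Context {R : realType}.
Local Notation mu := (@lebesgue_measure R).

Let mI (i : interval R) :
  measurable ([set` i] : set (g_sigma_algebraType R.-ocitv.-measurable)).
Proof. exact: measurable_itv. Qed.

Lemma is_derive_continuous (f : R -> R) (t l : R) :
  is_derive t 1 f l -> {for t, continuous f}.
Proof.
move=> [df _]; apply: differentiable_continuous; exact/derivable1_diffP.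
Qed.

Definition causal (q : R -> R) : Prop :=
  (forall t, t < 0 -> q t = 0) /\
  forall T, mu.-integrable `[0, T] (EFin \o q).

Definition indef (q : R -> R) (t : R) : R := \int[mu]_(s in `[0, t]) q s.

Variable q : R -> R.
Hypothesis cq : causal q.

Lemma causal_integrable a b : mu.-integrable `[a, b] (EFin \o q).
Proof.
have [q0 /(_ b) qi] := cq.
have : mu.-integrable setT (EFin \o (q \_ `[0, b])).
  by rewrite -restrict_EFin; apply/integrable_restrict => //=; rewrite setTI.
move=> /(integrableS measurableT (mI `[a, b]) (@subsetT _ _)).
apply: eq_integrable => // x; rewrite inE/= in_itv/= => /andP[_ xb].
rewrite patchE mem_setE in_itv/= xb andbT; case: leP => // x0.
by rewrite q0.
Qed.

(** Since q vanishes before 0, the lower bound may be moved to the left. Any t, also t <= 0, then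
    becomes an interior point for the fundamental theorem of calculus. *)
Lemma indefE a t : a <= 0 -> \int[mu]_(s in `[a, t]) q s = indef q t.
Proof.
move=> a0; have [q0 _] := cq; rewrite /indef.
have -> : `[0, t]%classic = `[a, t]%classic `&` `[0, +oo[%classic :> set R.
  apply/seteqP; split => x /=; rewrite !in_itv/=.
    by move=> /andP[x0 ->]; rewrite x0 (le_trans a0 x0).
  by move=> [/andP[_ ->]]; rewrite andbT => ->.
rewrite Rintegral_mkcondr; apply: eq_Rintegral => x _.
by rewrite patchE mem_setE in_itv/= andbT; case: leP => // x0; rewrite q0.
Qed.

Lemma indef0 t : t <= 0 -> indef q t = 0.
Proof.
rewrite /indef le_eqVlt => /predU1P[->|t0]; first by rewrite set_itv1 Rintegral_set1.
by rewrite set_itv_ge ?Rintegral_set0// bnd_simp -ltNge.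
Qed.

Lemma indef_sub a b : a <= b -> \int[mu]_(s in `[a, b]) q s = indef q b - indef q a.
Proof.
move=> ab; have [m [m0 ma]] : exists m, m <= 0 /\ m <= a.
  by exists (Num.min a 0); rewrite !ge_min !lexx orbT.
rewrite -!(indefE _ m0) Rintegral_itvB//; last exact: causal_integrable.
rewrite Rintegral_itv_obnd_cbnd//.
apply: integrableS (causal_integrable a b) => //.
by apply: subset_itvr; rewrite bnd_simp.
Qed.

Lemma indef_continuous : continuous (indef q).
Proof.
move=> t; pose a := Num.min t 0 - 1.
have a0 : a <= 0 by rewrite /a lerBlDr ge_min add0r ler01 orbT.
have at_ : a < t by rewrite /a ltrBlDr gt_min ltrDl ltr01.
have ab : a <= t + 1 by rewrite (le_trans (ltW at_))// lerDl.
have := parameterized_integral_continuous ab (causal_integrable a (t + 1)).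
have -> : (fun x => parameterized_integral mu a x q) = indef q.
  by apply/funext => x; exact: indefE.
move=> /within_continuous_continuous; apply.
  by rewrite (lt_trans at_)// ltrDl.
by rewrite in_itv/= at_ ltrDl ltr01.
Qed.

Lemma indef_derive t : {for t, continuous q} -> is_derive t 1 (indef q) (q t).
Proof.
move=> qt; pose a := Num.min t 0 - 1.
have a0 : a <= 0 by rewrite /a lerBlDr ge_min add0r ler01 orbT.
have at_ : a < t by rewrite /a ltrBlDr gt_min ltrDl ltr01.
have t1 : t < t + 1 by rewrite ltrDl.
have [] := continuous_FTC1_closed t1 (causal_integrable a (t + 1)) at_ qt.
have -> : (fun x => \int[mu]_(s in `[a, x]) q s) = indef q.
  by apply/funext => x; exact: indefE.
by move=> dF dE; exact: (DeriveDef dF (etrans (esym (derive1E _ _)) dE)).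
Qed.

Lemma indef_bound a b K : a <= b -> (forall t, t \in `[a, b] -> `|q t| <= K) ->
  `|\int[mu]_(s in `[a, b]) q s| <= K * (b - a).
Proof.
move=> ab qK; have qi := causal_integrable a b.
rewrite (le_trans (le_normr_Rintegral _ qi))//.
have <- : \int[mu]_(s in `[a, b]) K = K * (b - a).
  rewrite Rintegral_cst//= lebesgue_measure_itv/= lte_fin.
  by case: ltP => // ba; congr (_ * _); apply/eqP; rewrite eq_sym subr_eq0 eq_le ab ba.
apply: le_Rintegral => //.
- exact: integrable_norm.
- apply: measurable_bounded_integrable => //.
    by rewrite /= lebesgue_measure_itv/=; case: ifPn; rewrite ?ltry.
  by exists `|K|; split; rewrite ?num_real// => M KM x _; rewrite /= ltW.
Qed.

End CausalIntegral.

Lemma Rintegral_sumr (R : realType) (a b : R) p (f : 'I_p -> R -> R) :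
  (forall i, (@lebesgue_measure R).-integrable `[a, b] (EFin \o f i)) ->
  \int[@lebesgue_measure R]_(x in `[a, b]) (\sum_i f i x) =
  \sum_i \int[@lebesgue_measure R]_(x in `[a, b]) f i x.
Proof.
move=> fi; rewrite /Rintegral; under eq_integral do rewrite -sumEFin.
rewrite integral_sum//.
rewrite [RHS]sum_fine// => i _; apply: integrable_fin_num; last exact: fi.
exact: measurable_itv.
Qed.

Section DelayConvolution.
Context {R : realType}.
Local Notation mu := (@lebesgue_measure R).
Variables (m : nat) (A : 'M[R]_m) (B : 'cV[R]_m) (D : R) (v : R -> R).
Hypotheses (D0 : 0 <= D) (cv : causal v).

Let mI (i : interval R) :
  measurable ([set` i] : set (g_sigma_algebraType R.-ocitv.-measurable)).
Proof. exact: measurable_itv. Qed.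

Lemma expmx_continuous i j : continuous (fun s : R => expmx (s *: A) i j).
Proof. by move=> s; apply: is_derive_continuous (expmx_derive A s i j). Qed.

Definition propagator (s : R) : 'cV[R]_m := expmx (s *: A) *m B.

Lemma propagator_continuous i : continuous (fun s : R => propagator s i 0).
Proof.
move=> s; rewrite /propagator.
have -> : (fun s => (expmx (s *: A) *m B) i 0) =
    (fun s => \sum_k expmx (s *: A) i k * B k 0).
  by apply/funext => x; rewrite mxE.
by apply: cvg_sumr => k; apply: cvgM; [exact: expmx_continuous|exact: cvg_cst].
Qed.

Lemma causalM (phi : R -> R) : continuous phi -> causal (fun s => phi s * v s).
Proof.
move=> cphi; have [v0 vi] := cv; split => [t t0|T]; first by rewrite v0// mulr0.
have cT : {within `[0, T], continuous phi} by exact: continuous_subspaceT.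
have /integrableP[/measurable_EFinP mphi _] := within_continuous_integrable cT.
have /compact_bounded[M [_ mrt]] := continuous_compact cT (@segment_compact _ 0 T).
apply: (@integrableMr _ _ _ mu _ _ phi (EFin \o v)) => //.
by exists M; split; rewrite ?num_real // => ? ? ? ?; exact: mrt.
Qed.

Let q i s := propagator (- s) i 0 * v s.

Let cq i : causal (q i).
Proof.
apply: causalM => s; apply: (@continuous_comp _ _ _ -%R (fun s => propagator s i 0)).
  exact: opp_continuous.
exact: propagator_continuous.
Qed.

Definition delay_moment (t : R) : 'cV[R]_m := \col_i indef (q i) t.

(** The factor e^((t - D)A) is pulled out of the integral, leaving a difference of two values of a
    primitive. The derivative then follows from the product rule and the fundamental theorem of
    calculus, without differentiating under the integral sign. *)
Definition delay_term (t : R) : 'cV[R]_m :=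
  expmx ((t - D) *: A) *m (delay_moment t - delay_moment (t - D)).

Lemma delay_termE t :
  \col_i \int[mu]_(tau in `[t - D, t]) ((expmx ((t - D - tau) *: A) *m B) i 0 * v tau)
  = delay_term t.
Proof.
apply/colP => i; rewrite [LHS]mxE /delay_term mxE.
have tD : t - D <= t by rewrite gerBl.
transitivity (\sum_k expmx ((t - D) *: A) i k * \int[mu]_(s in `[t - D, t]) q k s).
  transitivity (\int[mu]_(s in `[t - D, t])
      \sum_k expmx ((t - D) *: A) i k * q k s).
    apply: eq_Rintegral => s _.
    rewrite expmxD -mulmxA mxE mulr_suml; apply: eq_bigr => k _.
    by rewrite /q /propagator mulrA.
  have qi k : mu.-integrable `[t - D, t] (EFin \o q k) by exact: causal_integrable.
  have qi' k : mu.-integrable `[t - D, t]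
      (EFin \o (fun s => expmx ((t - D) *: A) i k * q k s)).
    have := integrableZl (mI `[t - D, t]) (expmx ((t - D) *: A) i k) (qi k).
    by apply: eq_integrable.
  rewrite Rintegral_sumr//; apply: eq_bigr => k _.
  by rewrite RintegralZl.
by apply: eq_bigr => k _; rewrite indef_sub// !mxE.
Qed.

Let sum_delay_term t i : delay_term t i 0 =
  \sum_k expmx ((t - D) *: A) i k * (indef (q k) t - indef (q k) (t - D)).
Proof. by rewrite mxE; apply: eq_bigr => k _; rewrite !mxE. Qed.

Let continuous_shift (f : R -> R) : continuous f -> continuous (fun t => f (t - D)).
Proof.
move=> cf t; apply: (@continuous_comp _ _ _ (fun t => t - D) f); last exact: cf.
by apply: cvgB; [exact: cvg_id|exact: cvg_cst].
Qed.

Lemma delay_term_continuous i : continuous (fun t => delay_term t i 0).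
Proof.
rewrite (funext (fun t => sum_delay_term t i)) => t.
apply: cvg_sumr => k; apply: cvgM.
  exact: (@continuous_shift (fun s => expmx (s *: A) i k) (@expmx_continuous i k) t).
apply: cvgB; first exact: indef_continuous.
by apply: continuous_shift; exact: indef_continuous.
Qed.

Let is_derive_shift (f : R -> R) (t l : R) :
  is_derive (t - D) 1 f l -> is_derive t 1 (fun s => f (s - D)) l.
Proof.
move=> df; have ds : is_derive t 1 (fun s : R => s - D) 1.
  apply: is_derive_eq (is_deriveB (is_derive_id t 1) (is_derive_cst D t 1)) _.
  by rewrite subr0.
by rewrite -[l]mulr1; exact: (@is_derive1_comp _ f (fun s => s - D) _ _ _ df ds).
Qed.

(** The primitive contributes v(t) e^(-tA) B and v(t - D) e^(-(t - D)A) B; the outer exponential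
    turns the two vectors into e^(-DA) B and B. *)
Lemma delay_term_derive t :
  {for t, continuous v} -> {for (t - D), continuous v} ->
  is_derive_mx delay_term t
    (A *m delay_term t + v t *: propagator (- D) - v (t - D) *: B).
Proof.
move=> vt vtD.
have dE : is_derive_mx (fun s => expmx ((s - D) *: A)) t (A *m expmx ((t - D) *: A)).
  by move=> i k; exact: (@is_derive_shift (fun s => expmx (s *: A) i k)
    _ _ (expmx_derive A (t - D) i k)).
have cq' k s : {for s, continuous v} -> {for s, continuous (q k)}.
  move=> vs; apply: cvgM; last exact: vs.
  apply: (@continuous_comp _ _ _ -%R (fun s => propagator s k 0)).
    exact: opp_continuous.
  exact: propagator_continuous.
have dM : is_derive_mx (fun s => delay_moment s - delay_moment (s - D)) t
    (v t *: propagator (- t) - v (t - D) *: propagator (- (t - D))).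
  move=> k j; rewrite (ord1 j).
  have -> : (fun s => (delay_moment s - delay_moment (s - D)) k 0) =
      (fun s => indef (q k) s - indef (q k) (s - D)).
    by apply/funext => s; rewrite !mxE.
  apply: is_derive_eq (is_deriveB (indef_derive (cq k) (cq' k t vt))
    (is_derive_shift (indef_derive (cq k) (cq' k _ vtD)))) _.
  have mB (X Y : 'cV[R]_m) : (X - Y) k 0 = X k 0 - Y k 0 by rewrite !mxE.
  have mZ a (X : 'cV[R]_m) : (a *: X) k 0 = a * X k 0 by rewrite mxE.
  by rewrite mB !mZ /q; ring.
have E a s : expmx ((t - D) *: A) *m (a *: propagator (- s)) =
    a *: propagator (t - D - s).
  by rewrite -scalemxAr /propagator mulmxA -expmxD.
have p0 : propagator 0 = B by rewrite /propagator expmx0 mul1mx.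
have E' : expmx ((t - D) *: A) *m
    (v t *: propagator (- t) - v (t - D) *: propagator (- (t - D))) =
    v t *: propagator (- D) - v (t - D) *: B.
  rewrite mulmxBr 2!E [t - D - (t - D)]subrr p0.
  by have -> : t - D - t = - D by ring.
have := is_derive_mulmx dE dM.
by rewrite E' addrA -mulmxA.
Qed.

Lemma delay_term_entry_bound t K M i : 0 <= M ->
  (forall s, s \in `[- D, 0] -> `|propagator s i 0| <= M) ->
  (forall s, s \in `[t - D, t] -> `|v s| <= K) ->
  `|delay_term t i 0| <= M * K * D.
Proof.
move=> M0 PM vK; rewrite -delay_termE mxE.
have tD : t - D <= t by rewrite gerBl.
have c : continuous (fun s => propagator (t - D - s) i 0).
  move=> s; apply: (@continuous_comp _ _ _ (fun s => t - D - s) (fun s => propagator s i 0)).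
    by apply: cvgB; [exact: cvg_cst|exact: cvg_id].
  exact: propagator_continuous.
have := @indef_bound _ _ (causalM c) (t - D) t (M * K) tD.
rewrite opprB addrCA subrr addr0; apply => s sD.
rewrite normrM ler_pM// ?vK//; apply: PM.
by move: sD; rewrite !in_itv/= => /andP[? ?]; apply/andP; split; lra.
Qed.

End DelayConvolution.

(** C is chosen before v and t: it involves only the maximum of e^(sA) B over the compact window
    [-D, 0]. *)
Lemma delay_term_bound (R : realType) (m : nat) (A : 'M[R]_m) (B : 'cV[R]_m) (D : R) :
  0 <= D -> exists2 C : R, 0 <= C & forall (v : R -> R) (t K : R), causal v ->
    (forall s, s \in `[t - D, t] -> `|v s| <= K) ->
    nsq (delay_term A B D v t) <= C * K ^+ 2.
Proof.
move=> D0.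
have cP : {within `[- D, 0], continuous (fun s : R => \sum_i `|propagator A B s i 0|)}.
  apply: continuous_subspaceT => s; apply: cvg_sumr => i.
  by apply: cvg_norm; exact: propagator_continuous.
have [|c0 _ cM] := EVT_max _ cP; first by rewrite oppr_le0.
set M := \sum_i _ in cM.
have M0 : 0 <= M by apply: sumr_ge0.
exists (\sum_(i < m) (M * D) ^+ 2).
  by apply: sumr_ge0 => i _; exact: sqr_ge0.
move=> v t K cv vK; rewrite /nsq mulr_suml; apply: ler_sum => i _.
rewrite -exprMn mulrAC -[leLHS]real_normK ?num_real//.
have := @delay_term_entry_bound _ _ A B D v D0 cv t K M i M0.
move=> H; have {}H : `|delay_term A B D v t i 0| <= M * K * D.
  apply: H => // s sD; apply: le_trans (cM s sD); rewrite (bigD1 i)//= lerDl.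
  by apply: sumr_ge0.
by rewrite lerXn2r ?nnegrE// (le_trans _ H).
Qed.

(** * The reduced state in block coordinates *)

Section State.
Context {R : realType}.
Variable n : nat.
Implicit Types (u z : R) (w : nat -> R).

Lemma stateD u w z u' w' z' :
  state n u w z + state n u' w' z' = state n (u + u') (fun j => w j + w' j) (z + z').
Proof.
rewrite /state !add_col_mx -!raddfD/=; congr (col_mx (col_mx _ _) _).
by apply/colP => i; rewrite !mxE.
Qed.

Lemma stateZ k u w z :
  k *: state n u w z = state n (k * u) (fun j => k * w j) (k * z).
Proof.
rewrite /state !scale_col_mx !scale_scalar_mx; congr (col_mx (col_mx _ _) _).
by apply/colP => i; rewrite !mxE.
Qed.

Lemma stateN u w z : - state n u w z = state n (- u) (fun j => - w j) (- z).
Proof.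
rewrite -scaleN1r stateZ !mulN1r; congr state.
by apply/funext => j; rewrite mulN1r.
Qed.

Lemma nsq_state u w z : nsq (state n u w z) = u ^+ 2 + \sum_(j < n) w j ^+ 2 + z ^+ 2.
Proof.
rewrite !nsq_col_mx /nsq !big_ord1 !mxE eqxx !mulr1n; congr (_ + _ + _).
by apply: eq_bigr => j _; rewrite mxE.
Qed.

Lemma state_inj u w z u' w' z' : state n u w z = state n u' w' z' ->
  [/\ u = u', forall j, (j < n)%N -> w j = w' j & z = z'].
Proof.
rewrite /state => /eq_col_mx[/eq_col_mx[uu ww] zz]; split.
- by move/matrixP : uu => /(_ 0 0); rewrite !mxE !mulr1n.
- by move=> j jn; move/colP : ww => /(_ (Ordinal jn)); rewrite !mxE.
- by move/matrixP : zz => /(_ 0 0); rewrite !mxE !mulr1n.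
Qed.

Lemma eq_state u w z u' w' z' : u = u' -> (forall j, (j < n)%N -> w j = w' j) ->
  z = z' -> state n u w z = state n u' w' z'.
Proof.
move=> -> ww ->; congr (col_mx (col_mx _ _) _).
by apply/colP => i; rewrite !mxE ww.
Qed.

Lemma is_derive_mx_col p q r (F : R -> 'M[R]_(p, r)) (G : R -> 'M[R]_(q, r)) t F' G' :
  is_derive_mx F t F' -> is_derive_mx G t G' ->
  is_derive_mx (fun s => col_mx (F s) (G s)) t (col_mx F' G').
Proof.
move=> dF dG i j; case: (split_ordP i) => k ->.
  rewrite col_mxEu (funext (fun s => col_mxEu (F s) (G s) k j)); exact: dF.
rewrite col_mxEd (funext (fun s => col_mxEd (F s) (G s) k j)); exact: dG.
Qed.

Lemma is_derive_mx_scalar (f : R -> R) (t f' : R) : is_derive t 1 f f' ->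
  is_derive_mx (fun s => (f s)%:M : 'M[R]_1) t f'%:M.
Proof.
move=> df i j; rewrite !ord1 (_ : (fun s => _) = f).
  by rewrite mxE eqxx mulr1n.
by apply/funext => s; rewrite mxE eqxx mulr1n.
Qed.

Lemma is_derive_state (u z : R -> R) (w : nat -> R -> R) (t u' : R) w' z' :
  is_derive t 1 u u' -> (forall j, is_derive t 1 (w j) (w' j)) ->
  is_derive t 1 z z' ->
  is_derive_mx (fun s => state n (u s) (w^~ s) (z s)) t (state n u' w' z').
Proof.
move=> du dw dz; apply: is_derive_mx_col; last exact: is_derive_mx_scalar.
apply: is_derive_mx_col; first exact: is_derive_mx_scalar.
move=> i j; rewrite mxE (_ : (fun s => _) = w i); first exact: dw.
by apply/funext => s; rewrite mxE.
Qed.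

Lemma continuous_halfline_state (u z : R -> R) (w : nat -> R -> R) i :
  continuous_halfline u -> (forall j, continuous_halfline (w j)) ->
  continuous_halfline z ->
  continuous_halfline (fun s => state n (u s) (w^~ s) (z s) i 0).
Proof.
move=> cu cw cz; case: (split_ordP i) => k ->; last first.
  rewrite (_ : (fun s => _) = z)//; apply/funext => s.
  by rewrite col_mxEd ord1 mxE eqxx mulr1n.
case: (split_ordP k) => l ->.
  rewrite (_ : (fun s => _) = u)//; apply/funext => s.
  by rewrite !col_mxEu ord1 mxE eqxx mulr1n.
rewrite (_ : (fun s => _) = w l)//; apply/funext => s.
by rewrite col_mxEu col_mxEd mxE.
Qed.

End State.

(** * The stable energy and the H^1_0 norm *)

Section SpectralEstimates.
Context {R : realType}.
Variables (L : R) (c : R -> R) (e : nat -> H2 L) (lam : nat -> R) (n : nat).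
Hypotheses (L0 : 0 < L) (Lc : Linfty L c) (sp : spectral_data c e lam).
Hypothesis un : unstable_count lam n.
Implicit Type f : H2 L.

Let He := eig_basis sp.

Lemma stable_le j : (n <= j)%N -> lam j <= lam n.
Proof. by case: un => _ + _; exact. Qed.

Lemma stable_lt0 : lam n < 0. Proof. by case: un. Qed.

Lemma calA_energy_cvg f : dirichlet f ->
  \sum_(0 <= j < N) (- lam j * ip L f (e j) ^+ 2) @[N --> \oo] -->
  ip L (dx f) (dx f) - ip L (fun x => c x * f x) f.
Proof.
move=> Df; rewrite (calA_energy L0 Lc Df) addrAC subrr add0r.
apply: cvg_eq (cvgN (parseval He (calA_L2 L0 Lc f) (h2_L2 L0 f))) => N.
rewrite /= -sumrN; apply: eq_bigr => j _.
by rewrite (calA_coef L0 Lc sp)//; ring.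
Qed.

(** Serves for the initial value. The full series sums to |f'|^2 - <c f, f>; discarding the
    nonnegative terms beyond N only helps, discarding the first n terms costs at most Lam |f|^2, and
    Poincare's inequality absorbs |f|^2. *)
Lemma stable_energy_le : exists2 C : R, 0 <= C & forall f N, dirichlet f ->
  \sum_(n <= j < N) (- lam j * ip L f (e j) ^+ 2) <= C * ip L (dx f) (dx f).
Proof.
have [M M0 HM] := Linfty_bound Lc.
pose Lam := \sum_(j < n) lam j.
have lam0 (j : 'I_n) : 0 <= lam j by case: un => + _ _; apply.
have Lam0 : 0 <= Lam by apply: sumr_ge0.
exists (1 + (M + Lam) * L ^+ 2).
  by apply: addr_ge0 => //; apply: mulr_ge0; rewrite ?addr_ge0 ?sqr_ge0.
move=> f N Df; have Lf := h2_L2 L0 f; have P := poincare L0 Df.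
have S0 : \sum_(0 <= j < n) lam j * ip L f (e j) ^+ 2 <= Lam * ip L f f.
  apply: (@le_trans _ _ (\sum_(0 <= j < n) Lam * ip L f (e j) ^+ 2)).
    rewrite !big_mkord; apply: ler_sum => j _; rewrite ler_wpM2r ?sqr_ge0//.
    by rewrite /Lam (bigD1 j)//= lerDl sumr_ge0.
  by rewrite -mulr_sumr ler_wpM2l// bessel.
have t0 j : (n <= j)%N -> 0 <= - lam j * ip L f (e j) ^+ 2.
  move=> nj; rewrite mulr_ge0 ?sqr_ge0// oppr_ge0 ltW//.
  exact: le_lt_trans (stable_le nj) stable_lt0.
have : \sum_(n <= j < N) (- lam j * ip L f (e j) ^+ 2) <=
    ip L (dx f) (dx f) - ip L (fun x => c x * f x) f + Lam * ip L f f.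
  rewrite -lerBlDr; apply: cvgr_to_ge (calA_energy_cvg Df) _.
  exists (maxn n N) => // N' /=; rewrite geq_max => /andP[nN' NN'].
  rewrite (big_cat_nat (leq0n n) nN')/= addrC lerD//; last first.
    rewrite lerNl -sumrN; apply: le_trans S0.
    by apply: ler_sum => j _; rewrite mulNr opprK.
  have [nN|Nn] := leqP n N; last first.
    rewrite big_geq; last exact: ltnW.
    by rewrite big_nat; apply: sumr_ge0 => j /andP[nj _]; exact: t0.
  rewrite [leRHS](big_cat_nat nN NN')/= lerDl big_nat.
  by apply: sumr_ge0 => j /andP[Nj _]; exact/t0/(leq_trans nN).
move=> H; apply: le_trans H _.
have := HM f Lf; rewrite ler_norml => /andP[E1 _].
have E2 : (M + Lam) * ip L f f <= (M + Lam) * (L ^+ 2 * ip L (dx f) (dx f)).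
  by rewrite ler_wpM2l// addr_ge0.
lra.
Qed.

(** Serves at the final time. The term <c f, f> costs a multiple of |f|^2, which is bounded by the
    first n squared coefficients plus H / (- lam n), because - lam_j >= - lam_n on the tail. *)
Lemma energy_le : exists2 C : R, 0 <= C & forall f H, dirichlet f -> 0 <= H ->
  (forall N, \sum_(n <= j < N) (- lam j * ip L f (e j) ^+ 2) <= H) ->
  ip L (dx f) (dx f) <= C * (H + \sum_(j < n) ip L f (e j) ^+ 2).
Proof.
have [M M0 HM] := Linfty_bound Lc.
have l0 := stable_lt0.
exists (1 + M + M / - lam n).
  by rewrite !addr_ge0// divr_ge0// oppr_ge0 ltW.
move=> f H Df H0 HN; have Lf := h2_L2 L0 f.
have E1 : ip L (dx f) (dx f) - ip L (fun x => c x * f x) f <= H.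
  apply: cvgr_to_le (calA_energy_cvg Df) _; exists n => // N /= nN.
  rewrite (big_cat_nat (leq0n n) nN)/= -[leRHS]add0r lerD//.
  rewrite big_mkord; apply: sumr_le0 => j _; rewrite mulNr oppr_le0.
  by rewrite mulr_ge0 ?sqr_ge0//; case: un => + _ _; apply.
have E2 : ip L f f <= \sum_(j < n) ip L f (e j) ^+ 2 + H / - lam n.
  apply: cvgr_to_le (parseval He Lf Lf) _; exists n => // N /= nN.
  rewrite (big_cat_nat (leq0n n) nN)/= lerD//.
    by rewrite big_mkord; apply: ler_sum => j _; rewrite expr2.
  rewrite ler_pdivlMr ?oppr_gt0//; apply: le_trans (HN N).
  rewrite mulr_suml !big_nat; apply: ler_sum => j /andP[nj _].
  rewrite -expr2 mulrC ler_wpM2r ?sqr_ge0// lerN2; exact: stable_le.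
have := HM f Lf; rewrite ler_norml => /andP[_ E3].
set S := \sum_(j < n) _ in E2 *.
have S0 : 0 <= S by apply: sumr_ge0 => j _; exact: sqr_ge0.
have E4 : M * ip L f f <= M * (S + H / - lam n) by rewrite ler_wpM2l.
have E5 : 0 <= M / - lam n * S by rewrite mulr_ge0// divr_ge0// oppr_ge0 ltW.
have -> : (1 + M + M / - lam n) * (H + S) =
  H + S + M * H + M * (S + H / - lam n) + M / - lam n * S by ring.
have : 0 <= M * H by rewrite mulr_ge0.
lra.
Qed.

End SpectralEstimates.

Lemma is_derive_affine (R : realType) (f g : R -> R) (t f' g' k m : R) :
  is_derive t 1 f f' -> is_derive t 1 g g' ->
  is_derive t 1 (fun s => k * f s + g s - m) (k * f' + g').
Proof.
move=> df dg; rewrite (_ : (fun s => _) = k *: f + g - cst m)//.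
by apply: is_derive_eq; rewrite subr0.
Qed.

Lemma is_derive_mxD (R : realType) p q (F G : R -> 'M[R]_(p, q)) t F' G' :
  is_derive_mx F t F' -> is_derive_mx G t G' ->
  is_derive_mx (fun s => F s + G s) t (F' + G').
Proof.
move=> dF dG i j; rewrite mxE (_ : (fun s => _) = (fun s => F s i j) + (fun s => G s i j)).
  by have [] := (dF i j, dG i j) => ? ?; apply: is_deriveD.
by apply/funext => s; rewrite mxE.
Qed.

Section L2FunctionalTheory.
Context {R : realType}.
Variables (L C : R) (phi : (R -> R) -> R).
Hypothesis Hphi : L2_functional L C phi.
Implicit Types f g : R -> R.

Lemma functional_linear k f g : L2 L f -> L2 L g ->
  phi (fun x => k * f x + g x) = k * phi f + phi g.
Proof. by case: Hphi => _ + _; exact. Qed.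

Lemma functional0 : phi (fun=> 0) = 0.
Proof.
have := functional_linear 1 (L2_0 L) (L2_0 L).
have -> : (fun=> 1 * 0 + 0) = (fun=> 0) :> (R -> R).
  by apply/funext => x; rewrite mulr0 addr0.
by lra.
Qed.

Lemma functionalZ k f : L2 L f -> phi (fun x => k * f x) = k * phi f.
Proof.
move=> Lf; have := functional_linear k Lf (L2_0 L); rewrite functional0 addr0 => <-.
by congr phi; apply/funext => x; rewrite addr0.
Qed.

Lemma functionalD f g : L2 L f -> L2 L g ->
  phi (fun x => f x + g x) = phi f + phi g.
Proof.
move=> Lf Lg; have := functional_linear 1 Lf Lg; rewrite mul1r => <-.
by congr phi; apply/funext => x; rewrite mul1r.
Qed.

Lemma functionalB f g : L2 L f -> L2 L g ->
  phi (fun x => f x - g x) = phi f - phi g.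
Proof.
move=> Lf Lg; rewrite addrC -mulN1r -functional_linear//.
by congr phi; apply/funext => x; rewrite mulN1r addrC.
Qed.

End L2FunctionalTheory.

Lemma unit_ramp_L2 (R : realType) (L : R) : 0 < L -> L2 L (fun x => x / L).
Proof.
move=> L0; have := L2B (L2_cst L 1) (ramp_L2 L0).
by congr (L2 L _); apply/funext => x; rewrite /ramp; ring.
Qed.

Lemma afun_L2 (R : realType) (L : R) (c : R -> R) : 0 < L -> Linfty L c ->
  L2 L (afun L c).
Proof.
move=> L0 Lc; have := L2_bounded_mul Lc (unit_ramp_L2 L0).
by congr (L2 L _); apply/funext => x; rewrite /afun mulrC.
Qed.

Lemma bfun_L2 (R : realType) (L : R) : 0 < L -> L2 L (bfun L).
Proof. by move=> /unit_ramp_L2/L2N. Qed.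

(** * Equilibrium and reduced dynamics *)

Section Equilibrium.
Context {R : realType}.
Variables (L D : R) (c : R -> R) (e : nat -> H2 L) (lam : nat -> R) (n : nat).
Variable K : 'rV[R]_(1 + n + 1).
Hypotheses (L0 : 0 < L) (Lc : Linfty L c) (sp : spectral_data c e lam).
Hypothesis un : unstable_count lam n.
Hypothesis hK : hurwitz (AK D c e lam K).

Local Notation A := (Amx c e lam n).
Local Notation B := (Bmx e lam n).
Local Notation tf := (tailf e lam n).

Lemma Amx_state u w z : A *m state n u w z =
  state n 0 (fun j => acoef c e j * u + lam j * w j)
    (alpha c e lam n * u + \sum_(j < n) dx (e j) 0 * w j).
Proof.
rewrite /Amx /A1 /L1 /state mul_block_col !mul0mx !addr0.
rewrite mul_block_col !mul0mx addr0 mul_row_col.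
congr (col_mx (col_mx _ _) _).
- by apply/matrixP => i j; rewrite !mxE mul0rn.
- apply/colP => i; rewrite mul_diag_mx !mxE big_ord1 !mxE.
  by rewrite mulr1n.
- apply/matrixP => i j; rewrite !ord1 -scalar_mxM !mxE eqxx !mulr1n.
  by congr (_ + _); apply: eq_bigr => k _; rewrite !mxE.
Qed.

Lemma BmxE : B = state n 1 (bcoef e) (beta e lam n).
Proof. by []. Qed.

Definition head_row : 'rV[R]_(1 + n + 1) := row_mx (row_mx 1%:M 0) 0.

Lemma head_state u w z : head_row *m state n u w z = u%:M.
Proof. by rewrite /head_row /state !mul_row_col !mul0mx !addr0 mul1mx. Qed.

Lemma head_Amx : head_row *m A = 0.
Proof.
rewrite /head_row /Amx /A1 mul_row_block !mul0mx !addr0 mul_row_block.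
by rewrite !mul0mx !mulmx0 !addr0 !row_mx0.
Qed.

(* The first row of A vanishes, so the first coordinate of the input is integrated
   without drift. *)
Lemma head_expmx t : head_row *m expmx (t *: A) = head_row.
Proof.
apply/rowP => j.
pose F (s : R) : R := (head_row *m expmx (s *: A)) 0 j.
have dh s : is_derive_mx (fun=> head_row) s (0 : 'rV[R]_(1 + n + 1)).
  move=> i k; have -> : (0 : 'rV[R]_(1 + n + 1)) i k = 0 by rewrite mxE.
  exact: is_derive_cst.
have dF (s : R) : is_derive s 1 F 0.
  have := is_derive_mulmx (dh s) (expmx_derive A s) 0 j.
  by rewrite mul0mx add0r mulmxA head_Amx mul0mx mxE.
by have := is_derive_0_is_cst t 0 dF; rewrite /F expmx0 mulmx1.
Qed.

Lemma AK_unit : AK D c e lam K \in unitmx.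
Proof.
rewrite unitmxE unitfE; apply/negP => /det0P[x x0 xA].
have : eigenvalue (map_mx (real_complex R) (AK D c e lam K)) 0.
  apply/eigenvalueP; exists (map_mx (real_complex R) x); last by rewrite map_mx_eq0.
  by rewrite -map_mxM xA scale0r map_mx0.
by move/hK; rewrite ltxx.
Qed.

Lemma head_B : head_row *m B = 1%:M.
Proof. exact: head_state. Qed.

Lemma tailf_functional : exists C, L2_functional L C tf.
Proof.
have [C C0 HC] := tailf_bound L0 Lc sp un.
exists (Num.sqrt C); split; first exact: sqrtr_ge0.
  by move=> k f g Lf Lg; exact: tailf_linear L0 Lc sp n un k f g Lf Lg.
move=> f Lf; rewrite -(@ler_pXn2r _ 2)// ?nnegrE ?mulr_ge0 ?sqrtr_ge0 ?l2norm_ge0//.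
by rewrite real_normK ?num_real// exprMn sqr_sqrtr// sqr_l2norm HC.
Qed.

Section EquilibriumPoint.
Variables (re : R) (de : R -> R) (we : H2 L).
Hypotheses (Lde : L2 L de) (Ewe : equilibrium_profile D c e lam K re de we).

Local Notation X := (Xe D c e lam K re de).
Local Notation ue := (u_e D c e lam K re de).
Local Notation ze := (zeta_e D c e lam K re de).
Local Notation wc := (wcoef_e D c e lam K re de).

Lemma Xe_state : X = state n ue wc ze.
Proof.
rewrite -[LHS]vsubmxK -[usubmx X]vsubmxK; congr (col_mx (col_mx _ _) _).
- by rewrite [LHS]mx11_scalar.
- apply/colP => i; rewrite [RHS]mxE /wcoef_e.
  by rewrite insubT// => iN; congr (dsubmx _ _ _); apply: val_inj.
- by rewrite [LHS]mx11_scalar.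
Qed.

Lemma AK_Xe : AK D c e lam K *m X = - Gamma_e e lam n re de.
Proof. by rewrite /Xe mulmxN mulKVmx// AK_unit. Qed.

(** By [head_Amx], [head_expmx] and [head_B] the first row of A_K is K, while the first entry of
    Gamma_e is 0. *)
Lemma K_Xe : K *m X = 0.
Proof.
have := congr1 (mulmx head_row) AK_Xe.
rewrite /AK mulmxDl mulmxDr !mulmxA head_Amx mul0mx add0r head_expmx.
have -> : head_row *m - Gamma_e e lam n re de = 0.
  by rewrite mulmxN [_ *m _]head_state raddf0 oppr0.
rewrite head_B => H.
by rewrite mul1mx in H.
Qed.

(** As K X_e = 0, the equation A_K X_e = - Gamma_e reduces to A X_e = - Gamma_e, which covers j < n
    and the trace relation; for j >= n the identity is built into [wcoef_e]. *)
Lemma equilibrium_eqs :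
  (forall j, lam j * wc j = - (acoef c e j * ue) - decoef e de j) /\
  alpha c e lam n * ue + \sum_(j < n) dx (e j) 0 * wc j = re + tf de.
Proof.
have : A *m X = - Gamma_e e lam n re de.
  by rewrite -AK_Xe /AK mulmxDl -!mulmxA K_Xe !mulmx0 addr0.
rewrite {1}Xe_state Amx_state /Gamma_e stateN => /state_inj[_ E1 E2]; split.
  move=> j; have [jn|nj] := ltnP j n.
    by have := E1 j jn; lra.
  rewrite /wcoef_e insubF; last by rewrite ltnNge nj.
  by field; apply: unstable_count_neq0 nj.
by rewrite E2 /tailf /decoef; ring.
Qed.

Let He := eig_basis sp.
Let Lwe := h2_L2 L0 we.

Lemma we_coef j : ip L we (e j) = wc j.
Proof.
by case: Ewe => _ /(L2_sum_coef He Lwe); exact.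
Qed.

Let La := afun_L2 L0 Lc.

Lemma calA_we_coef j :
  ip L (calA c we) (e j) = - (acoef c e j * ue) - decoef e de j.
Proof.
have [Dw _] := Ewe; rewrite (calA_coef L0 Lc sp)// we_coef.
by case: equilibrium_eqs.
Qed.

Lemma tailf_calA_we : tf (calA c we) = - (ue * tf (afun L c)) - tf de.
Proof.
have [C tfC] := tailf_functional.
have LZ := L2Z (- ue) La.
rewrite -mulNr -(functionalZ tfC)// -(functionalB tfC)//.
congr tail; apply/funext => j; rewrite calA_we_coef ipBl//; last exact: h2_L2.
by rewrite ipZl//; [rewrite /acoef /decoef; ring|exact: h2_L2].
Qed.

(** In terms of y_e = w_e + (x / L) u_e this says that the output y_e'(0) equals its set point
    r_e. *)
Lemma trace0_we : dx we 0 = re - ue / L.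
Proof.
have [Dw _] := Ewe; rewrite (trace0_expansion L0 Lc sp un Dw) tailf_calA_we.
have [_] := equilibrium_eqs; rewrite /alpha -/(tf (afun L c)).
rewrite big_mkord; under [in X in _ -> X]eq_bigr do rewrite we_coef.
by lra.
Qed.

Section Trajectory.
Variables (r : R -> R) (d : R -> R -> R) (y0 : H2 L) (z0 : R).
Variables (v : R -> R) (y : R -> H2 L) (z : R -> R).
Hypotheses (Ld : forall t, 0 <= t -> L2 L (d t)).
Hypothesis cl : closed_loop D c e lam v y z K r d y0 z0.
Hypothesis D0 : 0 < D.

Local Notation u := (uD D v).
Local Notation W := (delay_term A B D v).

Lemma control_causal : causal v.
Proof. by split; [exact: control_neg cl|exact: control_loc cl]. Qed.

Let cv := control_causal.

Lemma uDE t : u t = indef v (t - D).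
Proof. by rewrite /uD /input; case: ifPn => // tD; rewrite indef0// ltW. Qed.

Definition deviation (t : R) : H2 L := h2_deviation L0 (u t) (y t) we.

Lemma deviation_dirichlet t : 0 <= t -> dirichlet (deviation t).
Proof.
move=> t0; apply: dirichlet_deviation => //; last by case: Ewe.
- exact: y_left cl t t0.
- exact: y_right cl t t0.
Qed.

Let rhs t x := dxx (y t) x + c x * y t x + d t x.

Let rhsE t : rhs t =
  (fun x => (calA c (deviation t) x + calA c we x) + (u t * afun L c x + d t x)).
Proof. by apply/funext => x; rewrite /rhs /calA /= /afun; ring. Qed.

Let Ly t : L2 L (y t). Proof. exact: h2_L2. Qed.
Let LA (f : H2 L) : L2 L (calA c f). Proof. exact: calA_L2. Qed.

Let Lrhs t : 0 <= t -> L2 L (rhs t).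
Proof. by move=> t0; rewrite rhsE; apply: L2D; apply: L2D => //; [exact: L2Z|exact: Ld]. Qed.

(* The control may jump at 0, hence u(t - D) need not be differentiable at t = D. *)
Lemma functional_derivative C phi t : L2_functional L C phi -> 0 <= t ->
  has_derivative_halfline (fun s => phi (y s)) t
    (phi (calA c (deviation t)) + phi (calA c we) + (u t * phi (afun L c) + phi (d t))).
Proof.
move=> Hphi t0; have Lt := Ld t0.
have -> : phi (calA c (deviation t)) + phi (calA c we) +
    (u t * phi (afun L c) + phi (d t)) = phi (rhs t).
  rewrite rhsE (functionalD Hphi); [|exact: L2D|apply: L2D => //; exact: L2Z].
  have LZ := L2Z (u t) La.
  by rewrite (functionalD Hphi (LA _) (LA _)) (functionalD Hphi LZ Lt) (functionalZ Hphi).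
apply: (L2_functional_derivative Hphi) => //; first exact: Lrhs.
exact: y_pde cl t t0.
Qed.

Lemma uD_continuous : continuous u.
Proof.
rewrite (funext uDE) => t.
apply: (@continuous_comp _ _ _ (fun t => t - D) (indef v)); last exact: indef_continuous.
by apply: cvgB; [exact: cvg_id|exact: cvg_cst].
Qed.

Let ipej j := ip_functional (h2_L2 L0 (e j)).

Lemma coef_y_continuous j : continuous_halfline (fun t => ip L (y t) (e j)).
Proof.
apply: halfline_derivative_continuous => t t0; eexists.
exact: functional_derivative (ipej j) t0.
Qed.

Lemma tailf_y_continuous : continuous_halfline (fun t => tf (y t)).
Proof.
have [C HC] := tailf_functional.
apply: halfline_derivative_continuous => t t0; eexists.
exact: functional_derivative HC t0.
Qed.

Lemma z_continuous : continuous_halfline z.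
Proof.
apply: halfline_derivative_continuous => t t0; eexists; exact: z_ode cl t t0.
Qed.

Let Lb := bfun_L2 L0.

Lemma wcoefE t j : wcoef D e v y t j = u t * bcoef e j + ip L (y t) (e j).
Proof.
rewrite /wcoef /bcoef -ipZl//; last exact: h2_L2.
rewrite -ipDl//; [|exact: L2Z|exact: h2_L2].
by congr (ip L _ _); apply/funext => x; rewrite /wfun /bfun; ring.
Qed.

Lemma zetaE t : zeta D e lam n v y z t = z t + u t * beta e lam n - tf (y t).
Proof.
have [C HC] := tailf_functional.
rewrite /zeta; have -> : tail e lam n (wcoef D e v y t) = tf (wfun D v y t) by [].
have -> : wfun D v y t = (fun x => u t * bfun L x + y t x).
  by apply/funext => x; rewrite /wfun /bfun; ring.
rewrite (functional_linear HC)// /beta.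
have -> : tail e lam n (bcoef e) = tf (bfun L) by [].
by ring.
Qed.

Let continuous_uM k : continuous_halfline (fun t => u t * k).
Proof.
apply: continuous_halflineM; last exact: continuous_halfline_cst.
exact/continuous_halflineT/uD_continuous.
Qed.

Lemma Xvec_continuous i : continuous_halfline (fun t => Xvec D e lam n v y z t i 0).
Proof.
rewrite /Xvec; apply: (@continuous_halfline_state _ n u (zeta D e lam n v y z)
   (fun j t => wcoef D e v y t j)).
- exact/continuous_halflineT/uD_continuous.
- move=> j; rewrite (funext (fun t => wcoefE t j)).
  apply: continuous_halflineD; [exact: continuous_uM|exact: coef_y_continuous].
- rewrite (funext zetaE); apply: continuous_halflineD.
    by apply: continuous_halflineD; [exact: z_continuous|exact: continuous_uM].
  rewrite (_ : (fun t => - tf (y t)) = (fun t => -1 * tf (y t))); last first.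
    by apply/funext => t; rewrite mulN1r.
  apply: continuous_halflineM; first exact: continuous_halfline_cst.
  exact: tailf_y_continuous.
Qed.

Lemma ZvecE t : Zvec D c e lam n v y z t = Xvec D e lam n v y z t + W t.
Proof. by rewrite /Zvec delay_termE//; exact: ltW. Qed.

Lemma Zvec_continuous i : continuous_halfline (fun t => Zvec D c e lam n v y z t i 0).
Proof.
have -> : (fun t => Zvec D c e lam n v y z t i 0) =
    (fun t => Xvec D e lam n v y z t i 0 + W t i 0).
  by apply/funext => t; rewrite ZvecE mxE.
apply: continuous_halflineD; first exact: Xvec_continuous.
apply: continuous_halflineT; apply: delay_term_continuous => //.
Qed.

(** Continuity of Z needs only the integrability of v, so the feedback law v = K Z upgrades v to a
    continuous function for t > 0; for t < 0 it is 0. *)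
Lemma control_continuous t : t != 0 -> {for t, continuous v}.
Proof.
rewrite neq_lt => /orP[t0|t0].
  have v0 : \forall s \near t, 0 = v s.
    near=> s; rewrite (control_neg cl)//; near: s; exact: lt_nbhsl.
  suff : v s @[s --> t] --> v t by [].
  rewrite (control_neg cl t0).
  exact: cvg_trans (near_eq_cvg v0) (cvg_cst _).
have cKZ : continuous_halfline (fun s => (K *m Zvec D c e lam n v y z s) 0 0).
  have -> : (fun s => (K *m Zvec D c e lam n v y z s) 0 0) =
      (fun s => \sum_i K 0 i * Zvec D c e lam n v y z s i 0).
    by apply/funext => s; rewrite mxE.
  apply: continuous_halfline_sum => i; apply: continuous_halflineM.
    exact: continuous_halfline_cst.
  exact: Zvec_continuous.
have vE : \forall s \near t, (K *m Zvec D c e lam n v y z s) 0 0 = v s.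
  by apply: filterS (near_ge0 t0) => s s0; rewrite (control_law cl).
suff : v s @[s --> t] --> v t by [].
rewrite (control_law cl (ltW t0)).
exact: cvg_trans (near_eq_cvg vE) (continuous_halfline_at cKZ t0).
Unshelve. all: by end_near. Qed.

Definition dX t : 'cV[R]_(1 + n + 1) :=
  state n (u t - ue) (fun j => ip L (deviation t) (e j)) (zeta D e lam n v y z t - ze).

Definition dZ t : 'cV[R]_(1 + n + 1) := dX t + W t.

Definition dGamma t : 'cV[R]_(1 + n + 1) :=
  state n 0 (fun j => ip L (fun x => d t x - de x) (e j))
    (- (r t - re) - tf (fun x => d t x - de x)).

Lemma coef_deviationE t j :
  ip L (deviation t) (e j) = u t * bcoef e j + ip L (y t) (e j) - ip L we (e j).
Proof.
rewrite -wcoefE /wcoef -ipBl//; last exact: h2_L2.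
rewrite (_ : wfun D v y t = (fun x => u t * bfun L x + y t x)).
  by apply: L2D => //; exact: L2Z.
by apply/funext => x; rewrite /wfun /bfun; ring.
Qed.

Lemma dXE t : dX t = Xvec D e lam n v y z t - X.
Proof.
rewrite Xe_state /Xvec stateN stateD; apply: eq_state => // j jn.
by rewrite coef_deviationE wcoefE we_coef.
Qed.

Lemma controlE (t : R) : 0 <= t -> v t = (K *m dZ t) 0 0.
Proof.
move=> t0; rewrite (control_law cl t0) ZvecE /dZ dXE addrAC mulmxBr K_Xe subr0.
by [].
Qed.

Lemma uD_derive (t : R) : t != D -> is_derive t 1 u (v (t - D)).
Proof.
move=> tD; rewrite (funext uDE).
have d1 : is_derive (t - D) 1 (indef v) (v (t - D)).
  by apply: indef_derive => //; apply: control_continuous; rewrite subr_eq0.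
have d2 : is_derive t (1 : R) (fun s : R => s - D) 1.
  by apply: is_derive_eq; rewrite subr0.
by have := @is_derive1_comp _ (indef v) (fun s => s - D) _ _ _ d1 d2; rewrite mulr1.
Qed.

Lemma coef_deviation_derive (t : R) j : 0 < t -> t != D ->
  is_derive t 1 (fun s => ip L (deviation s) (e j))
    (lam j * ip L (deviation t) (e j) + acoef c e j * (u t - ue)
     + ip L (fun x => d t x - de x) (e j) + bcoef e j * v (t - D)).
Proof.
move=> t0 tD; have t0' := ltW t0.
have -> : (fun s => ip L (deviation s) (e j)) =
    (fun s => bcoef e j * u s + ip L (y s) (e j) - ip L we (e j)).
  by apply/funext => s; rewrite coef_deviationE mulrC.
have dy := halfline_derivative_is_derive t0 (functional_derivative (ipej j) t0').
apply: is_derive_eq (is_derive_affine (bcoef e j) (ip L we (e j)) (uD_derive tD) dy) _.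
rewrite (calA_coef L0 Lc sp)//; last exact: deviation_dirichlet.
rewrite calA_we_coef /decoef ipBl//; [|exact: Ld|exact: h2_L2].
by rewrite /acoef; ring.
Qed.

(** [trace0_expansion] writes the trace of the deviation at 0 as n explicit terms plus
    [tf (calA c _)]. The derivative of - tf (y) cancels that last term, and r_e enters through
    [trace0_we]. *)
Lemma zeta_derive (t : R) : 0 < t -> t != D ->
  is_derive t 1 (fun s => zeta D e lam n v y z s - ze)
    (alpha c e lam n * (u t - ue) + \sum_(j < n) dx (e j) 0 * ip L (deviation t) (e j)
     + beta e lam n * v (t - D) - (r t - re) - tf (fun x => d t x - de x)).
Proof.
move=> t0 tD; have t0' := ltW t0; have [C HC] := tailf_functional.
have -> : (fun s => zeta D e lam n v y z s - ze) =
    (fun s => beta e lam n * u s + (-1 * tf (y s) + z s - 0) - ze).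
  by apply/funext => s; rewrite zetaE; ring.
have dz := halfline_derivative_is_derive t0 (z_ode cl t0').
have dt := halfline_derivative_is_derive t0 (functional_derivative HC t0').
apply: is_derive_eq (is_derive_affine (beta e lam n) ze (uD_derive tD)
  (is_derive_affine (-1) 0 dt dz)) _.
have dxE0 : dx (y t) 0 = dx (deviation t) 0 + u t / L + dx we 0 by rewrite /=; ring.
have := trace0_expansion L0 Lc sp un (deviation_dirichlet t0').
rewrite big_mkord dxE0 trace0_we tailf_calA_we (functionalB HC)//; last exact: Ld.
rewrite /alpha -[tail _ _ _ (acoef _ _)]/(tf (afun L c)) => ->.
by ring.
Qed.

(** The delay term contributes - v(t - D) B, which cancels the delayed input of dX, and v(t) e^(-DA)
    B, which with v = K dZ completes A to A_K. *)
Lemma dZ_derive (t : R) : 0 < t -> t != D ->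
  is_derive_mx dZ t (AK D c e lam K *m dZ t + dGamma t).
Proof.
move=> t0 tD; have t0' := ltW t0.
have dW : is_derive_mx W t (A *m W t + v t *: propagator A B (- D) - v (t - D) *: B).
  apply: delay_term_derive => //; apply: control_continuous; first by rewrite gt_eqF.
  by rewrite subr_eq0.
have du : is_derive t 1 (fun s => u s - ue) (v (t - D)).
  have -> : (fun s => u s - ue) = u - cst ue by [].
  have := uD_derive tD => du.
  by apply: is_derive_eq; rewrite subr0.
have dXt := is_derive_state du (fun j => coef_deviation_derive j t0 tD) (zeta_derive t0 tD).
have dS := is_derive_mxD (dXt n) dW.
have SE : state n (v (t - D))
    (fun j => lam j * ip L (deviation t) (e j) + acoef c e j * (u t - ue)
       + ip L (fun x => d t x - de x) (e j) + bcoef e j * v (t - D))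
    (alpha c e lam n * (u t - ue) + \sum_(j < n) dx (e j) 0 * ip L (deviation t) (e j)
       + beta e lam n * v (t - D) - (r t - re) - tf (fun x => d t x - de x)) =
    A *m dX t + dGamma t + v (t - D) *: B.
  by rewrite /dX Amx_state BmxE stateZ !stateD; apply: eq_state => [|j _|]; ring.
have KZ : K *m dZ t = (v t)%:M by rewrite [LHS]mx11_scalar -controlE.
rewrite SE in dS; suff <- : A *m dX t + dGamma t + v (t - D) *: B +
    (A *m W t + v t *: propagator A B (- D) - v (t - D) *: B) =
    AK D c e lam K *m dZ t + dGamma t by exact: dS.
rewrite /AK mulmxDl -(mulmxA _ K) KZ mul_mx_scalar -/(propagator A B (- D)) mulmxDr.
move: (A *m dX t) (A *m W t) (dGamma t) (_ *: B) (v t *: _) => m1 m2 m3 m4 m5.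
by apply/matrixP => i j; rewrite !mxE; ring.
Qed.

End Trajectory.
End EquilibriumPoint.
End Equilibrium.

Section SquareNorm.
Context {R : realType}.

Lemma is_derive_mx_cst p q (M : 'M[R]_(p, q)) t : is_derive_mx (fun=> M) t 0.
Proof.
by move=> i j; rewrite [X in is_derive _ _ _ X]mxE; exact: is_derive_cst.
Qed.

Lemma is_derive_nsq p (F : R -> 'cV[R]_p) t F' : is_derive_mx F t F' ->
  is_derive t 1 (fun s => nsq (F s)) (2 * \sum_i F t i 0 * F' i 0).
Proof.
move=> dF; rewrite mulr_sumr; apply: is_derive_sumr => i.
have -> : (fun s => F s i 0 ^+ 2) = (fun s => F s i 0 * F s i 0).
  by apply/funext => s; rewrite expr2.
by apply: is_derive_eq (is_derive_mulr (dF i 0) (dF i 0)) _; ring.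
Qed.

Lemma continuous_halfline_nsq p q (Q : 'M[R]_(p, q)) (F : R -> 'cV[R]_q) :
  (forall i, continuous_halfline (fun s => F s i 0)) ->
  continuous_halfline (fun s => nsq (Q *m F s)).
Proof.
move=> cF; apply: continuous_halfline_sum => i.
have cQ : continuous_halfline (fun s => (Q *m F s) i 0).
  rewrite (_ : (fun s => _) = (fun s => \sum_k Q i k * F s k 0)).
    apply: continuous_halfline_sum => k; apply: continuous_halflineM => //.
    exact: continuous_halfline_cst.
  by apply/funext => s; rewrite mxE.
have := continuous_halflineM cQ cQ.
by congr continuous_halfline; apply/funext => s; rewrite expr2.
Qed.

Lemma nsqN p (x : 'cV[R]_p) : nsq (- x) = nsq x.
Proof. by apply: eq_bigr => i _; rewrite mxE sqrrN. Qed.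

(* Young's inequality: 2 x y <= k x^2 + y^2 / k. *)
Lemma young_sum p (x y : 'cV[R]_p) (k : R) : 0 < k ->
  2 * \sum_i x i 0 * y i 0 <= k * nsq x + nsq y / k.
Proof.
move=> k0; rewrite /nsq !mulr_sumr mulr_suml -big_split/=; apply: ler_sum => i _.
rewrite -subr_ge0 (_ : _ - _ = (k * x i 0 - y i 0) ^+ 2 / k).
  by rewrite divr_ge0 ?sqr_ge0 ?ltW.
by field; rewrite gt_eqF.
Qed.

End SquareNorm.

Lemma ip_scale (R : realType) (L k : R) (f : R -> R) : L2 L f ->
  ip L (fun x => k * f x) (fun x => k * f x) = k ^+ 2 * ip L f f.
Proof.
move=> Lf; have Lk := L2Z k Lf.
by rewrite ipZl// ipC ipZl// mulrA expr2.
Qed.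

(** * Decay estimates *)

Section Estimates.
Context {R : realType}.
Variables (L D : R) (c : R -> R) (e : nat -> H2 L) (lam : nat -> R) (n : nat).
Variable K : 'rV[R]_(1 + n + 1).
Hypotheses (L0 : 0 < L) (D0 : 0 < D) (Lc : Linfty L c) (sp : spectral_data c e lam).
Hypothesis un : unstable_count lam n.
Hypothesis hK : hurwitz (AK D c e lam K).

Local Notation A := (Amx c e lam n).
Local Notation B := (Bmx e lam n).
Local Notation tf := (tailf e lam n).

Let He := eig_basis sp.

Lemma bessel_head f : L2 L f -> \sum_(j < n) ip L f (e j) ^+ 2 <= ip L f f.
Proof. by move=> Lf; have := bessel He n Lf; rewrite big_mkord. Qed.

Lemma bessel_tail f N : L2 L f -> \sum_(n <= j < N) ip L f (e j) ^+ 2 <= ip L f f.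
Proof.
move=> Lf; have [Nn|nN] := leqP N n; first by rewrite big_geq// ip_ge0.
apply: le_trans (bessel He N Lf); rewrite (big_cat_nat (leq0n n) (ltnW nN))/= lerDr.
by apply: sumr_ge0 => j _; exact: sqr_ge0.
Qed.

Lemma nsq_disturbance_le : exists2 C : R, 0 <= C & forall f k, L2 L f ->
  nsq (state n 0 (fun j => ip L f (e j)) (- k - tf f)) <= C * (k ^+ 2 + ip L f f).
Proof.
have [C C0 HC] := tailf_bound L0 Lc sp un.
exists (3 + 2 * C); first by rewrite addr_ge0// mulr_ge0.
move=> f k Lf; rewrite nsq_state; have := bessel_head Lf; have := HC f Lf.
have := sqr_ge0 (k - tf f); have := mulr_ge0 C0 (sqr_ge0 k); have := ip_ge0 L f.
move: (\sum_(j < n) _) => S.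
by nra.
Qed.

Lemma nsq_state_le : exists2 C : R, 0 <= C & forall (f : H2 L) u z, dirichlet f ->
  nsq (state n u (fun j => ip L f (e j)) z) <=
  C * (u ^+ 2 + z ^+ 2 + ip L (dx f) (dx f)).
Proof.
exists (1 + L ^+ 2); first by rewrite addr_ge0// sqr_ge0.
move=> f u z Df; rewrite nsq_state.
have := bessel_head (h2_L2 L0 f); have := poincare L0 Df.
have := mulr_ge0 (sqr_ge0 L) (sqr_ge0 u); have := mulr_ge0 (sqr_ge0 L) (sqr_ge0 z).
have := ip_ge0 L (dx f); move: (\sum_(j < n) _) => S.
by nra.
Qed.

(** The nominal values are fields of the record: a constant chosen before the trajectory is then
    uniform in r_e and d_e. *)
Record trajectory : Type := Trajectory {
  tr_re : R; tr_de : R -> R; tr_we : H2 L;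
  tr_r : R -> R; tr_d : R -> R -> R; tr_y0 : H2 L; tr_z0 : R;
  tr_v : R -> R; tr_y : R -> H2 L; tr_z : R -> R;
  tr_de_L2 : L2 L tr_de;
  tr_equilibrium : equilibrium_profile D c e lam K tr_re tr_de tr_we;
  tr_r_continuous : {within `[0, +oo[, continuous tr_r};
  tr_d_C1 : L2_C1 L tr_d;
  tr_closed_loop : closed_loop D c e lam tr_v tr_y tr_z K tr_r tr_d tr_y0 tr_z0 }.

Section OneTrajectory.
Variable tr : trajectory.

Local Notation re := (tr_re tr).
Local Notation de := (tr_de tr).
Local Notation we := (tr_we tr).
Local Notation r := (tr_r tr).
Local Notation d := (tr_d tr).
Local Notation v := (tr_v tr).
Local Notation y := (tr_y tr).
Local Notation z := (tr_z tr).
Local Notation ue := (u_e D c e lam K re de).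
Local Notation ze := (zeta_e D c e lam K re de).

Let Lde := tr_de_L2 tr.
Let Ewe := tr_equilibrium tr.
Let cl := tr_closed_loop tr.
Let Ld t (t0 : 0 <= t) : L2 L (d t) := (tr_d_C1 tr).1 t t0.

Definition tr_dev (t : R) : H2 L := deviation D L0 we v y t.
Definition tr_X (t : R) := dX D c e lam K L0 re de we v y z t.
Definition tr_Z (t : R) := dZ D c e lam K L0 re de we v y z t.
Definition tr_Gamma (t : R) := dGamma e lam n re de r d t.

Definition tr_perturbation (t : R) : R :=
  (r t - re) ^+ 2 + l2norm L (fun x => d t x - de x) ^+ 2.

Definition tr_energy (t : R) : R :=
  (uD D v t - ue) ^+ 2 + (zeta D e lam n v y z t - ze) ^+ 2 + H10norm L (tr_dev t) ^+ 2.

Lemma tr_v_causal : causal v. Proof. exact: control_causal cl. Qed.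

Lemma tr_dev_dirichlet t : 0 <= t -> dirichlet (tr_dev t).
Proof. exact: deviation_dirichlet Ewe _ _ _ _ _ _ _ cl t. Qed.

Lemma tr_ZE t : tr_Z t = tr_X t + delay_term A B D v t.
Proof. by []. Qed.

(** The control vanishes on [-D, 0), so Z starts from X, which the initial energy controls. *)
Lemma tr_Z0 : tr_Z 0 = tr_X 0.
Proof.
rewrite tr_ZE -[RHS]addr0; congr (_ + _).
rewrite /delay_term (_ : delay_moment _ _ _ 0 - _ = 0) ?mulmx0//.
apply/colP => i; have cm := causalM tr_v_causal (@propagator_continuous _ _ _ _ i).
by rewrite !mxE !indef0 ?subr0// sub0r oppr_le0 ltW.
Qed.

Lemma tr_Z_continuous i : continuous_halfline (fun t => tr_Z t i 0).
Proof.
have := Zvec_continuous L0 Lc sp un we Ld cl D0 (i := i) => cZ.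
rewrite (_ : (fun t => _) = (fun t => Zvec D c e lam n v y z t i 0 +
    (- Xe D c e lam K re de) i 0)).
  by apply: continuous_halflineD => //; exact: continuous_halfline_cst.
apply/funext => t; rewrite /tr_Z /dZ (dXE L0 sp Ewe) (ZvecE cl D0) addrAC.
by rewrite [LHS]mxE.
Qed.

Lemma tr_coef_continuous j : continuous_halfline (fun t => ip L (tr_dev t) (e j)).
Proof.
have cy := coef_y_continuous L0 Lc we Ld cl (j := j).
have cu := continuous_halflineT (uD_continuous cl).
rewrite (_ : (fun t => _) = (fun t => uD D v t * bcoef e j + ip L (y t) (e j)
    + - ip L we (e j))).
  apply: continuous_halflineD; last exact: continuous_halfline_cst.
  apply: continuous_halflineD => //; apply: continuous_halflineM => //.
  exact: continuous_halfline_cst.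
by apply/funext => t; rewrite coef_deviationE.
Qed.

Lemma tr_perturbation_ge0 t : 0 <= tr_perturbation t.
Proof. by rewrite addr_ge0 ?sqr_ge0. Qed.

Lemma tr_energy_ge0 t : 0 <= tr_energy t.
Proof. by rewrite !addr_ge0 ?sqr_ge0. Qed.

(** Makes the supremum of the theorem finite; this is where the continuity of r and the time
    regularity of d are used. *)
Lemma tr_perturbation_continuous : continuous_halfline tr_perturbation.
Proof.
have cr : continuous_halfline r.
  have /subspace_continuousP H := tr_r_continuous (t := tr).
  move=> t t0; have := H t; rewrite set_itvE /= => /(_ t0).
  by [].
have cd : continuous_halfline (fun t => ip L (fun x => d t x - de x) (fun x => d t x - de x)).
  have [_ [d' [Ld' dd _]]] := tr_d_C1 tr.
  apply: (@L2_derivative_continuous _ _ (fun t x => d t x - de x)).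
    by move=> s s0; apply: L2B => //; exact: Ld.
  move=> t t0; exists (d' t); first exact: Ld'.
  apply: cvg_eq (dd t t0) => s; congr (l2norm L _); apply/funext => x.
  by congr (_ / _ - _); ring.
rewrite (_ : tr_perturbation = (fun t => (r t + - re) * (r t + - re) +
    ip L (fun x => d t x - de x) (fun x => d t x - de x))).
  apply: continuous_halflineD => //.
  have cr' := continuous_halflineD cr (@continuous_halfline_cst _ (- re)).
  exact: (continuous_halflineM cr' cr').
by apply/funext => t; rewrite /tr_perturbation sqr_l2norm expr2.
Qed.

Lemma nsq_tr_Gamma_le C : (forall f k, L2 L f ->
    nsq (state n 0 (fun j => ip L f (e j)) (- k - tf f)) <= C * (k ^+ 2 + ip L f f)) ->
  forall t, 0 <= t -> nsq (tr_Gamma t) <= C * tr_perturbation t.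
Proof.
move=> HC t t0; have Lt := L2B (Ld t0) Lde.
by rewrite /tr_perturbation sqr_l2norm; exact: HC Lt.
Qed.

(** Everything the estimates use of the gauge. With E abstract, all constants are fixed before eps,
    T and the supremum are known. *)
Record dominates (rho T : R) (E E' : R -> R) : Prop := Dominates {
  dom_derive : forall t : R, is_derive t 1 E (E' t);
  dom_ge0 : forall t, 0 <= E t;
  dom_rate : forall t, - rho * E t <= E' t;
  dom_delay : forall s t, t - D <= s -> s <= t -> E s <= expR (rho * D) * E t;
  dom_init : tr_energy 0 <= E 0;
  dom_perturbation : forall t, 0 <= t <= T -> tr_perturbation t <= E t }.

Lemma dominates_continuous rho T E E' : dominates rho T E E' -> continuous E.
Proof. by move=> dom t; apply: is_derive_continuous; exact: dom_derive dom t. Qed.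

Lemma dominates_comparison rho T E E' (h h' : R -> R) (mu a M : R) :
  dominates rho T E E' -> continuous_halfline h ->
  (forall t : R, 0 < t -> t <= T -> t != D ->
    is_derive t 1 h (h' t) /\ h' t <= - mu * h t + a * E t) ->
  0 <= M -> a <= M * (mu - rho) -> h 0 <= M * E 0 ->
  forall t, 0 <= t <= T -> h t <= M * E t.
Proof.
move=> dom ch dh M0 aM h0 t /andP[t0 tT].
apply: (@comparison _ h h' E E' t D mu rho a M) => //.
- exact: continuous_halfline_within.
- by apply: continuous_subspaceT; exact: dominates_continuous dom.
- move=> s _; split; first exact: dom_ge0 dom s.
  by split; [exact: dom_derive dom s|exact: dom_rate dom s].
- move=> s; rewrite in_itv/= => /andP[s0 st] sD; apply: dh => //.
  by apply: le_trans tT; exact: ltW.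
Qed.

End OneTrajectory.

(** The derivative of |Q Z|^2 is at most - 2 k |Q Z|^2 + 2 <Q Z, Q Gamma>; Young's inequality with
    weight k spends half of the decay and leaves the rate k. *)
Lemma tr_Z_bound : exists2 k : R, 0 < k & forall rho, 0 < rho < k ->
  exists2 M : R, 0 <= M & forall tr T E E', dominates tr rho T E E' ->
    forall t, 0 <= t <= T -> nsq (tr_Z tr t) <= M * E t.
Proof.
have m0 : (0 < 1 + n + 1)%N by rewrite addn1.
have [Q [k [C [k0 C0 QC QM]]]] := hurwitz_lyapunov m0 hK.
have [CQ CQ0 HQ] := nsq_mulmx_le Q.
have [CG CG0 HG] := nsq_disturbance_le.
have [CX CX0 HX] := nsq_state_le.
exists k => // rho /andP[rho0 rhok].
have kr : 0 < k - rho by rewrite subr_gt0.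
pose a := CQ * CG / k.
have a0 : 0 <= a by rewrite !mulr_ge0// invr_ge0 ltW.
(* The first summand meets the condition a <= M (k - rho), the second one bounds the initial
   value. *)
pose M := a / (k - rho) + CQ * CX.
have M1 : 0 <= a / (k - rho) by rewrite divr_ge0// ltW.
have M2 : 0 <= CQ * CX by rewrite mulr_ge0.
have M0 : 0 <= M by rewrite addr_ge0.
exists (C * M); first by rewrite mulr_ge0.
move=> tr T E E' dom t tT.
apply: le_trans (QC _) _; rewrite -mulrA ler_wpM2l//.
move: t tT; apply: (dominates_comparison (a := a) (mu := k)
  (h' := fun t => 2 * \sum_l (Q *m tr_Z tr t) l 0 *
    (Q *m (AK D c e lam K *m tr_Z tr t + tr_Gamma tr t)) l 0) dom) => //.
- by apply: continuous_halfline_nsq => i; exact: tr_Z_continuous.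
- move=> t t0 tT tD; split.
    have Ldt t0 (t0' : 0 <= t0) : L2 L (tr_d tr t0) := (tr_d_C1 tr).1 t0 t0'.
    have dZt := dZ_derive L0 Lc sp un hK (tr_de_L2 tr) (tr_equilibrium tr) Ldt
      (tr_closed_loop tr) D0 t0 tD.
    have := is_derive_nsq (is_derive_mulmx (is_derive_mx_cst Q t) dZt).
    by rewrite mul0mx add0r.
  have := young_sum (Q *m tr_Z tr t) (Q *m tr_Gamma tr t) k0.
  have G : nsq (Q *m tr_Gamma tr t) / k <= a * E t.
    rewrite /a mulrAC ler_wpM2r ?invr_ge0 ?(ltW k0)// -mulrA.
    apply: le_trans (HQ _) _; rewrite ler_wpM2l//.
    apply: (le_trans (nsq_tr_Gamma_le tr HG (ltW t0))); rewrite ler_wpM2l//.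
    by apply: (dom_perturbation dom); rewrite ltW.
  have QMt := QM (tr_Z tr t).
  rewrite mulmxDr; under [in X in _ -> X]eq_bigr => i _ do rewrite [X in _ * X]mxE mulrDr.
  rewrite big_split/= mulrDr.
  by lra.
- by rewrite /M mulrDl divfK ?gt_eqF// lerDl mulr_ge0// ltW.
- apply: le_trans (HQ _) _; rewrite /M mulrDl -(mulrA CQ).
  rewrite -[leLHS]add0r lerD//; first by rewrite mulr_ge0// (dom_ge0 dom).
  rewrite ler_wpM2l// tr_Z0.
  have D00 : dirichlet (tr_dev tr 0) by exact: tr_dev_dirichlet.
  apply: le_trans (HX (tr_dev tr 0) _ _ D00) _; rewrite ler_wpM2l//.
  by apply: le_trans (dom_init dom); rewrite /tr_energy sqr_H10norm.
Qed.

(** On the window [t - D, t] either s < 0 and v(s) = 0, or v(s) = K Z(s), whose square is bounded by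
    a multiple of E(s) <= e^(rho D) E(t). This bounds the delay term, and X is Z minus that term. *)
Lemma tr_X_bound rho M : 0 <= M -> exists2 M' : R, 0 <= M' &
  forall tr T E E', dominates tr rho T E E' ->
  (forall t, 0 <= t <= T -> nsq (tr_Z tr t) <= M * E t) ->
  forall t, 0 <= t <= T ->
    tr_v tr (t - D) ^+ 2 <= M' * E t /\ nsq (tr_X tr t) <= M' * E t.
Proof.
move=> M0; have [CK CK0 HK] := nsq_mulmx_le K.
have [CW CW0 HW] := delay_term_bound A B (ltW D0).
pose K1 := CK * M * expR (rho * D).
have K10 : 0 <= K1 by rewrite !mulr_ge0// expR_ge0.
have CWK : 0 <= CW * K1 by rewrite mulr_ge0.
exists (K1 + 2 * (M + CW * K1)); first by rewrite addr_ge0// mulr_ge0// addr_ge0.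
move=> tr T E E' dom HZ t /andP[t0 tT]; have Et := dom_ge0 dom t.
have vb s : s \in `[t - D, t] -> tr_v tr s ^+ 2 <= K1 * E t.
  rewrite in_itv/= => /andP[ts st]; have [s0|s0] := ltP s 0.
    by rewrite (control_neg (tr_closed_loop tr) s0) expr0n mulr_ge0.
  rewrite (controlE L0 sp hK (tr_equilibrium tr) (tr_closed_loop tr) D0 s0).
  apply: le_trans (nsq_entry_le _ _) _; apply: le_trans (HK _) _.
  rewrite /K1 -!mulrA ler_wpM2l//.
  have sT : 0 <= s <= T by rewrite s0 (le_trans st).
  apply: le_trans (HZ s sT) _; rewrite ler_wpM2l//.
  exact: dom_delay dom _ _ ts st.
have vD : tr_v tr (t - D) ^+ 2 <= K1 * E t.
  by apply: vb; rewrite in_itv/= lexx gerBl ltW.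
have K1E : 0 <= K1 * E t by rewrite mulr_ge0.
have W : nsq (delay_term A B D (tr_v tr) t) <= CW * (K1 * E t).
  rewrite -[K1 * E t](sqr_sqrtr K1E); apply: HW => [|s ts]; first exact: tr_v_causal.
  rewrite -(@ler_pXn2r _ 2)// ?nnegrE ?sqrtr_ge0// real_normK ?num_real//.
  by rewrite sqr_sqrtr//; exact: vb.
split.
  apply: le_trans vD _; rewrite ler_wpM2r// lerDl mulr_ge0// addr_ge0//.
have -> : tr_X tr t = tr_Z tr t + - delay_term A B D (tr_v tr) t by rewrite tr_ZE addrK.
apply: le_trans (nsqD_le _ _) _; rewrite nsqN.
have := HZ t; rewrite t0 tT => /(_ isT) Z.
by move: K1E W Z; clearbody K1; lra.
Qed.

(** With f_j the coefficients of the forcing, the derivative of - lam_j w_j^2 is - 2 (lam_j w_j)^2 -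
    2 lam_j w_j f_j <= - (lam_j w_j)^2 + f_j^2, and (lam_j w_j)^2 >= (- lam_n) (- lam_j w_j^2).
    Bessel bounds the sum of the f_j^2 independently of N. The delayed control belongs to the
    forcing, hence the hypothesis on v. *)
Lemma tr_tail_bound rho M : 0 < rho < - lam n -> 0 <= M -> exists2 M' : R, 0 <= M' &
  forall tr T E E', dominates tr rho T E E' ->
  (forall t, 0 <= t <= T ->
    tr_v tr (t - D) ^+ 2 <= M * E t /\ nsq (tr_X tr t) <= M * E t) ->
  forall N t, 0 <= t <= T ->
    \sum_(n <= j < N) (- lam j * ip L (tr_dev tr t) (e j) ^+ 2) <= M' * E t.
Proof.
move=> /andP[rho0 rhol] M0; have [CS CS0 HS] := stable_energy_le L0 Lc sp un.
have La := afun_L2 L0 Lc; have Lb := bfun_L2 L0.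
set pa := ip L (afun L c) (afun L c); set pb := ip L (bfun L) (bfun L).
have pa0 : 0 <= pa by exact: ip_ge0.
have pb0 : 0 <= pb by exact: ip_ge0.
(* Two applications of |f + g|^2 <= 2 (|f|^2 + |g|^2) to the forcing, made of the u_D, v_D and d
   terms. *)
pose a := 2 * (2 * (M * pa + M * pb) + 1).
have a0 : 0 <= a by rewrite !(mulr_ge0, addr_ge0).
have lr : 0 < - lam n - rho by rewrite subr_gt0.
have M1 : 0 <= a / (- lam n - rho) by rewrite divr_ge0// ltW.
exists (a / (- lam n - rho) + CS); first exact: addr_ge0.
move=> tr T E E' dom HX N t tT.
have sumE (F : nat -> R) : \sum_(n <= j < N) F j = \sum_(j < N - n) F (j + n)%N.
  by rewrite -{1}[n]add0n big_addn big_mkord.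
pose F t x := (uD D (tr_v tr) t - u_e D c e lam K (tr_re tr) (tr_de tr)) * afun L c x
  + tr_v tr (t - D) * bfun L x + (tr_d tr t x - tr_de tr x).
have Ld t0 (t0' : 0 <= t0) : L2 L (tr_d tr t0) := (tr_d_C1 tr).1 t0 t0'.
rewrite sumE; move: t tT.
apply: (dominates_comparison (a := a) (mu := - lam n) (h' := fun t =>
  \sum_(j < N - n) (2 * - lam (j + n)%N * ip L (tr_dev tr t) (e (j + n)%N) *
    (lam (j + n)%N * ip L (tr_dev tr t) (e (j + n)%N) + ip L (F t) (e (j + n)%N)))) dom).
- apply: continuous_halfline_sum => j; apply: continuous_halflineM.
    exact: continuous_halfline_cst.
  have cj := tr_coef_continuous (tr := tr) (j := (j + n)%N).
  have := continuous_halflineM cj cj.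
  by congr continuous_halfline; apply/funext => s; rewrite expr2.
- move=> t t0 tT tD; have t0' := ltW t0.
  have Lu := L2Z (uD D (tr_v tr) t - u_e D c e lam K (tr_re tr) (tr_de tr)) La.
  have Lv := L2Z (tr_v tr (t - D)) Lb.
  have Luv := L2D Lu Lv.
  have Ldd := L2B (Ld t t0') (tr_de_L2 tr).
  have LF : L2 L (F t) by exact: L2D.
  have FE j : ip L (F t) (e j) =
      acoef c e j * (uD D (tr_v tr) t - u_e D c e lam K (tr_re tr) (tr_de tr))
      + ip L (fun x => tr_d tr t x - tr_de tr x) (e j) + bcoef e j * tr_v tr (t - D).
    have Lej := h2_L2 L0 (e j).
    rewrite [LHS](ipDl Luv Ldd Lej) (ipDl Lu Lv Lej) (ipZl _ La Lej) (ipZl _ Lb Lej) /acoef /bcoef.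
    by ring.
  split.
    apply: is_derive_sumr => j.
    have dj := coef_deviation_derive L0 Lc sp un hK (tr_de_L2 tr) (tr_equilibrium tr)
      Ld (tr_closed_loop tr) D0 (j + n)%N t0 tD.
    have := is_derive_mulr (is_derive_cst (- lam (j + n)%N) t 1) (is_derive_mulr dj dj).
    move=> H; apply: is_derive_eq H _.
    by rewrite FE /tr_dev /cst; ring.
  have FF : ip L (F t) (F t) <= a * E t.
    apply: le_trans (ip_sqrD Luv Ldd) _; rewrite /a -mulrA ler_wpM2l// mulrDl mul1r lerD//.
      apply: le_trans (ip_sqrD Lu Lv) _; rewrite -mulrA ler_wpM2l//.
      have [Hv HX'] : tr_v tr (t - D) ^+ 2 <= M * E t /\ nsq (tr_X tr t) <= M * E t.
        by apply: HX; rewrite t0'.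
      have Hu : (uD D (tr_v tr) t - u_e D c e lam K (tr_re tr) (tr_de tr)) ^+ 2 <= M * E t.
        apply: le_trans HX'; rewrite nsq_state -addrA lerDl addr_ge0 ?sqr_ge0//.
        by apply: sumr_ge0 => j _; exact: sqr_ge0.
      rewrite (ip_scale _ La) (ip_scale _ Lb).
      apply: le_trans (lerD (ler_wpM2r pa0 Hu) (ler_wpM2r pb0 Hv)) _.
      by rewrite -!mulrDr mulrAC.
    rewrite -sqr_l2norm; apply: le_trans (dom_perturbation dom _); last by rewrite t0'.
    by rewrite /tr_perturbation lerDr sqr_ge0.
  have := bessel_tail N LF; rewrite sumE => HB.
  apply: le_trans (lerD (lexx _) FF); apply: le_trans (lerD (lexx _) HB).
  rewrite mulr_sumr -big_split/=; apply: ler_sum => j _.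
  have ln := stable_lt0 un; have lj := stable_le un (leq_addl j n).
  move: (ip L (tr_dev tr t) _) (ip L (F t) _) (lam (j + n)%N) lj => x f l lj.
  have l0 : 0 <= - l by lra.
  have := sqr_ge0 (l * x + f).
  have ll : 0 <= lam n - l by rewrite subr_ge0.
  have := mulr_ge0 (mulr_ge0 l0 ll) (sqr_ge0 x).
  by nra.
- exact: addr_ge0.
- by rewrite mulrDl divfK ?gt_eqF// lerDl mulr_ge0// ltW.
- rewrite -(sumE (fun j => - lam j * ip L (tr_dev tr 0) (e j) ^+ 2)).
  have D00 : dirichlet (tr_dev tr 0) by exact: tr_dev_dirichlet.
  apply: le_trans (HS _ N D00) _.
  rewrite mulrDl -[leLHS]add0r lerD//; first by rewrite mulr_ge0// (dom_ge0 dom).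
  rewrite ler_wpM2l//.
  apply: le_trans (dom_init dom); rewrite /tr_energy sqr_H10norm//.
  by rewrite lerDr addr_ge0 ?sqr_ge0.
Qed.

Lemma tr_energy_bound : exists2 rho : R, 0 < rho & exists2 M : R, 0 <= M &
  forall tr T E E', 0 <= T -> dominates tr rho T E E' -> tr_energy tr T <= M * E T.
Proof.
have [k k0 HZ] := tr_Z_bound; have l0 := stable_lt0 un.
(* Half of the minimum keeps a positive gap to both k and - lam n; the constants divide by these
   gaps. *)
pose rho := Num.min k (- lam n) / 2.
have m0 : 0 < Num.min k (- lam n) by rewrite lt_min k0 oppr_gt0.
have rho0 : 0 < rho by rewrite divr_gt0.
have rhom : rho < Num.min k (- lam n) by rewrite /rho; move: m0; lra.
have [rk rl] : rho < k /\ rho < - lam n.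
  by move: rhom; rewrite lt_min => /andP.
have [M1 M10 HM1] := HZ rho (introT andP (conj rho0 rk)).
have [M2 M20 HM2] := tr_X_bound rho M10.
have [M3 M30 HM3] := tr_tail_bound (introT andP (conj rho0 rl)) M20.
have [CE CE0 HE] := energy_le L0 Lc sp un.
exists rho => //; exists (M2 + CE * (M3 + M2)).
  by rewrite addr_ge0// mulr_ge0// addr_ge0.
move=> tr T E E' T0 dom.
have HX := HM2 _ _ _ _ dom (HM1 _ _ _ _ dom).
have TT : 0 <= T <= T by rewrite T0 lexx.
have HT N := HM3 _ _ _ _ dom HX N T TT.
have [_ XT] := HX T TT.
have M3E : 0 <= M3 * E T by rewrite mulr_ge0// (dom_ge0 dom).
have := HE _ _ (tr_dev_dirichlet tr T0) M3E HT.
rewrite /tr_energy sqr_H10norm// => H.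
move: XT; rewrite nsq_state -/(tr_dev tr T) => XT.
have S0 : 0 <= \sum_(j < n) ip L (tr_dev tr T) (e j) ^+ 2.
  by apply: sumr_ge0 => j _; exact: sqr_ge0.
have := sqr_ge0 (uD D (tr_v tr) T - u_e D c e lam K (tr_re tr) (tr_de tr)).
have := sqr_ge0 (zeta D e lam n (tr_v tr) (tr_y tr) (tr_z tr) T -
  zeta_e D c e lam K (tr_re tr) (tr_de tr)).
move: (_ ^+ 2) XT => z2; move: (_ ^+ 2) => u2 XT z20 u20.
rewrite mulrDl; apply: lerD; first by move: XT; lra.
apply: le_trans H _; rewrite -mulrA ler_wpM2l// mulrDl lerD2l.
by move: XT; lra.
Qed.

(** The hypothesis on sigma says that the perturbation at s is at most sigma e^(eps rho (T - s)),
    the second summand of the gauge. Since eps rho <= rho, both summands decay at most at the rate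
    rho and are larger by at most e^(rho D) one delay earlier. *)
Lemma envelope_dominates tr (rho eps T sigma : R) : 0 < rho -> 0 <= eps < 1 -> 0 <= T ->
  0 <= sigma ->
  (forall s, 0 <= s <= T ->
    expR (- (eps * rho * (T - s))) * tr_perturbation tr s <= sigma) ->
  let tau := sigma * expR (eps * rho * T) in
  dominates tr rho T
    (fun s => tr_energy tr 0 * expR (- rho * s) + tau * expR (- (eps * rho) * s))
    (fun s => tr_energy tr 0 * (- rho * expR (- rho * s)) +
      tau * (- (eps * rho) * expR (- (eps * rho) * s))).
Proof.
move=> rho0 /andP[eps0 eps1] T0 sigma0 Hs tau.
have P0 := tr_energy_ge0 tr 0.
have tau0 : 0 <= tau by rewrite mulr_ge0// expR_ge0.
have er : eps * rho <= rho by rewrite ger_pMl// ltW.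
have er0 : 0 <= eps * rho by rewrite mulr_ge0// ltW.
split.
- move=> t.
  have d1 := is_derive_expRM (- rho) t; have d2 := is_derive_expRM (- (eps * rho)) t.
  have := is_derive_affine (tr_energy tr 0) 0 d1
    (is_derive_affine tau 0 d2 (is_derive_cst (0 : R) t 1)).
  rewrite !addr0; congr is_derive; apply/funext => s.
  by rewrite /cst /= addr0 !subr0.
- by move=> t; rewrite addr_ge0// mulr_ge0// expR_ge0.
- move=> t; rewrite mulrDr lerD// mulrCA ler_wpM2l//.
  by rewrite ler_wpM2r ?expR_ge0// lerN2.
- move=> s t Ds st; rewrite mulrDr; apply: lerD; rewrite mulrCA ler_wpM2l//.
    rewrite -expRD ler_expR; nra.
  rewrite -expRD ler_expR.
  have : eps * rho * (t - s) <= rho * (t - s) by rewrite ler_wpM2r// subr_ge0.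
  have : rho * (t - s) <= rho * D by rewrite ler_wpM2l ?(ltW rho0)//; lra.
  by lra.
- by rewrite !mulr0 expR0 !mulr1 lerDl.
- move=> s sT; apply: le_trans (_ : tau * expR (- (eps * rho) * s) <= _); last first.
    by rewrite lerDr mulr_ge0// expR_ge0.
  have H := Hs s sT; rewrite /tau -[leRHS]mulrA -expRD.
  have := ler_wpM2r (expR_ge0 (eps * rho * T + - (eps * rho) * s)) H.
  rewrite mulrAC -expRD (_ : _ + _ = 0) ?expR0 ?mul1r//.
  by ring.
Qed.

End Estimates.

Theorem theorem1 (R : realType) (L D : R) (c : R -> R) (e : nat -> H2 L)
    (lam : nat -> R) (n : nat) (K : 'rV[R]_(1 + n + 1)) :
  0 < L -> 0 < D -> Linfty L c ->
  spectral_data c e lam -> unstable_count lam n ->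
  hurwitz (AK D c e lam K) ->
  exists kappa C1 : R, [/\ 0 < kappa, 0 < C1 &
    forall eps : R, 0 <= eps < 1 -> exists2 C2 : R, 0 < C2 &
      forall (re : R) (de : R -> R) (we : H2 L),
        L2 L de -> equilibrium_profile D c e lam K re de we ->
      forall (r : R -> R) (d : R -> R -> R) (y0 : H2 L) (z0 : R),
        {within `[0, +oo[, continuous r} -> L2_C1 L d -> dirichlet y0 ->
      forall (v : R -> R) (y : R -> H2 L) (z : R -> R),
        closed_loop D c e lam v y z K r d y0 z0 ->
      let ue := u_e D c e lam K re de in
      let zetae := zeta_e D c e lam K re de in
      let energy (t : R) : R :=
        (uD D v t - ue) ^+ 2
        + (zeta D e lam n v y z t - zetae) ^+ 2
        + H10norm L (fun x => wfun D v y t x - we x) ^+ 2 in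
      forall t : R, 0 <= t ->
        energy t <= C1 * expR (- (2 * kappa * t)) * energy 0
          + C2 * sup [set expR (- (2 * eps * kappa * (t - s)))
                      * ((r s - re) ^+ 2
                         + l2norm L (fun x => d s x - de x) ^+ 2)
                     | s in `[0, t]]].
Proof.
move=> L0 D0 Lc sp un hK.
have [rho rho0 [M M0 HM]] := tr_energy_bound L0 D0 Lc sp un hK.
(* The exponent of the statement is 2 kappa, hence rho / 2. M + 1 is positive, and it serves as C2
   for every eps. *)
exists (rho / 2), (M + 1); split; [exact: divr_gt0|exact: ltr_wpDl|].
move=> eps eps01; exists (M + 1); first exact: ltr_wpDl.
move=> re de we Lde Ewe r d y0 z0 cr dC1 Dy0 v y z cl ue zetae energy t t0.
pose tr := Trajectory Lde Ewe cr dC1 cl.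
set S := [set _ | _ in _].
have E2 : 2 * (rho / 2) = rho by field.
have SE s : 2 * eps * (rho / 2) * (t - s) = eps * rho * (t - s) by field.
(* [sup] of an unbounded set is 0 by convention, so a bound comes first: the weighted perturbation
   is continuous on the compact [0, t]. *)
have Sup : has_ubound S.
  have cf : continuous_halfline (fun s => expR (- (eps * rho * t)) *
      (expR (eps * rho * s) * tr_perturbation tr s)).
    apply: continuous_halflineM; first exact: continuous_halfline_cst.
    apply: continuous_halflineM; last exact: tr_perturbation_continuous.
    exact/continuous_halflineT/continuous_expRM.
  have [m _ mM] := EVT_max t0 (continuous_halfline_within (b := t) cf (lexx 0)).
  exists (expR (- (eps * rho * t)) * (expR (eps * rho * m) * tr_perturbation tr m)).
  move=> _ [s st <-]; apply: le_trans (mM s st).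
  rewrite [leRHS]mulrA -expRD SE.
  rewrite (_ : - (eps * rho * t) + eps * rho * s = - (eps * rho * (t - s)))//.
  by ring.
have Sle s : 0 <= s <= t ->
    expR (- (eps * rho * (t - s))) * tr_perturbation tr s <= sup S.
  move=> st; apply: ub_le_sup => //; exists s; last by rewrite SE.
  by rewrite /= in_itv.
have S0 : 0 <= sup S.
  apply: le_trans (Sle 0 _); last by rewrite lexx.
  by rewrite mulr_ge0 ?expR_ge0// tr_perturbation_ge0.
(* The horizon is t itself and sigma is the supremum; at s = t the two exponentials in its
   coefficient cancel. *)
have := HM tr t _ _ t0 (envelope_dominates L0 rho0 eps01 t0 S0 Sle).
rewrite -[tr_energy L0 tr t]/(energy t) -[tr_energy L0 tr 0]/(energy 0).
rewrite -(mulrA (sup S)) -expRD (_ : eps * rho * t + - (eps * rho) * t = 0); last by ring.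
rewrite expR0 mulr1 E2 mulNr => /le_trans; apply.
have En0 : 0 <= energy 0 := tr_energy_ge0 L0 tr 0.
have x0 := expR_ge0 (- (rho * t)); have := mulr_ge0 x0 En0.
by move: (expR _) (energy 0) (sup S) S0 => x p s s0; lra.
Qed.
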